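(* Suppose that $\Omega\subset\mathbb{P}(\mathbb{R}^d)$ is a properly convex domain and $\Gamma\le\mathrm{Aut}(\Omega)$ is a convex co-compact subgroup. If $\mathcal{X}$ is a $\Gamma$-invariant collection of closed unbounded convex subsets of $\mathcal{C}_\Omega(\Gamma)$, then the following are equivalent: (1) $\mathcal{X}$ is a peripheral family of $(\Omega,\mathcal{C}_\Omega(\Gamma),\Gamma)$. (2) $\mathcal{X}$ has the following properties: (a) $\mathcal{X}$ is closed in the local Hausdorff topology induced by the Hilbert metric $d_\Omega$. (b) If $X_1,X_2\in\mathcal{X}$ are distinct, then $\partial_iX_1\cap\partial_iX_2=\emptyset$. (c) If $\ell\subset\partial_i\mathcal{C}_\Omega(\Gamma)$ is a non-trivial line segment, then $\ell\subset\partial_iX$ for some $X\in\mathcal{X}$. Moreover, when $\mathcal{X}$ is a peripheral family of $(\Omega,\mathcal{C}_\Omega(\Gamma),\Gamma)$ (equivalently, when $\mathcal{X}$ has properties (a), (b) and (c)), then $$[\partial_i\mathcal{C}_\Omega(\Gamma)]_{\mathcal{P}}=[\partial_i\mathcal{C}_\Omega(\Gamma)]_{\mathcal{X}},$$ where $\mathcal{P}$ is a set of representatives of the $\Gamma$-conjugacy classes in $\{\mathrm{Stab}_\Gamma(X):X\in\mathcal{X}\}$.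
   Context: A properly convex domain $\Omega\subset\mathbb{P}(\mathbb{R}^d)$ is an open subset which is a bounded convex subset of some affine chart; $\mathrm{Aut}(\Omega)\le\mathrm{PGL}_d(\mathbb{R})$ is the group of projective automorphisms preserving $\Omega$. The Hilbert metric on $\Omega$ is $d_\Omega(x,y)=\frac12\log\frac{|x-b||y-a|}{|x-a||y-b|}$ for $x\ne y$, where $a,b$ are the points of $\partial\Omega$ on the projective line through $x,y$, ordered $a,x,y,b$. For $A\subset\Omega$, $r>0$: $\mathcal{N}_\Omega(A,r)=\{x\in\Omega:d_\Omega(x,A)<r\}$, $\mathrm{diam}_\Omega$ is the $d_\Omega$-diameter; ''unbounded'' refers to $d_\Omega$ and ''closed'' means closed in $\Omega$. For $x\in\overline\Omega$, $F_\Omega(x)=\{x\}\cup\{y\in\overline\Omega:\text{there is an open line segment in }\overline\Omega\text{ containing }x\text{ and }y\}$, and $F_\Omega(A)=\bigcup_{x\in A}F_\Omega(x)$. For a closed convex $\mathcal{C}\subset\Omega$, $\partial_i\mathcal{C}=\overline{\mathcal{C}}\cap\partial\Omega$. The limit set of $G\le\mathrm{Aut}(\Omega)$ is $\mathcal{L}_\Omega(G)=\partial\Omega\cap\bigcup_{p\in\Omega}\overline{G\cdot p}$. $\mathcal{C}_\Omega(G)$ is the closed convex hull of $\mathcal{L}_\Omega(G)$ in $\Omega$, i.e. $\Omega\cap\bigcap\{Y:Y\text{ closed convex},\ \mathcal{L}_\Omega(G)\subset Y\subset\overline\Omega\}$. A discrete subgroup $\Gamma\le\mathrm{Aut}(\Omega)$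 is convex co-compact if $\mathcal{C}_\Omega(\Gamma)\neq\emptyset$ and $\Gamma\backslash\mathcal{C}_\Omega(\Gamma)$ is compact. A $k$-dimensional simplex is the image under an element of $\mathrm{PGL}_d(\mathbb{R})$ of $\{[x_1:\dots:x_{k+1}:0:\dots:0]:x_1,\dots,x_{k+1}>0\}$; a simplex $S\subset\mathcal{C}$ is properly embedded if $S\hookrightarrow\mathcal{C}$ is proper. For $\mathcal{C}=\mathcal{C}_\Omega(\Gamma)$, a peripheral family of $(\Omega,\mathcal{C},\Gamma)$ is a collection $\mathcal{X}$ of closed unbounded convex subsets of $\mathcal{C}$ such that: (i) $\Gamma\cdot\mathcal{X}=\mathcal{X}$; (ii) for every $r>0$ there is $D_1(r)>0$ with $\mathrm{diam}_\Omega(\mathcal{N}_\Omega(X_1,r)\cap\mathcal{N}_\Omega(X_2,r))\le D_1(r)$ for all distinct $X_1,X_2\in\mathcal{X}$; (iii) there is $D_2>0$ such that every properly embedded simplex $S\subset\mathcal{C}$ of dimension at least two lies in $\mathcal{N}_\Omega(X,D_2)$ for some $X\in\mathcal{X}$. The local Hausdorff topology on the non-empty closed subsets of a metric space $(Y,d)$ is generated by the sets $U(C_0,x_0,r_0,\epsilon_0)=\{C\subset Y\text{ closed}: d^{\mathrm{Haus}}_Y(C_0\cap\mathcal{B}_Y(x_0,r_0),\,C\cap\mathcal{B}_Y(x_0,r_0))<\epsilon_0\}$, where $\mathcal{B}_Y(x_0,r_0)$ is the open ball, $C_0$ is a non-empty closed set, $x_0\in Y$ and $r_0,\epsilon_0>0$.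 $\mathrm{Stab}_\Gamma(X)=\{\gamma\in\Gamma:\gamma X=X\}$. $[\partial_i\mathcal{C}]_{\mathcal{X}}$ is the topological quotient of $\partial_i\mathcal{C}$ by the relation $x\sim y$ iff either $x,y\in F_\Omega(\partial_iX)$ for some $X\in\mathcal{X}$, or $F_\Omega(x)=F_\Omega(y)$. $[\partial_i\mathcal{C}]_{\mathcal{P}}$ is the quotient obtained by collapsing each limit set $\mathcal{L}_\Omega(\gamma P\gamma^{-1})$ ($\gamma\in\Gamma$, $P\in\mathcal{P}$) to a point.
   Formalization: In the local Hausdorff topology, the basic set U(C_0,x_0,r_0,ε_0) is taken only when C_0 meets the ball and contains only those C that meet it; if two empty sets had Hausdorff distance 0, (2) would not imply (1). *)

(* Defs.v *)
From HB Require Import structures.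
From Stdlib Require Import Relation_Operators.
From mathcomp Require Import all_boot all_order all_algebra.
From mathcomp Require Import all_classical all_reals all_analysis.

Set Implicit Arguments.
Unset Strict Implicit.
Unset Printing Implicit Defensive.

Import Order.TTheory GRing.Theory Num.Theory.
Import numFieldNormedType.Exports.

Local Open Scope classical_set_scope.
Local Open Scope ring_scope.
Local Open Scope quotient_scope.

(* Topological quotient by the equivalence relation generated by [r]. *)
Section Quotient.
Variables (T : topologicalType) (r : T -> T -> Prop).

Definition gen_equiv : rel T := fun x y => `[< clos_refl_sym_trans T r x y >].

Lemma gen_equiv_refl : reflexive gen_equiv.
Proof. by move=> x; apply/asboolP; exact: rst_refl. Qed.

Lemma gen_equiv_sym : symmetric gen_equiv.
Proof.
by move=> x y; apply/idP/idP => /asboolP h; apply/asboolP; exact: rst_sym.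
Qed.

Lemma gen_equiv_trans : transitive gen_equiv.
Proof.
move=> y x z /asboolP xy /asboolP yz; apply/asboolP.
exact: rst_trans xy yz.
Qed.

Definition gen_equiv_rel : equiv_rel T :=
  EquivRel gen_equiv gen_equiv_refl gen_equiv_sym gen_equiv_trans.

Definition quot_by : Type := quotient_topology {eq_quot gen_equiv_rel}.
HB.instance Definition _ := Topological.on quot_by.
HB.instance Definition _ := Quotient.on quot_by.

Definition qpi (x : T) : quot_by := \pi_quot_by x.

Definition qrepr (p : quot_by) : T := repr p.

Lemma qreprK (p : quot_by) : qpi (qrepr p) = p.
Proof. exact: reprK. Qed.

Lemma eq_qpi (x y : T) : qpi x = qpi y <-> clos_refl_sym_trans T r x y.
Proof.
split=> [|xy]; last by apply/eqmodP/asboolP.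
by move=> /(@eqmodP _ gen_equiv_rel) /asboolP.
Qed.

Lemma eq_qpi_equiv (x y : T) :
  (forall x, r x x) -> (forall x y, r x y -> r y x) ->
  (forall x y z, r x y -> r y z -> r x z) ->
  qpi x = qpi y <-> r x y.
Proof.
move=> rr rs rt; rewrite eq_qpi; split; last exact: rst_step.
by elim=> {x y} // [x y _|x y z _ xy _ yz]; [exact: rs|exact: rt xy yz].
Qed.

End Quotient.

(* Equality of two quotients of the same space [T]: a homeomorphism that
   commutes with the projections from [T]. *)
Definition same_quotient (T : topologicalType) (r s : T -> T -> Prop) : Prop :=
  exists (h : quot_by r -> quot_by s) (k : quot_by s -> quot_by r),
    [/\ cancel h k, cancel k h, continuous h, continuous k
      & forall x : T, h (qpi r x) = qpi s x].

Definition boundary (T : topologicalType) (A : set T) : set T :=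
  closure A `\` A°.

Definition closed_in (T : topologicalType) (U A : set T) : Prop :=
  A `<=` U /\ closure A `&` U `<=` A.

Section Projective.
Variables (R : realType) (d : nat).

Definition nonzero : set 'cV[R]_d := [set v | v != 0].

Definition proportional_vec (u v : nonzero) : Prop :=
  exists2 c : R, c != 0 & \val u = c *: \val v.

Definition pspace : Type := quot_by proportional_vec.
HB.instance Definition _ := Topological.on pspace.

Definition pt (v : nonzero) : pspace := qpi proportional_vec v.

Definition vec (p : pspace) : nonzero := @qrepr _ proportional_vec p.

Definition invertible : set 'M[R]_d := [set A | A \in unitmx].

Definition proportional_mx (A B : invertible) : Prop :=
  exists2 c : R, c != 0 & \val A = c *: \val B.

Definition PGL : Type := quot_by proportional_mx.
HB.instance Definition _ := Topological.on PGL.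

Definition pgl (A : invertible) : PGL := qpi proportional_mx A.

Definition mx (g : PGL) : invertible := @qrepr _ proportional_mx g.

Lemma vecK p : pt (vec p) = p. Proof. exact: qreprK. Qed.

Lemma mxK g : pgl (mx g) = g. Proof. exact: qreprK. Qed.

Lemma eq_pt u v : pt u = pt v <-> proportional_vec u v.
Proof.
apply: eq_qpi_equiv => [x|x y [c c0 xy]|x y z [a a0 xy] [b b0 yz]].
- by exists 1; rewrite ?oner_neq0 // scale1r.
- by exists c^-1; rewrite ?invr_neq0 // xy scalerA mulVf // scale1r.
- by exists (a * b); rewrite ?mulf_neq0 // xy yz scalerA.
Qed.

Lemma eq_pgl A B : pgl A = pgl B <-> proportional_mx A B.
Proof.
apply: eq_qpi_equiv => [x|x y [c c0 xy]|x y z [a a0 xy] [b b0 yz]].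
- by exists 1; rewrite ?oner_neq0 // scale1r.
- by exists c^-1; rewrite ?invr_neq0 // xy scalerA mulVf // scale1r.
- by exists (a * b); rewrite ?mulf_neq0 // xy yz scalerA.
Qed.

Lemma invertible1 : (1%:M : 'M[R]_d) \in invertible.
Proof. by apply/mem_set; exact: unitmx1. Qed.

Lemma invertibleM (A B : invertible) : \val A *m \val B \in invertible.
Proof.
apply/mem_set; rewrite /invertible /= unitmx_mul.
by apply/andP; split; exact: (@set_valP _ invertible).
Qed.

Lemma invertibleV (A : invertible) : invmx (\val A) \in invertible.
Proof.
apply/mem_set; rewrite /invertible /= unitmx_inv.
exact: (@set_valP _ invertible).
Qed.

Lemma nonzeroM (A : invertible) (v : nonzero) : \val A *m \val v \in nonzero.
Proof.
apply/mem_set; apply: contra_neq (@set_valP _ nonzero v) => Av0.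
by rewrite -[LHS](mulKmx (@set_valP _ invertible A)) Av0 mulmx0.
Qed.

Definition mulGL (A B : invertible) : invertible := SigSub (invertibleM A B).
Definition invGL (A : invertible) : invertible := SigSub (invertibleV A).
Definition actGL (A : invertible) (v : nonzero) : nonzero :=
  SigSub (nonzeroM A v).

Definition PGL_one : PGL := pgl (SigSub invertible1).
Definition PGL_mul (g h : PGL) : PGL := pgl (mulGL (mx g) (mx h)).
Definition PGL_inv (g : PGL) : PGL := pgl (invGL (mx g)).
Definition act (g : PGL) (p : pspace) : pspace := pt (actGL (mx g) (vec p)).

Lemma PGL_mulE A B : PGL_mul (pgl A) (pgl B) = pgl (mulGL A B).
Proof.
have [a a0 eA] := (eq_pgl _ _).1 (mxK (pgl A)).
have [b b0 eB] := (eq_pgl _ _).1 (mxK (pgl B)).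
apply/eq_pgl; exists (a * b); first by rewrite mulf_neq0.
by rewrite /= eA eB -scalemxAl -scalemxAr scalerA.
Qed.

Lemma PGL_invE A : PGL_inv (pgl A) = pgl (invGL A).
Proof.
have [a a0 eA] := (eq_pgl _ _).1 (mxK (pgl A)).
apply/eq_pgl; exists a^-1; first by rewrite invr_neq0.
by rewrite /= eA invmxZ // -?eA; exact: (set_valP (mx (pgl A))).
Qed.

Lemma actE A v : act (pgl A) (pt v) = pt (actGL A v).
Proof.
have [a a0 eA] := (eq_pgl _ _).1 (mxK (pgl A)).
have [b b0 ev] := (eq_pt _ _).1 (vecK (pt v)).
apply/eq_pt; exists (a * b); first by rewrite mulf_neq0.
by rewrite /= eA ev -scalemxAl -scalemxAr scalerA.
Qed.

Lemma PGL_mulA : associative PGL_mul.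
Proof.
move=> f g h; rewrite -[f]mxK -[g]mxK -[h]mxK !PGL_mulE; congr pgl.
by apply: val_inj; rewrite /= mulmxA.
Qed.

Lemma PGL_mul1 : left_id PGL_one PGL_mul.
Proof.
move=> f; rewrite -[f]mxK PGL_mulE; congr pgl.
by apply: val_inj; rewrite /= mul1mx.
Qed.

Lemma PGL_1mul : right_id PGL_one PGL_mul.
Proof.
move=> f; rewrite -[f]mxK PGL_mulE; congr pgl.
by apply: val_inj; rewrite /= mulmx1.
Qed.

Lemma PGL_mulV : left_inverse PGL_one PGL_inv PGL_mul.
Proof.
move=> f; rewrite -[f]mxK PGL_invE PGL_mulE; congr pgl.
by apply: val_inj; rewrite /= mulVmx //; exact: (set_valP (mx f)).
Qed.

Lemma PGL_Vmul : right_inverse PGL_one PGL_inv PGL_mul.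
Proof.
move=> f; rewrite -[f]mxK PGL_invE PGL_mulE; congr pgl.
by apply: val_inj; rewrite /= mulmxV //; exact: (set_valP (mx f)).
Qed.

HB.instance Definition _ :=
  isGroup.Build PGL PGL_mulA PGL_mul1 PGL_1mul PGL_mulV PGL_Vmul.

(* The affine chart of a nonzero linear form [f] is the complement of the
   hyperplane [f = 0], identified with the affine hyperplane [f = 1] by
   [chart_coord f]. *)
Definition lform (f : 'rV[R]_d) (p : pspace) : R := (f *m \val (vec p)) 0 0.

Definition affine_chart (f : 'rV[R]_d) : set pspace := [set p | lform f p != 0].

Definition chart_coord (f : 'rV[R]_d) (p : pspace) : 'cV[R]_d :=
  (lform f p)^-1 *: \val (vec p).

Definition convex_in_chart (f : 'rV[R]_d) (A : set pspace) : Prop :=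
  A `<=` affine_chart f /\ @convex_set R 'cV[R]_d (chart_coord f @` A).

Definition proj_convex (A : set pspace) : Prop :=
  exists2 f : 'rV[R]_d, f != 0 & convex_in_chart f A.

Definition properly_convex_in_chart (f : 'rV[R]_d) (A : set pspace) : Prop :=
  [/\ f != 0, convex_in_chart f A & bounded_set (chart_coord f @` A)].

Definition properly_convex_domain (Omega : set pspace) : Prop :=
  open Omega /\ exists f : 'rV[R]_d, properly_convex_in_chart f Omega.

Definition proj_line (x y : pspace) : set pspace :=
  [set p | exists a b : R,
    \val (vec p) = a *: \val (vec x) + b *: \val (vec y)].

(* Two points of projective space bound two segments, so a segment is not
   determined by its endpoints. *)
Definition line_segment (l : set pspace) : Prop :=
  connected l /\ exists x y : pspace, x <> y /\ l `<=` proj_line x y.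

Definition nontrivial_segment (l : set pspace) : Prop :=
  line_segment l /\ exists x y : pspace, [/\ l x, l y & x <> y].

Definition open_segment (l : set pspace) : Prop :=
  connected l /\
  exists x y : pspace, x <> y /\
    exists2 U : set pspace, open U & l = proj_line x y `&` U.

Definition std_simplex (k : nat) : set pspace :=
  [set pt v | v in [set v : nonzero | forall i : 'I_d,
     if (i <= k)%N then 0 < \val v i 0 else \val v i 0 == 0]].

Definition simplex (k : nat) (S : set pspace) : Prop :=
  (k < d)%N /\ exists g : PGL, S = act g @` std_simplex k.

Definition properly_embedded (C S : set pspace) : Prop :=
  S `<=` C /\
  forall K : set pspace, K `<=` C -> compact K -> compact (S `&` K).

Section Domain.
Variable Omega : set pspace.

(* The quotient of lengths is taken in an affine chart in which [Omega] is
   bounded, where collinear [a, x, y, b] occur in this order; being a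
   cross-ratio, it depends neither on the chart nor on the norm. *)
Definition hilbert_value (x y : pspace) : set R := [set r |
  exists (f : 'rV[R]_d) (a b : pspace), [/\ properly_convex_in_chart f Omega,
    boundary Omega a, boundary Omega b &
    let A := chart_coord f a in let B := chart_coord f b in
    let X := chart_coord f x in let Y := chart_coord f y in
    (exists s t : R, [/\ 0 < s, s < t, t < 1,
       X = A + s *: (B - A) & Y = A + t *: (B - A)]) /\
    r = 2^-1 * ln ((`|X - B| * `|Y - A|) / (`|X - A| * `|Y - B|))]].

Definition hilbert_dist (x y : pspace) : R :=
  if x == y then 0 else xget 0 (hilbert_value x y).

Definition hdist_set (x : pspace) (A : set pspace) : \bar R :=
  ereal_inf [set (hilbert_dist x a)%:E | a in A].

Definition hnbhd (A : set pspace) (r : R) : set pspace :=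
  [set x | Omega x /\ (hdist_set x A < r%:E)%E].

Definition hball (x : pspace) (r : R) : set pspace :=
  [set y | Omega y /\ hilbert_dist x y < r].

Definition hdiam (A : set pspace) : \bar R :=
  ereal_sup [set (hilbert_dist x y)%:E | x in A & y in A].

Definition unbounded (A : set pspace) : Prop := hdiam A = +oo%E.

Definition hausdorff_dist (A B : set pspace) : \bar R :=
  maxe (ereal_sup [set hdist_set a B | a in A])
       (ereal_sup [set hdist_set b A | b in B]).

Definition closed_subset : Type :=
  {C : set pspace | C !=set0 /\ closed_in Omega C}.
HB.instance Definition _ := gen_eqMixin closed_subset.
HB.instance Definition _ := gen_choiceMixin closed_subset.

(* The Hausdorff distance is a distance between nonempty sets, so [C0] and the
   members of a basic set must meet the ball. Giving two empty sets distance [0]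
   would make missing an open ball an open condition on [C]; a line tangent to
   that ball would then not be a limit of nearby lines that cross it. *)
Definition hausdorff_basic (C0 : closed_subset) (x0 : pspace) (r0 e0 : R) :
    set closed_subset :=
  [set C | [/\ sval C0 `&` hball x0 r0 !=set0, sval C `&` hball x0 r0 !=set0
     & (hausdorff_dist (sval C0 `&` hball x0 r0) (sval C `&` hball x0 r0)
        < e0%:E)%E]].

Definition local_hausdorff_subbase : set (set closed_subset) := [set U |
  exists (C0 : closed_subset) (x0 : pspace) (r0 e0 : R),
    [/\ Omega x0, 0 < r0, 0 < e0 & U = hausdorff_basic C0 x0 r0 e0]].

HB.instance Definition _ :=
  isSubBaseTopological.Build closed_subset local_hausdorff_subbase id.

Definition local_hausdorff_closed (X : set (set pspace)) : Prop :=
  closed [set C : closed_subset | X (sval C)].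

Definition face (x : pspace) : set pspace := [set x] `|` [set y |
  closure Omega y /\ exists l : set pspace,
    [/\ open_segment l, l `<=` closure Omega, l x & l y]].

Definition faces (A : set pspace) : set pspace := \bigcup_(x in A) face x.

Definition ideal_boundary (C : set pspace) : set pspace :=
  closure C `&` boundary Omega.

Definition Aut : set PGL := [set g | act g @` Omega = Omega].

Definition limit_set (G : set PGL) : set pspace :=
  boundary Omega `&`
  \bigcup_(p in Omega) closure [set act g p | g in G].

Definition core (G : set PGL) : set pspace :=
  Omega `&` \bigcap_(Y in [set Y : set pspace | [/\ closed Y, proj_convex Y,
    limit_set G `<=` Y & Y `<=` closure Omega]]) Y.

Definition orbit_rel (G : set PGL) (C : set pspace) (x y : C) : Prop :=
  exists2 g, G g & act g (\val x) = \val y.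

Definition convex_cocompact (G : set PGL) : Prop :=
  [/\ group_closed [in G], G `<=` Aut, G `<=` isolated G, core G !=set0
    & compact [set: quot_by (@orbit_rel G (core G))]].

Definition invariant_family (G : set PGL) (X : set (set pspace)) : Prop :=
  [set act g @` Y | g in G & Y in X] = X.

Definition convex_family (C : set pspace) (X : set (set pspace)) : Prop :=
  forall Y, X Y ->
    [/\ Y `<=` C, closed_in Omega Y, unbounded Y & proj_convex Y].

Definition peripheral_family (C : set pspace) (G : set PGL)
    (X : set (set pspace)) : Prop :=
  [/\ convex_family C X,
      invariant_family G X,
      forall r : R, 0 < r -> exists2 D1 : R, 0 < D1 &
        forall X1 X2, X X1 -> X X2 -> X1 <> X2 ->
          (hdiam (hnbhd X1 r `&` hnbhd X2 r) <= D1%:E)%E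
    & exists2 D2 : R, 0 < D2 &
        forall (k : nat) (S : set pspace), (2 <= k)%N -> simplex k S ->
          properly_embedded C S -> exists2 Y, X Y & S `<=` hnbhd Y D2].

Definition family_stab (G : set PGL) (Y : set pspace) : set PGL :=
  [set g | G g /\ act g @` Y = Y].

Definition conj_subgroup (g : PGL) (P : set PGL) : set PGL :=
  [set (g * p * g^-1)%g | p in P].

Definition conj_representatives (G : set PGL) (H P : set (set PGL)) : Prop :=
  P `<=` H /\
  forall S, H S -> exists! S', P S' /\ exists2 g, G g & S = conj_subgroup g S'.

Definition family_rel (C : set pspace) (X : set (set pspace))
    (x y : ideal_boundary C) : Prop :=
  (exists2 Y, X Y & faces (ideal_boundary Y) (\val x) /\
                    faces (ideal_boundary Y) (\val y)) \/
  face (\val x) = face (\val y).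

Definition subgroup_rel (C : set pspace) (G : set PGL) (P : set (set PGL))
    (x y : ideal_boundary C) : Prop :=
  exists g S, [/\ G g, P S, limit_set (conj_subgroup g S) (\val x)
                & limit_set (conj_subgroup g S) (\val y)].

End Domain.
End Projective.

Arguments family_rel {R d} Omega C X x y.
Arguments subgroup_rel {R d} Omega C G P x y.

(* Main.v *)
Require Import Defs.
From Stdlib Require Import Relation_Operators.
From mathcomp Require Import all_boot all_order all_algebra.
From mathcomp Require Import all_classical all_reals all_analysis.
From mathcomp Require Import ring lra.

(** The statement is proved in the cone [O] over [Omega], with closed cone [K], instead of
    an affine chart. By the cross-ratio formula, two points are at Hilbert distance at
    most [r] iff vectors [u], [v] that represent them are comparable with constant
    [M = expR (2 * r)]: [a *: v - u] and [M *: u - a *: v] lie in [K] for some [a > 0]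
    ([hil], [hilbert_dist_le]). Comparability is linear, invariant under the group, passes
    to limits, and makes sense on the boundary, where it describes open faces. Compactness
    is used through ultrafilters: normalized vectors of [K] always converge, families of
    convex sets always have a limit ([ulim]), and cocompactness says that points of the
    core can be translated so as to converge in the core.

    (2) implies (1). The bound on overlaps is [overlap_of_closed]. If two members are close
    at points that go to infinity, their limits have comparable ideal points, so by (b)
    and (c) the limits, which are members by (a), are equal. With distinct members and
    unbounded overlaps this applies at one end of the overlap, and again at the point
    where the first member leaves the [2]-neighbourhood of the second one, which is
    incompatible with equal limits. For the covering of simplices, the edges of a
    properly embedded simplex lie in the ideal boundary of the core. By (c) they lie in
    members, which share a vertex and are equal by (b); that member contains the
    simplex ([vertices_in_member], [simplex_in_member]).

    (1) implies (2). A limit of members contains two points that are too far apart for an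
    overlap of distinct members, so a convergent family is eventually constant
    ([fam_isolated]); this gives (a). Rays of two members to a common ideal point stay at
    bounded distance, which gives (b) ([disjoint_of_overlap]). For (c), extend a segment of
    the boundary to a maximal segment of its open face, with endpoints [a] and [b], and
    consider the triangle with vertices [a], [b] and a point [p] of the core. Seen from
    points that go to the segment along a ray from [p], this triangle looks like a
    properly embedded one, since its sides through [p] recede. So each large ball around
    these points in the triangle is close to a member ([triangle_near]); by the bound on
    overlaps it is always the same member ([triangle_member]), and its closure comes
    within bounded distance of each point of the open segment ([triangle_trace]). The
    member does not depend on the segment through a given point, and a closed convex cone
    within bounded distance of every point of an open face contains that face
    ([face_sub_closure]). Hence the whole face is in the ideal boundary of one member
    ([face_in_member]).

    The quotients. Translating a ray of a member [Y] back into a bounded region gives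
    translates of [Y] that are eventually constant, so every ideal point of [Y] is a limit
    of the stabilizer of [Y] ([stab_limit]). Conversely, a limit of an orbit of the
    stabilizer is comparable to an ideal point of [Y], hence is one itself by (b) and (c)
    ([comparable_member]). So the limit set of the stabilizer is the ideal boundary of [Y]
    ([limit_set_stab]). The remaining identifications are those of points of one open face:
    two such points are joined by a segment of the boundary, and by (c) lie in the ideal
    boundary of one member. The two relations therefore generate the same equivalence
    ([same_boundary_quotient]). *)

Set Implicit Arguments.
Unset Strict Implicit.
Unset Printing Implicit Defensive.

Import Order.TTheory GRing.Theory Num.Theory.
Import numFieldNormedType.Exports.

Local Open Scope classical_set_scope.
Local Open Scope ring_scope.
Local Open Scope quotient_scope.

(** * Ultrafilters *)

#[export] Existing Instance ultra_proper.

Lemma ultra_compact_cvg (I : Type) (U : set_system I) {UU : UltraFilter U}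
    (T : topologicalType) (A : set T) (u : I -> T) :
  compact A -> (\forall i \near U, A (u i)) ->
  exists2 l, A l & u i @[i --> U] --> l.
Proof.
move=> cA UA.
have [l [Al cl]] := cA (u @ U) _ UA.
exists l => // W Wl; have [//|UnW] := in_ultra_setVsetC (u @^-1` W) UU.
by have [x []] := cl (~` W) W UnW Wl.
Qed.

Lemma ultra_itv_cvg (R : realType) (I : Type) (U : set_system I)
    {UU : UltraFilter U} (u : I -> R) (a b : R) :
  (\forall i \near U, a <= u i <= b) ->
  exists2 l, a <= l <= b & u i @[i --> U] --> l.
Proof.
move=> Uu; have := @ultra_compact_cvg _ U _ _ `[a, b]%classic u.
case; first exact: segment_compact.
  by apply: filterS Uu => i; rewrite /= in_itv.
by move=> l; rewrite /= in_itv/= => lab ul; exists l.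
Qed.

Lemma ultra_or (I : Type) (U : set_system I) {UU : UltraFilter U} (P : I -> Prop) :
  ~ (\forall i \near U, P i) -> \forall i \near U, ~ P i.
Proof. by have [] := in_ultra_setVsetC [set i | P i] UU. Qed.

Lemma near_ex (I : Type) (U : set_system I) {PU : ProperFilter U} (P : I -> Prop) :
  (\forall i \near U, P i) -> exists i, P i.
Proof. by move=> UP; have [i Pi] := @filter_ex _ _ _ _ UP; exists i. Qed.

(** Choice along a filter: the default value fills in the indices where no witness
    is available. *)
Lemma near_choice (I T : Type) (U : set_system I) {PU : ProperFilter U}
    (P : I -> T -> Prop) :
  (\forall i \near U, exists t, P i t) ->
  exists f : I -> T, \forall i \near U, P i (f i).
Proof.
move=> UP; have [i0 [t0 _]] := near_ex UP.
have /choice[f fP] : forall i, exists t, (exists t, P i t) -> P i t.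
  move=> i; have [[t Pt]|np] := pselect (exists t, P i t); first by exists t.
  by exists t0.
by exists f; apply: filterS UP => i; exact: fP.
Qed.

Lemma near_choice2 (I T : Type) (U : set_system I) {PU : ProperFilter U}
    (P Q : I -> T -> Prop) :
  (\forall i \near U, exists2 t, P i t & Q i t) ->
  exists f : I -> T, \forall i \near U, P i (f i) /\ Q i (f i).
Proof.
move=> UP; apply: (near_choice (P := fun i t => P i t /\ Q i t)).
by apply: filterS UP => i [t Pt Qt]; exists t.
Qed.

Lemma cvg_in (I : Type) (F : set_system I) {FF : Filter F} (T : topologicalType)
    (u : I -> T) (l : T) (A : set T) :
  u i @[i --> F] --> l -> nbhs l A -> \forall i \near F, A (u i).
Proof. by move=> ul lA; exact: ul. Qed.

Lemma cvg_near_eq (I : Type) (F : set_system I) {FF : Filter F}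
    (T : topologicalType) (u v : I -> T) (l : T) :
  (\forall i \near F, u i = v i) ->
  v i @[i --> F] --> l -> u i @[i --> F] --> l.
Proof.
move=> uv vl; apply: (cvg_trans _ vl); apply: near_eq_cvg.
by apply: filterS uv => i ->.
Qed.

Lemma cvg_near_lt (R : realType) (I : Type) (F : set_system I) {FF : Filter F}
    (u : I -> R) (l b : R) :
  u i @[i --> F] --> l -> l < b -> \forall i \near F, u i < b.
Proof. by move=> ul lb; apply: (cvg_in ul (A := [set x | x < b])); exact: lt_nbhsl. Qed.

Lemma cvg_near_gt (R : realType) (I : Type) (F : set_system I) {FF : Filter F}
    (u : I -> R) (l b : R) :
  u i @[i --> F] --> l -> b < l -> \forall i \near F, b < u i.
Proof. by move=> ul lb; apply: (cvg_in ul (A := [set x | b < x])); exact: lt_nbhsr. Qed.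

Lemma cvg_closed (I : Type) (F : set_system I) {PF : ProperFilter F}
    (T : topologicalType) (u : I -> T) (l : T) (A : set T) :
  closed A -> (\forall i \near F, A (u i)) ->
  u i @[i --> F] --> l -> A l.
Proof. by move=> cA FA ul; exact: (closed_cvg A cA FA l ul). Qed.

Lemma cvg_closure (I : Type) (F : set_system I) {PF : ProperFilter F}
    (T : topologicalType) (u : I -> T) (l : T) (A : set T) :
  (\forall i \near F, A (u i)) ->
  u i @[i --> F] --> l -> closure A l.
Proof.
move=> FA; apply: cvg_closed; first exact: closed_closure.
by apply: filterS FA => i; exact: subset_closure.
Qed.

(** A point of the closure is the limit of an ultrafilter on the set, so closedness
    can be tested on convergent families. *)
Lemma closure_ultra (T : topologicalType) (A : set T) (x : T) :
  closure A x -> exists U : set_system T,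
    [/\ UltraFilter U, U A & U --> x].
Proof.
move=> clA; have PF : ProperFilter (within A (nbhs x)).
  by apply: within_nbhs_proper.
have [U [UU sU]] := ultraFilterLemma PF; exists U; split => //.
  by apply: sU; exact: withinT.
by apply: subset_trans sU; exact: cvg_within.
Qed.

Lemma closure_map (T S : topologicalType) (f : T -> S) (A : set T) (B : set S) x :
  {for x, continuous f} -> (forall y, A y -> B (f y)) ->
  closure A x -> closure B (f x).
Proof.
move=> fx AB clA W Wf; have [y [Ay Wy]] := clA (f @^-1` W) (fx _ Wf).
by exists (f y); split; [exact: AB|].
Qed.

Section mxE.
Variables (R : pzRingType) (m n : nat) (A B : 'M[R]_(m, n)) (c : R) (i : 'I_m) (j : 'I_n).
Lemma addmxE : (A + B) i j = A i j + B i j. Proof. by rewrite mxE. Qed.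
Lemma oppmxE : (- A) i j = - A i j. Proof. by rewrite mxE. Qed.
Lemma scalemxE : (c *: A) i j = c * A i j. Proof. by rewrite mxE. Qed.
Lemma zeromxE : (0 : 'M[R]_(m, n)) i j = 0. Proof. by rewrite mxE. Qed.
End mxE.

Definition linmxE := (addmxE, oppmxE, scalemxE, zeromxE).

Ltac mxring := apply/matrixP => ? ?; rewrite !linmxE; ring.
Ltac mxfield := apply/matrixP => ? ?; rewrite !linmxE; field.

(** * Proper cones and comparability *)

(** An open convex cone [cint], its closure [ccl] and a linear form [height] that is
    positive on it, with the facts about them that the convex geometry needs. The
    compact slice [height = 1] plays the role of the closed convex domain in an
    affine chart: normalized vectors of [ccl] converge along every ultrafilter. *)
Record proper_cone (R : realType) (d : nat) := ProperCone {
  cint : set 'cV[R]_d;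
  ccl : set 'cV[R]_d;
  height : 'cV[R]_d -> R;
  cint_open : open cint;
  ccl_closed : closed ccl;
  cint_ccl : cint `<=` ccl;
  cclD : forall u v, ccl u -> ccl v -> ccl (u + v);
  cclZ : forall t u, 0 <= t -> ccl u -> ccl (t *: u);
  cintD : forall u v, cint u -> ccl v -> cint (u + v);
  cintZ : forall t u, 0 < t -> cint u -> cint (t *: u);
  heightD : forall u v, height (u + v) = height u + height v;
  heightZ : forall t u, height (t *: u) = t * height u;
  height_continuous : continuous height;
  height_gt0 : forall u, ccl u -> u != 0 -> 0 < height u;
  cint_neq0 : ~ cint 0;
  slice_compact : compact [set u | ccl u /\ height u = 1] }.

Section Cone.
Variables (R : realType) (d : nat) (C : proper_cone R d).
Local Notation V := 'cV[R]_d.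
Local Notation O := (cint C).
Local Notation K := (ccl C).
Local Notation h := (height C).
Implicit Types (u v w x y z : V) (M N a b s t : R) (A Y : set V).

Lemma height0 : h 0 = 0.
Proof. by rewrite -(scale0r 0) heightZ mul0r. Qed.

Lemma heightN u : h (- u) = - h u.
Proof. by rewrite -scaleN1r heightZ mulN1r. Qed.

Lemma heightB u v : h (u - v) = h u - h v.
Proof. by rewrite heightD heightN. Qed.

Lemma cint_nz u : O u -> u != 0.
Proof. by move=> Ou; apply/eqP => u0; apply: (@cint_neq0 _ _ C); rewrite -u0. Qed.

Lemma cint_height u : O u -> 0 < h u.
Proof. by move=> Ou; apply: height_gt0 (cint_nz Ou); exact: cint_ccl. Qed.

Lemma ccl_height u : K u -> 0 <= h u.
Proof.
by move=> Ku; have [->|/(height_gt0 Ku)/ltW//] := eqVneq u 0; rewrite height0.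
Qed.

Lemma ccl_height0 u : K u -> h u <= 0 -> u = 0.
Proof.
move=> Ku hu; apply/eqP; apply: contraT => /(height_gt0 Ku).
by rewrite ltNge hu.
Qed.

Lemma height_neq0 u : 0 < h u -> u != 0.
Proof. by apply: contraTneq => ->; rewrite height0 ltxx. Qed.

Lemma cclDO u v : K u -> O v -> O (u + v).
Proof. by move=> Ku Ov; rewrite addrC; exact: cintD. Qed.

Lemma ccl0 u : K u -> K 0.
Proof. by move=> Ku; rewrite -(scale0r u); exact: cclZ. Qed.

Lemma cclZP t u : 0 < t -> K (t *: u) <-> K u.
Proof.
move=> t0; split; last by apply: cclZ; exact: ltW.
move=> /(cclZ (t := t^-1)); rewrite scalerA mulVf ?gt_eqF// scale1r.
by apply; rewrite invr_ge0 ltW.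
Qed.

Lemma cintZP t u : 0 < t -> O (t *: u) <-> O u.
Proof.
move=> t0; split; last exact: cintZ.
move=> /(cintZ (t := t^-1)); rewrite scalerA mulVf ?gt_eqF// scale1r.
by apply; rewrite invr_gt0.
Qed.

Lemma ccl_closedM u v :
  (forall M, 1 < M -> K (M *: u - v)) -> K (u - v).
Proof.
move=> KM; apply: (@cvg_closed _ (1 : R)^'+ _ _ (fun M => M *: u - v)).
- exact: ccl_closed.
- by near=> M; apply: KM; near: M; exact: nbhs_right_gt.
- apply: cvg_at_right_filter; apply: cvgB; last exact: cvg_cst.
  by rewrite -[X in _ --> X]scale1r; apply: cvgZr_tmp; exact: cvg_id.
Unshelve. all: by end_near. Qed.

Lemma cint_absorb u v : O u -> exists2 M, 0 < M & O (M *: u - v).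
Proof.
move=> Ou.
have : (fun e : R => u - e *: v) @ 0^'+ --> u.
  apply: cvg_at_right_filter.
  rewrite -[X in _ --> X]subr0 -(scale0r v).
  apply: cvgB; first exact: cvg_cst.
  by apply: cvgZr_tmp; exact: cvg_id.
move=> /(_ O (open_nbhs_nbhs (conj (@cint_open _ _ C) Ou))) e1.
have e0 := nbhs_right_gt (0 : R).
have [e [/= Oe e_gt0]] := near_ex (filterI (F := 0^'+) e1 e0).
exists e^-1; first by rewrite invr_gt0.
have := cintZ (t := e^-1) _ Oe; rewrite scalerBr scalerA mulVf ?gt_eqF//.
by rewrite scale1r; apply; rewrite invr_gt0.
Qed.

Lemma near_cint u : O u -> nbhs u O.
Proof. by move=> Ou; apply: open_nbhs_nbhs; split => //; exact: cint_open. Qed.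

Lemma ultra_slice_cvg (I : Type) (U : set_system I) {UU : UltraFilter U} (u : I -> V) :
  (\forall i \near U, K (u i) /\ h (u i) = 1) ->
  exists l, [/\ K l, h l = 1 & u i @[i --> U] --> l].
Proof.
move=> Uu; have [l [Kl hl] ul] := ultra_compact_cvg (@slice_compact _ _ C) Uu.
by exists l.
Qed.

Lemma cvg_height (I : Type) (F : set_system I) {FF : Filter F} (u : I -> V) l :
  u i @[i --> F] --> l -> h (u i) @[i --> F] --> h l.
Proof. by apply: continuous_cvg; exact: height_continuous. Qed.

(** The cone has bounded slices, so a bound on the height is a bound on the vector. *)
Lemma ultra_bounded_cvg (I : Type) (U : set_system I) {UU : UltraFilter U}
    (u : I -> V) B :
  (\forall i \near U, K (u i) /\ h (u i) <= B) ->
  exists2 l, K l & u i @[i --> U] --> l.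
Proof.
move=> Uu.
have [U0|/ultra_or U0] := pselect (\forall i \near U, u i = 0).
  have [i [Ku _]] := near_ex Uu.
  exists 0; first exact: (ccl0 Ku).
  by apply: cvg_near_cst.
have [l [Kl hl nl]] : exists l, [/\ K l, h l = 1 &
    ((h (u i))^-1 *: u i) @[i --> U] --> l].
  apply: ultra_slice_cvg; apply: filterS2 Uu U0 => i [Ku _] /eqP u0.
  have hu := height_gt0 Ku u0; split; last by rewrite heightZ mulVf ?gt_eqF.
  by apply: cclZ Ku; rewrite invr_ge0 ltW.
have [c /andP[c0 _] cc] : exists2 c, 0 <= c <= B & h (u i) @[i --> U] --> c.
  apply: ultra_itv_cvg; apply: filterS Uu => i [Ku uB]; rewrite uB andbT.
  exact: ccl_height.
exists (c *: l); first exact: cclZ.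
apply: (cvg_near_eq _ (cvgZ cc nl)).
apply: filterS2 Uu U0 => i [Ku _] /eqP u0.
by rewrite scalerA divff ?scale1r// gt_eqF// height_gt0.
Qed.

(** Comparability of [u] and [v] with constant [M]. Between two points of the open
    cone the best constant is the exponential of twice the Hilbert distance; the
    relation also makes sense on the boundary, where the vectors comparable to [x]
    are those of the open face of [x]. *)
Definition hil M u v := exists2 a, 0 < a & K (a *: v - u) /\ K (M *: u - a *: v).

(** The closed neighbourhood of a convex cone [A] of radius [(ln M) / 2], written so
    that it is visibly a convex cone: the coefficient of comparability is
    absorbed in the point of [A]. *)
Definition nb M A v := exists2 y, A y & K (y - v) /\ K (M *: v - y).

Lemma hil_refl M u : 1 <= M -> K u -> hil M u u.
Proof.
move=> M1 Ku; exists 1 => //; rewrite scale1r subrr; split; first exact: ccl0 Ku.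
by rewrite -[X in _ - X]scale1r -scalerBl; apply: cclZ => //; rewrite subr_ge0.
Qed.

Lemma hil_gt0 M u v : 0 < h u -> 0 < h v -> hil M u v -> 0 < M.
Proof.
move=> hu hv [a a0 [Ka KM]].
have := ccl_height KM; rewrite heightB !heightZ subr_ge0 => H.
by rewrite -(pmulr_lgt0 _ hu); apply: lt_le_trans H; exact: mulr_gt0.
Qed.

Lemma hil_ge1 M u v : 0 < h u -> hil M u v -> 1 <= M.
Proof.
move=> hu [a a0 [Ka KM]]; have := ccl_height (cclD Ka KM).
have -> : a *: v - u + (M *: u - a *: v) = (M - 1) *: u by mxring.
by rewrite heightZ pmulr_lge0// subr_ge0.
Qed.

Lemma hil_sym M u v : 0 < M -> hil M u v -> hil M v u.
Proof.
move=> M0 [a a0 [Ka KM]]; exists (M / a); first exact: divr_gt0.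
split.
  have -> : (M / a) *: u - v = a^-1 *: (M *: u - a *: v).
    by mxfield; exact: lt0r_neq0.
  by apply: cclZ => //; rewrite invr_ge0 ltW.
have -> : M *: v - (M / a) *: u = (M / a) *: (a *: v - u).
  by mxfield; exact: lt0r_neq0.
by apply: cclZ => //; rewrite ltW// divr_gt0.
Qed.

Lemma hil_trans M N u v w : 0 < N ->
  hil M u v -> hil N v w -> hil (M * N) u w.
Proof.
move=> N0 [a a0 [Ka KM]] [b b0 [Kb KN]]; exists (a * b); first exact: mulr_gt0.
split.
  have -> : (a * b) *: w - u = a *: (b *: w - v) + (a *: v - u) by mxring.
  by apply: cclD => //; apply: cclZ => //; exact: ltW.
have -> : (M * N) *: u - (a * b) *: w =
    N *: (M *: u - a *: v) + a *: (N *: v - b *: w) by mxring.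
by apply: cclD; apply: cclZ => //; exact: ltW.
Qed.

Lemma hil_le M N u v : M <= N -> K u -> hil M u v -> hil N u v.
Proof.
move=> MN Ku [a a0 [Ka KM]]; exists a => //; split => //.
have -> : N *: u - a *: v = (N - M) *: u + (M *: u - a *: v) by mxring.
by apply: cclD => //; apply: cclZ => //; rewrite subr_ge0.
Qed.

Lemma hilZr M u v t : 0 < t -> hil M u (t *: v) <-> hil M u v.
Proof.
move=> t0; split=> -[a a0 H].
  by exists (a * t); [exact: mulr_gt0|rewrite -scalerA].
exists (a / t); first exact: divr_gt0.
by rewrite scalerA divfK// lt0r_neq0.
Qed.

Lemma hilZl M u v t : 0 < t -> hil M (t *: u) v <-> hil M u v.
Proof.
move=> t0; split=> -[a a0 [H1 H2]].
  exists (a / t); first exact: divr_gt0.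
  split.
    have -> : (a / t) *: v - u = t^-1 *: (a *: v - t *: u).
      by mxfield; exact: lt0r_neq0.
    by apply: cclZ => //; rewrite invr_ge0 ltW.
  have -> : M *: u - (a / t) *: v = t^-1 *: (M *: (t *: u) - a *: v).
    by mxfield; exact: lt0r_neq0.
  by apply: cclZ => //; rewrite invr_ge0 ltW.
exists (t * a); first exact: mulr_gt0.
split.
  have -> : (t * a) *: v - t *: u = t *: (a *: v - u) by mxring.
  by apply: cclZ => //; exact: ltW.
have -> : M *: (t *: u) - (t * a) *: v = t *: (M *: u - a *: v) by mxring.
by apply: cclZ => //; exact: ltW.
Qed.

Lemma hil_cint M u v : O u -> hil M u v -> O v.
Proof.
move=> Ou [a a0 [Ka _]]; rewrite -(cintZP _ a0).
by rewrite -(subrK u (a *: v)); exact: cclDO.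
Qed.

Lemma hil_ccl M u v : K u -> hil M u v -> K v.
Proof.
move=> Ku [a a0 [Ka _]]; rewrite -(cclZP _ a0).
by rewrite -(subrK u (a *: v)); exact: cclD.
Qed.

Lemma hil_exists u v : O u -> O v -> exists2 M, 1 <= M & hil M u v.
Proof.
move=> Ou Ov; have [M M0 OM] := cint_absorb v Ou.
have [N N0 ON] := cint_absorb u Ov.
have H : hil (N * M) u v.
  exists N => //; split; first exact: cint_ccl.
  have -> : (N * M) *: u - N *: v = N *: (M *: u - v) by mxring.
  by apply: cclZ; [exact: ltW|exact: cint_ccl].
by exists (N * M) => //; apply: hil_ge1 H; exact: cint_height.
Qed.

(** Two normalized vectors that are comparable with every constant above [1] coincide:
    their difference lies in the cone and has height zero. *)
Lemma hil1 u v : K u -> h u = 1 -> K v -> h v = 1 ->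
  (forall M, 1 < M -> hil M u v) -> v = u.
Proof.
move=> Ku hu Kv hv H.
have KM M : 1 < M -> K (M *: v - u).
  move=> M1; have [a a0 [Ka KM]] := H _ M1.
  have := ccl_height KM; rewrite heightB !heightZ hu hv !mulr1 subr_ge0 => aM.
  have -> : M *: v - u = (M - a) *: v + (a *: v - u) by mxring.
  by apply: cclD => //; apply: cclZ => //; rewrite subr_ge0.
apply/eqP; rewrite -subr_eq0; apply/eqP; apply: ccl_height0.
  exact: ccl_closedM.
by rewrite heightB hu hv subrr.
Qed.

Lemma near_hil w M : O w -> 1 < M -> \forall u \near w, hil M w u.
Proof.
move=> Ow M1; pose a := (1 + M) / 2.
have a1 : 1 < a by rewrite /a; lra.
have aM : a < M by rewrite /a; lra.
have ca : (fun u => a *: u) @ w --> a *: w by apply: scaler_continuous.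
have c1 : (fun u => a *: u - w) @ w --> a *: w - w.
  exact: (cvgB ca (cvg_cst w)).
have c2 : (fun u => M *: w - a *: u) @ w --> M *: w - a *: w.
  exact: (cvgB (cvg_cst _) ca).
have O1 : O (a *: w - w).
  rewrite -[X in _ - X]scale1r -scalerBl; apply: cintZ => //.
  by rewrite subr_gt0.
have O2 : O (M *: w - a *: w).
  by rewrite -scalerBl; apply: cintZ => //; rewrite subr_gt0.
have n1 : \forall u \near w, O (a *: u - w) by exact: (c1 _ (near_cint O1)).
have n2 : \forall u \near w, O (M *: w - a *: u) by exact: (c2 _ (near_cint O2)).
near=> u; exists a; first lra.
by split; apply: cint_ccl; near: u.
Unshelve. all: by end_near. Qed.

(** The comparison coefficients stay in a bounded interval, because the heights of the
    two limits are positive; so they converge along the ultrafilter. *)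
Lemma hil_cvg (I : Type) (U : set_system I) {UU : UltraFilter U} (M : R)
    (u v : I -> V) lu lv :
  (\forall i \near U, hil M (u i) (v i)) ->
  u i @[i --> U] --> lu -> v i @[i --> U] --> lv ->
  0 < h lu -> 0 < h lv -> hil M lu lv.
Proof.
move=> UH ul vl hlu hlv.
have [a aP] := near_choice2 UH.
have hul : h (u i) @[i --> U] --> h lu by exact: cvg_height.
have hvl : h (v i) @[i --> U] --> h lv by exact: cvg_height.
have [la _ al] : exists2 la, 0 <= la <= `|M| * (2 * h lu) / (h lv / 2) &
    a i @[i --> U] --> la.
  apply: ultra_itv_cvg.
  have u2 : \forall i \near U, h (u i) < 2 * h lu.
    by apply: (cvg_near_lt hul); lra.
  have v2 : \forall i \near U, h lv / 2 < h (v i).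
    by apply: (cvg_near_gt hvl); lra.
  have u0 : \forall i \near U, 0 < h (u i).
    by apply: (cvg_near_gt hul); lra.
  near=> i; have [a0 [K1 K2]] : 0 < a i /\ (K (a i *: v i - u i) /\ K (M *: u i - a i *: v i)).
    by near: i; exact: aP.
  rewrite ltW//=; have hv0 : 0 < h lv / 2 by lra.
  rewrite ler_pdivlMr//; have := ccl_height K2.
  rewrite heightB !heightZ subr_ge0 => H.
  have V2 : h lv / 2 < h (v i) by near: i.
  have U2 : h (u i) < 2 * h lu by near: i.
  have U0 : 0 < h (u i) by near: i.
  apply: (@le_trans _ _ (a i * h (v i))); first by rewrite ler_pM2l// ltW.
  apply: (le_trans H); apply: (@le_trans _ _ (`|M| * h (u i))).
    by rewrite ler_pM2r// ler_norm.
  by apply: ler_pM => //; rewrite ltW.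
have K1 : K (la *: lv - lu).
  apply: (@cvg_closed _ U _ _ (fun i => a i *: v i - u i)).
  - exact: ccl_closed.
  - by apply: filterS aP => i [_ []].
  - by apply: cvgB => //; exact: cvgZ.
exists la; last first.
  split => //; apply: (@cvg_closed _ U _ _ (fun i => M *: u i - a i *: v i)).
  - exact: ccl_closed.
  - by apply: filterS aP => i [_ []].
  - by apply: cvgB; [exact: cvgZl_tmp|exact: cvgZ].
have := ccl_height K1; rewrite heightB heightZ subr_ge0 => /(lt_le_trans hlu).
by rewrite pmulr_lgt0.
Unshelve. all: by end_near. Qed.

End Cone.

(** * Convex subcones and their limits *)

Section ConvexSets.
Variables (R : realType) (d : nat) (C : proper_cone R d).
Local Notation V := 'cV[R]_d.
Local Notation O := (cint C).
Local Notation K := (ccl C).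
Local Notation h := (height C).
Local Notation hil := (hil C).
Local Notation nb := (nb C).
Implicit Types (u v w x y z : V) (M N a b s t : R) (A Y : set V).

(** The cones over the convex subsets of the domain that are closed in it. *)
Record cset A : Prop := CSet {
  csetO : A `<=` O;
  csetD : forall u v, A u -> A v -> A (u + v);
  csetZ : forall t u, 0 < t -> A u -> A (t *: u);
  cset_closed : closure A `&` O `<=` A }.

(** The cone over the ideal boundary of [A]. *)
Definition bd A x := [/\ closure A x, ~ O x & x != 0].

Lemma closure_ccl A x : A `<=` O -> closure A x -> K x.
Proof.
move=> AO /(closure_subset AO)/(closure_subset (@cint_ccl _ _ C)).
by rewrite -(closure_id K).1//; exact: ccl_closed.
Qed.

Lemma bd_height A x : A `<=` O -> bd A x -> 0 < h x.
Proof. by move=> AO [/(closure_ccl AO) Kx _ x0]; exact: height_gt0. Qed.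

Lemma cset_closureD A x y : cset A -> closure A x -> closure A y -> closure A (x + y).
Proof.
move=> cA clx cly W Wxy.
have [[/= W1 W2] [W1x W2y] sW] := @add_continuous V (x, y) W Wxy.
have [u [Au Wu]] := clx _ W1x; have [v [Av Wv]] := cly _ W2y.
exists (u + v); split; first exact: csetD.
exact: (sW (u, v)).
Qed.

Lemma cset_closureZ A x t : cset A -> 0 < t -> closure A x -> closure A (t *: x).
Proof.
move=> cA t0; apply: closure_map; first exact: scaler_continuous.
by move=> y; exact: csetZ.
Qed.

Lemma cset_add_closure A y x s : cset A -> A y -> closure A x -> 0 <= s ->
  A (y + s *: x).
Proof.
move=> cA Ay clx; rewrite le_eqVlt => /orP[/eqP<-|s0].
  by rewrite scale0r addr0.
apply: (cset_closed cA); split.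
  by apply: cset_closureD => //; [exact: subset_closure|exact: cset_closureZ].
apply: cintD; first exact: (csetO cA).
by apply: cclZ; [exact: ltW|exact: (closure_ccl (csetO cA))].
Qed.

Lemma ray_cvg y x : (fun s : R => s^-1 *: y + x) @ +oo --> x.
Proof.
rewrite -[X in _ --> X]add0r -(scale0r y); apply: cvgD; last exact: cvg_cst.
apply: cvgZr_tmp; apply/cvgr0Pnorm_lt => e e0.
near=> s; have s0 : e^-1 < s by near: s; apply: nbhs_pinfty_gt; exact: num_real.
have s1 : 0 < s by apply: lt_trans s0; rewrite invr_gt0.
by rewrite gtr0_norm ?invr_gt0// -[e]invrK ltf_pV2// posrE// invr_gt0.
Unshelve. all: by end_near.
Qed.

(** After rescaling, the points [y + s *: x] tend to [x]. *)
Lemma closure_ray A y x : (forall t u, 0 < t -> A u -> A (t *: u)) ->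
  (forall s, 0 <= s -> A (y + s *: x)) -> closure A x.
Proof.
move=> AZ Ay; apply: (@cvg_closure _ (+oo%R : set_system R) _ _ (fun s : R => s^-1 *: y + x)).
  near=> s; have s0 : 0 < s by near: s; apply: nbhs_pinfty_gt; exact: num_real.
  have -> : s^-1 *: y + x = s^-1 *: (y + s *: x).
    by mxfield; exact: lt0r_neq0.
  by apply: AZ; [rewrite invr_gt0|apply: Ay; exact: ltW].
exact: ray_cvg.
Unshelve. all: by end_near. Qed.

Definition raycone y : set V := [set t *: y | t in [set t | 0 < t]].

Lemma cset_raycone y : O y -> cset (raycone y).
Proof.
move=> Oy; split.
- by move=> _ [t /= t0 <-]; exact: cintZ.
- by move=> _ _ [t /= t0 <-] [s /= s0 <-]; exists (t + s) => /=;
    [exact: addr_gt0|mxring].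
- by move=> s _ /= s0 [t /= t0 <-]; exists (s * t) => /=;
    [exact: mulr_gt0|mxring].
- move=> x [clx Ox]; exists (h x / h y).
    by rewrite /= divr_gt0// cint_height.
  have hy := cint_height Oy.
  have cf : continuous (fun x => h x *: y - h y *: x).
    move=> z; apply: (@cvgB _ _ _ (nbhs z)); last exact: scaler_continuous.
    by apply: (@cvgZr_tmp _ _ _ (nbhs z)); exact: height_continuous.
  have : [set 0] (h x *: y - h y *: x).
    have c0 : closed [set (0 : V)].
      by apply: accessible_closed_set1; exact: hausdorff_accessible (@norm_hausdorff _ _).
    rewrite ((closure_id [set (0 : V)]).1 c0); apply: (closure_map (cf x) _ clx).
    move=> _ [t /= t0 <-]; rewrite heightZ; mxring.
  move=> /= H.
  have xE : x = (h y)^-1 *: (h x *: y - (h x *: y - h y *: x)).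
    by mxfield; exact: lt0r_neq0.
  by rewrite [RHS]xE H subr0; mxring.
Qed.

(** Balls are neighbourhoods of rays: results on neighbourhoods of convex cones apply
    to them. *)
Lemma nb_raycone M u v : nb M (raycone v) u <-> hil M u v.
Proof.
split=> [[_ [a /= a0 <-] H]|[a a0 H]]; first by exists a.
by exists (a *: v) => //; exists a.
Qed.

Lemma nb_self M A : 1 <= M -> A `<=` O -> A `<=` nb M A.
Proof.
move=> M1 AO u Au; exists u => //; rewrite subrr.
have Ku := cint_ccl (AO _ Au).
split; first exact: ccl0 Ku.
by rewrite -[X in _ - X]scale1r -scalerBl; apply: cclZ => //; rewrite subr_ge0.
Qed.

Lemma nbP M A u : (forall t u, 0 < t -> A u -> A (t *: u)) ->
  nb M A u <-> exists2 y, A y & hil M u y.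
Proof.
move=> AZ; split=> [[y Ay H]|[y Ay [a a0 H]]].
  by exists y => //; exists 1 => //; rewrite scale1r.
by exists (a *: y) => //; exact: AZ.
Qed.

Lemma nb_hil M N A u v : cset A -> 0 < N -> nb N A u -> hil M v u -> nb (M * N) A v.
Proof.
move=> cA N0 /(nbP _ _ (csetZ cA))[y Ay Hy] Hv.
by apply/(nbP _ _ (csetZ cA)); exists y => //; exact: hil_trans Hy.
Qed.

Lemma nbO M A u : A `<=` O -> 0 < M -> nb M A u -> O u.
Proof.
move=> AO M0 [y /AO Oy [_ KM]]; rewrite -(cintZP C _ M0).
by rewrite -(subrK y (M *: u)); exact: cclDO.
Qed.

Lemma nb_le M N A u : A `<=` O -> 0 < M -> M <= N -> nb M A u -> nb N A u.
Proof.
move=> AO M0 MN nu; have Ku := cint_ccl (nbO AO M0 nu).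
case: nu => y Ay [K1 K2]; exists y => //; split => //.
have -> : N *: u - y = (N - M) *: u + (M *: u - y) by mxring.
by apply: cclD => //; apply: cclZ => //; rewrite subr_ge0.
Qed.

Lemma nbD M A u v : cset A -> nb M A u -> nb M A v -> nb M A (u + v).
Proof.
move=> cA [y Ay [Ky KMy]] [z Az [Kz KMz]]; exists (y + z); first exact: csetD.
split.
  have -> : y + z - (u + v) = (y - u) + (z - v) by mxring.
  exact: cclD.
have -> : M *: (u + v) - (y + z) = (M *: u - y) + (M *: v - z) by mxring.
exact: cclD.
Qed.

Lemma nbZ M A t u : cset A -> 0 < t -> nb M A u -> nb M A (t *: u).
Proof.
move=> cA t0 [y Ay [Ky KMy]]; exists (t *: y); first exact: csetZ.
split; first by rewrite -scalerBr; apply: cclZ => //; exact: ltW.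
have -> : M *: (t *: u) - t *: y = t *: (M *: u - y) by mxring.
by apply: cclZ => //; exact: ltW.
Qed.

Lemma sqrt_le M : 1 < M -> exists2 N, 1 < N & N * N <= M.
Proof.
move=> M1; exists (1 + Num.min 1 ((M - 1) / 3)).
  by rewrite ltrDl lt_min ltr01 divr_gt0//; lra.
have H1 : Num.min 1 ((M - 1) / 3) <= 1 by rewrite ge_min lexx.
have H2 : Num.min 1 ((M - 1) / 3) <= (M - 1) / 3 by rewrite ge_min lexx orbT.
have H0 : 0 <= Num.min 1 ((M - 1) / 3) by rewrite le_min ler01 divr_ge0//; lra.
by nra.
Qed.

Section UltraLimit.
Context {I : Type} (U : set_system I) {UU : UltraFilter U}.

(** The limit of a family of cones along an ultrafilter. Every family has one, which
    replaces the compactness of the local Hausdorff topology; it may be empty. *)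
Definition ulim (Y : I -> set V) : set V := [set v | O v /\
  forall W, nbhs v W -> \forall i \near U, (Y i `&` W) !=set0].

Lemma ulim_in (Y : I -> set V) (u : I -> V) w : O w -> u i @[i --> U] --> w ->
  (\forall i \near U, Y i (u i)) -> ulim Y w.
Proof.
move=> Ow uw Yu; split => // W /uw Wu.
by apply: filterS2 Yu Wu => i Yi Wi; exists (u i).
Qed.

Lemma cset_ulim (Y : I -> set V) : (forall i, cset (Y i)) -> cset (ulim Y).
Proof.
move=> cY; split.
- by move=> u [].
- move=> u v [Ou Yu] [Ov Yv]; split; first by apply: cintD => //; exact: cint_ccl.
  move=> W Wuv.
  have [[/= W1 W2] [W1x W2y] sW] := @add_continuous V (u, v) W Wuv.
  apply: filterS2 (Yu _ W1x) (Yv _ W2y) => i [x [Yx Wx]] [y [Yy Wy]].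
  exists (x + y); split; first exact: (csetD (cY i)).
  exact: (sW (x, y)).
- move=> t u t0 [Ou Yu]; split; first exact: cintZ.
  move=> W Wu; have := Yu _ (@scaler_continuous _ V t u W Wu).
  apply: filterS => i [x [Yx Wx]]; exists (t *: x); split => //.
  exact: (csetZ (cY i)).
- move=> v [clv Ov]; split => // W.
  rewrite nbhsE => -[B [oB Bv] BW].
  have [v' [[_ Yv'] Bv']] := clv B (open_nbhs_nbhs (conj oB Bv)).
  have := Yv' B (open_nbhs_nbhs (conj oB Bv')).
  by apply: filterS => i [x [Yx Bx]]; exists x; split => //; exact: BW.
Qed.

Lemma ulim_cst A : cset A -> ulim (fun=> A) = A.
Proof.
move=> cA; apply/seteqP; split => [v [Ov Av]|v Av].
  apply: (cset_closed cA); split => // W Wv.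
  by have [_ ?] := near_ex (Av _ Wv).
apply: (@ulim_in _ (fun=> v)); [exact: (csetO cA)|exact: cvg_cst|].
exact: nearW.
Qed.

(** Only a slightly larger neighbourhood is reached, since the points of [Y i] merely
    accumulate at [w]. *)
Lemma ulim_near (Y : I -> set V) (u : I -> V) w M : (forall i, cset (Y i)) -> ulim Y w ->
  u i @[i --> U] --> w -> 1 < M -> \forall i \near U, nb M (Y i) (u i).
Proof.
move=> cY [Ow Yw] uw M1; have [N N1 NM] := sqrt_le M1.
have near_w := near_hil Ow N1.
have Uu : \forall i \near U, hil N w (u i) by exact: cvg_in uw near_w.
apply: filterS2 Uu (Yw _ near_w) => i uN [y [Yy yN]].
have N0 : 0 < N by lra.
apply: (nb_le (csetO (cY i)) _ NM); first by rewrite mulr_gt0.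
apply/(nbP _ _ (csetZ (cY i))); exists y => //.
exact: (hil_trans N0 (hil_sym N0 uN) yN).
Qed.

Lemma nb_cvg (Y : I -> set V) (v : I -> V) (lv : V) M :
  (forall i, cset (Y i)) -> 0 < M -> v i @[i --> U] --> lv ->
  (\forall i \near U, nb M (Y i) (v i)) ->
  exists (y : I -> V) (ly : V), [/\ \forall i \near U, Y i (y i),
    y i @[i --> U] --> ly & K (ly - lv) /\ K (M *: lv - ly)].
Proof.
move=> cY M0 vl nv; have [y yP] := near_choice2 nv.
have hlv : \forall i \near U, h (v i) < h lv + 1.
  by apply: cvg_near_lt (cvg_height vl) _; rewrite ltrDl.
have [ly Kly yl] : exists2 l, K l & y i @[i --> U] --> l.
  apply: (@ultra_bounded_cvg _ _ _ _ _ _ _ (M * (h lv + 1))).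
  apply: filterS2 yP hlv => i [Yy [K1 K2]] hv; split.
    exact: (cint_ccl (csetO (cY i) Yy)).
  have := ccl_height K2; rewrite heightB heightZ subr_ge0 => /le_trans; apply.
  by rewrite ler_pM2l// ltW.
exists y, ly; split => //; first by apply: filterS yP => i [].
split.
  apply: (@cvg_closed _ U _ _ (fun i => y i - v i)).
  - exact: ccl_closed.
  - by apply: filterS yP => i [_ []].
  - exact: cvgB.
apply: (@cvg_closed _ U _ _ (fun i => M *: v i - y i)).
- exact: ccl_closed.
- by apply: filterS yP => i [_ []].
- by apply: cvgB => //; exact: cvgZl_tmp.
Qed.

Lemma nb_ulim (Y : I -> set V) (u : I -> V) w M : (forall i, cset (Y i)) ->
  0 < M -> O w -> u i @[i --> U] --> w ->
  (\forall i \near U, nb M (Y i) (u i)) -> nb M (ulim Y) w.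
Proof.
move=> cY M0 Ow uw Unb; have [y [l [Yy yl [K1 K2]]]] := nb_cvg cY M0 uw Unb.
exists l => //; apply: (ulim_in _ yl Yy).
by rewrite -(subrK w l); exact: cclDO.
Qed.

End UltraLimit.

Lemma nb_closed A M w : cset A -> 0 < M -> closure (nb M A) w -> O w -> nb M A w.
Proof.
move=> cA M0 /closure_ultra[U [UU UA Uw]] Ow.
rewrite -(ulim_cst (U := U) cA); exact: (@nb_ulim _ U UU (fun=> A) id w M).
Qed.

(** The points [y + s *: z] of the segment from [y] to [z] that stay in the closed
    neighbourhood form a bounded interval, as the neighbourhood is a convex cone that
    misses [z]; the last one is not in any smaller neighbourhood, since an open
    condition would persist beyond it. *)
Lemma nb_crossing A M y z : cset A -> 0 < M -> nb M A y -> O z -> ~ nb M A z ->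
  exists2 s, 0 <= s & nb M A (y + s *: z) /\
    forall N, 0 < N -> N < M -> ~ nb N A (y + s *: z).
Proof.
move=> cA M0 ny Oz nz.
pose S := [set s : R | 0 <= s /\ nb M A (y + s *: z)].
have S0 : S 0 by split; rewrite // scale0r addr0.
have Sle s s' : S s -> 0 <= s' -> s' <= s -> S s'.
  move=> [s0 ns] s'0 s's; split => //.
  have [s0E|s_neq0] := eqVneq s 0.
    suff -> : s' = s by [].
    by apply/eqP; rewrite eq_le s's s0E.
  have {}s0 : 0 < s by rewrite lt_def s_neq0.
  have [<-//|ss'] := eqVneq s s'.
  have [->|s'_neq0] := eqVneq s' 0; first by rewrite scale0r addr0.
  have s'0' : 0 < s' by rewrite lt_def s'_neq0.
  have -> : y + s' *: z = (1 - s' / s) *: y + (s' / s) *: (y + s *: z).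
    by mxfield.
  apply: nbD => //; apply: nbZ => //; last exact: divr_gt0.
  by rewrite subr_gt0 ltr_pdivrMr// mul1r lt_def ss'.
have Oy : O y by apply: nbO ny => //; exact: csetO.
have Oyz s : 0 <= s -> O (y + s *: z).
  by move=> s0; apply: cintD => //; apply: cclZ => //; exact: cint_ccl.
have Sb : has_ubound S.
  apply: contrapT => Sb; apply: nz; apply: nb_closed => //.
  apply: (@closure_ray _ y); first by move=> t u t0; exact: nbZ.
  move=> s s0; have /existsNP[t /not_implyP[St /negP]] : ~ ubound S s.
    by move=> bs; apply: Sb; exists s.
  by rewrite -ltNge => /ltW st; have [] := Sle _ _ St s0 st.
have clS := closure_sup (ex_intro _ _ S0) Sb.
have s0 : 0 <= sup S by exact: (ub_le_sup Sb S0).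
have nsup : nb M A (y + sup S *: z).
  apply: nb_closed => //; last exact: Oyz.
  apply: (@closure_map _ _ (fun s : R => y + s *: z) S) clS.
    apply: (@cvgD _ _ _ (nbhs (sup S))); first exact: cvg_cst.
    by apply: (@cvgZr_tmp _ _ _ (nbhs (sup S))); exact: cvg_id.
  by move=> s [].
exists (sup S) => //; split => // N N0 NM [y1 Ay1 [K1 K2]].
have [m m0 Om] := cint_absorb z (Oyz _ s0).
pose e := (M - N) / (N * m).
have e0 : 0 < e by rewrite divr_gt0 ?mulr_gt0// subr_gt0.
have Se : S (sup S + e).
  split; first by rewrite addr_ge0// ltW.
  exists ((1 + e * m) *: y1).
    by apply: csetZ => //; rewrite addr_gt0// mulr_gt0.
  split.
    have -> : (1 + e * m) *: y1 - (y + (sup S + e) *: z) =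
      (1 + e * m) *: (y1 - (y + sup S *: z)) + e *: (m *: (y + sup S *: z) - z).
      by mxring.
    apply: cclD; apply: cclZ => //; [|exact: ltW|exact: cint_ccl].
    by rewrite addr_ge0// mulr_ge0// ltW.
  have -> : M *: (y + (sup S + e) *: z) - (1 + e * m) *: y1 =
      (1 + e * m) *: (N *: (y + sup S *: z) - y1) + (M * e) *: z.
    by rewrite /e; mxfield; rewrite !lt0r_neq0.
  apply: cclD; apply: cclZ => //; last exact: cint_ccl.
    by rewrite addr_ge0// mulr_ge0// ltW.
  by rewrite mulr_ge0// ltW.
by have := ub_le_sup Sb Se; rewrite gerDl leNgt e0.
Qed.

End ConvexSets.

Lemma cvg_sum_seq (R : realType) (m n : nat) (J I : Type) (F : set_system I)
    {FF : Filter F} (r : seq J) (f : J -> I -> 'M[R]_(m, n)) (l : J -> 'M[R]_(m, n)) :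
  (forall j, f j i @[i --> F] --> l j) ->
  (\sum_(j <- r) f j i) @[i --> F] --> \sum_(j <- r) l j.
Proof.
move=> fl; elim: r => [|j r IH].
  rewrite big_nil; under eq_fun do rewrite big_nil; exact: cvg_cst.
by rewrite big_cons; under eq_fun do rewrite big_cons; exact: cvgD.
Qed.

Lemma mulmx_cvg (R : realType) (m d : nat) (I : Type) (F : set_system I)
    {FF : Filter F} (A : 'M[R]_(m, d)) (u : I -> 'cV[R]_d) l :
  u i @[i --> F] --> l -> A *m u i @[i --> F] --> A *m l.
Proof.
move=> ul.
have mulE (v : 'cV[R]_d) : A *m v = \sum_j v j 0 *: col j A.
  apply/matrixP => i k; rewrite ord1 !mxE summxE; apply: eq_bigr => j _.
  by rewrite !mxE mulrC.
rewrite mulE; under eq_fun do rewrite mulE.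
apply: cvg_sum_seq => j; apply: cvgZr_tmp.
by move=> W /(@coord_continuous _ _ _ j 0 l)/ul.
Qed.

Lemma mulmx_continuous (R : realType) (m d : nat) (A : 'M[R]_(m, d)) :
  continuous (mulmx A : 'cV[R]_d -> 'cV[R]_m).
Proof. by move=> v; apply: (@mulmx_cvg _ _ _ _ (nbhs v) _ A id v); exact: cvg_id. Qed.

(** * Automorphisms of a cone *)

Section ConeAction.
Variables (R : realType) (d : nat) (C : proper_cone R d).
Local Notation V := 'cV[R]_d.
Local Notation O := (cint C).
Local Notation K := (ccl C).
Local Notation h := (height C).
Local Notation hil := (hil C).
Local Notation nb := (nb C).
Local Notation cset := (cset C).
Local Notation bd := (bd C).
Local Notation ulim := (ulim C).
Implicit Types (u v w x y z : V) (M N a b s t : R) (Y : set V).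

Lemma ultra_scale (I : Type) (U : set_system I) {UU : UltraFilter U} (v : I -> V) :
  (\forall i \near U, K (v i) /\ v i != 0) ->
  exists (t : I -> R) l, [/\ \forall i \near U, 0 < t i, K l, h l = 1 &
    t i *: v i @[i --> U] --> l].
Proof.
move=> Kv; exists (fun i => (h (v i))^-1).
have [l [Kl hl vl]] : exists l, [/\ K l, h l = 1 &
    (h (v i))^-1 *: v i @[i --> U] --> l].
  apply: ultra_slice_cvg; apply: filterS Kv => i [Ki /(height_gt0 Ki) hi].
  split; first by apply: cclZ Ki; rewrite invr_ge0 ltW.
  by rewrite heightZ mulVf// gt_eqF.
exists l; split => //; apply: filterS Kv => i [Ki /(height_gt0 Ki) hi].
by rewrite invr_gt0.
Qed.

Record cone_aut (A : 'M[R]_d) : Prop := ConeAut {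
  aut_unit : A \in unitmx;
  autO : forall v, O v -> O (A *m v);
  autK : forall v, K v -> K (A *m v);
  autVO : forall v, O v -> O (invmx A *m v);
  autVK : forall v, K v -> K (invmx A *m v) }.

Lemma aut_hil A M u v : cone_aut A -> hil M u v -> hil M (A *m u) (A *m v).
Proof.
move=> cA [a a0 [K1 K2]]; exists a => //; split.
  by have := autK cA K1; rewrite mulmxBr -scalemxAr.
by have := autK cA K2; rewrite mulmxBr -!scalemxAr.
Qed.

Lemma cone_autV A : cone_aut A -> cone_aut (invmx A).
Proof. by case=> uA *; split; rewrite ?unitmx_inv ?invmxK. Qed.

Lemma aut_hilP A M u v : cone_aut A -> hil M (A *m u) (A *m v) <-> hil M u v.
Proof.
move=> cA; split; last exact: aut_hil.
by move=> /(aut_hil (cone_autV cA)); rewrite !mulKmx//; exact: aut_unit.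
Qed.

Definition mximg (A : 'M[R]_d) Y : set V := [set A *m v | v in Y].

Lemma mximgK A Y : A \in unitmx -> mximg (invmx A) (mximg A Y) = Y.
Proof.
move=> uA; apply/seteqP; split=> [_ [_ [v Yv <-] <-]|v Yv].
  by rewrite mulKmx.
by exists (A *m v); [exists v|rewrite mulKmx].
Qed.

Lemma mximgP A Y v : A \in unitmx -> mximg A Y (A *m v) <-> Y v.
Proof.
move=> uA; split=> [[w Yw /(congr1 (mulmx (invmx A)))]|Yv]; last by exists v.
by rewrite !mulKmx// => <-.
Qed.

Lemma nb_mximg A M Y u : cone_aut A -> nb M Y u -> nb M (mximg A Y) (A *m u).
Proof.
move=> cA [y Yy [K1 K2]]; exists (A *m y); first by exists y.
split; first by rewrite -mulmxBr; exact: autK.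
by rewrite scalemxAr -mulmxBr; exact: autK.
Qed.

Lemma nb_mximgP A M Y u : cone_aut A -> nb M (mximg A Y) (A *m u) <-> nb M Y u.
Proof.
move=> cA; split; last exact: nb_mximg.
move=> /(nb_mximg (cone_autV cA)); rewrite mximgK ?mulKmx//; exact: aut_unit cA.
Qed.

Lemma bd_sub Y Y' x : Y `<=` Y' -> bd Y x -> bd Y' x.
Proof. by move=> YY' [cl nO x0]; split => //; exact: closure_subset cl. Qed.

Lemma bd_hil_nO M x z : ~ O x -> 0 < M -> hil M x z -> ~ O z.
Proof. by move=> nO M0 /(hil_sym M0) H Oz; apply: nO; exact: hil_cint H. Qed.

(** The rays from [w i] towards [u i] stay in [Y i], and their limit is the ray from
    [lw] towards [lu]. *)
Lemma ulim_bd (I : Type) (U : set_system I) {UU : UltraFilter U} (Y : I -> set V)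
    (w u : I -> V) (lw lu : V) :
  (forall i, cset (Y i)) -> (\forall i \near U, Y i (w i)) ->
  (\forall i \near U, Y i (u i)) -> w i @[i --> U] --> lw ->
  u i @[i --> U] --> lu -> O lw -> K lu -> ~ O lu -> lu != 0 ->
  bd (ulim U Y) lu.
Proof.
move=> cY Yw Yu wl ul Olw Klu nO lu0; split => //.
apply: (closure_ray (y := lw)); first exact: csetZ (cset_ulim (U := U) cY).
move=> s s0; apply: (@ulim_in _ _ _ _ _ _ _ (fun i => w i + s *: u i)).
- by apply: cintD => //; exact: cclZ.
- by apply: cvgD => //; exact: cvgZl_tmp.
- apply: filterS2 Yw Yu => i Ywi Yui.
  by apply: cset_add_closure => //; exact: subset_closure.
Qed.

End ConeAction.

(** * Cocompact actions and invariant families *)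

(** What the proof uses of a convex cocompact group, for the matrices [G] that lift
    its elements and the cone [H] over its convex core. [hull_cocompact] is
    cocompactness on the core: every family of points of the core can be translated so
    as to converge in it. [hull_limit] says that limits of orbits are in the closure of
    the core. *)
Record cocompact_action (R : realType) (d : nat) (C : proper_cone R d)
    (G : set 'M[R]_d) (H : set 'cV[R]_d) : Prop := CocompactAction {
  act_aut : forall A, G A -> cone_aut C A;
  actV : forall A, G A -> G (invmx A);
  actM : forall A B, G A -> G B -> G (A *m B);
  hull_cset : cset C H;
  hull_inv : forall A v, G A -> H v -> H (A *m v);
  hull_cocompact : forall (I : Type) (U : set_system I) (u : I -> 'cV[R]_d),
    UltraFilter U -> (\forall i \near U, H (u i)) ->
    exists (A : I -> 'M[R]_d) w,
      [/\ forall i, G (A i), H w & A i *m u i @[i --> U] --> w];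
  hull_limit : forall (I : Type) (U : set_system I) (A : I -> 'M[R]_d)
      (t : I -> R) (p y : 'cV[R]_d),
    UltraFilter U -> cint C p -> (forall i, G (A i)) ->
    (\forall i \near U, 0 < t i) ->
    t i *: (A i *m p) @[i --> U] --> y -> y != 0 -> ~ cint C y -> closure H y }.

Record invariant_cfamily (R : realType) (d : nat) (C : proper_cone R d)
    (G : set 'M[R]_d) (H : set 'cV[R]_d) (X : set (set 'cV[R]_d)) : Prop :=
    InvariantCFamily {
  fam_cset : forall Y, X Y -> cset C Y;
  fam_hull : forall Y, X Y -> Y `<=` H;
  fam_unbounded : forall Y, X Y -> forall M, exists u v, [/\ Y u, Y v & ~ hil C M u v];
  fam_inv : forall A Y, X Y -> G A -> X (mximg A Y) }.

(** Limits of sequences are taken along an ultrafilter finer than the filter at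
    infinity. *)
Lemma free_ultrafilter : exists2 U : set_system nat, UltraFilter U &
  \oo `<=` U.
Proof.
by have [U [UU sU]] := @ultraFilterLemma _ (\oo : set_system nat) _; exists U.
Qed.

Lemma cvg_sub (I : Type) (F F' : set_system I) (T : topologicalType) (u : I -> T)
    (l : T) : F `<=` F' -> u i @[i --> F] --> l -> u i @[i --> F'] --> l.
Proof. by move=> FF' ul W /ul FW; exact: FF'. Qed.

Section Criterion.
Variables (R : realType) (d : nat) (C : proper_cone R d) (G : set 'M[R]_d)
  (H : set 'cV[R]_d) (X : set (set 'cV[R]_d)).
Hypotheses (GH : cocompact_action C G H) (XH : invariant_cfamily C G H X).
Local Notation V := 'cV[R]_d.
Local Notation O := (cint C).
Local Notation K := (ccl C).
Local Notation h := (height C).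
Local Notation hil := (hil C).
Local Notation nb := (nb C).
Local Notation cset := (cset C).
Local Notation bd := (bd C).
Local Notation ulim := (ulim C).
Implicit Types (u v w x y z : V) (M N a b s t : R) (Y : set V).

(** Closedness for the local Hausdorff topology, expressed by limits of families. *)
Definition ultraclosed := forall (I : Type) (U : set_system I) (Y : I -> set V),
  UltraFilter U -> (forall i, X (Y i)) -> ulim U Y !=set0 -> X (ulim U Y).

Definition disjoint_bd := forall Y1 Y2 x, X Y1 -> X Y2 -> bd Y1 x -> bd Y2 x ->
  Y1 = Y2.

(** Nontrivial segments of the ideal boundary of [H], given by their endpoints [x] and
    [y]; one interior point in the boundary forces the whole segment into it. *)
Definition segments_in := forall x y, bd H x -> bd H y -> bd H (x + y) ->
  (forall t, 0 < t -> y <> t *: x) ->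
  exists2 Y, X Y & closure Y x /\ closure Y y.

(** The second axiom of peripheral families, with bounds on the comparability
    constants in place of bounds on the diameters. *)
Definition bounded_overlap := forall M, 0 < M -> exists D, forall Y1 Y2,
  X Y1 -> X Y2 -> Y1 <> Y2 -> forall u v,
  nb M Y1 u -> nb M Y2 u -> nb M Y1 v -> nb M Y2 v -> hil D u v.

Lemma fam_O Y : X Y -> Y `<=` O.
Proof. by move=> XY; exact: csetO (fam_cset XH XY). Qed.

Lemma bd_fam_hull Y x : X Y -> bd Y x -> bd H x.
Proof. by move=> XY; apply: bd_sub; exact: fam_hull XH _ XY. Qed.

(** Comparable boundary points span a segment of the boundary: an interior point
    [x + z] would absorb [z] up to a multiple of [x], and [x] itself would be interior. *)
Lemma bd_sum_comparable x z M : 0 < h x -> bd H x -> bd H z -> hil M x z ->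
  bd H (x + z).
Proof.
move=> hx bx bz xz; have cH := hull_cset GH.
have hz := bd_height (csetO cH) bz.
case: bx => clx nx x0; case: bz => clz nz z0.
split.
- exact: (cset_closureD cH).
- move=> Oxz; apply: nx.
  case: xz => a a0 [_ K2].
  have M0 : 0 < M + a.
    have := ccl_height K2; rewrite heightB !heightZ subr_ge0 => E.
    rewrite -(pmulr_lgt0 _ hx) mulrDl; apply: addr_gt0; last exact: mulr_gt0.
    by apply: lt_le_trans E; exact: mulr_gt0.
  apply/(cintZP C _ M0).
  have -> : (M + a) *: x = (M *: x - a *: z) + a *: (x + z) by mxring.
  by apply: cclDO => //; exact: cintZ.
- apply: (@height_neq0 _ _ C); rewrite heightD; exact: addr_gt0.
Qed.

(** * Bounded overlaps from closedness and disjointness *)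

Section Sufficient.
Hypotheses (Xa : ultraclosed) (Xb : disjoint_bd) (Xc : segments_in).

(** Comparable ideal points of two members are equal or span a segment of the ideal
    boundary. The segment lies in the ideal boundary of a third member, which meets
    those of the first two. *)
Lemma fam_eq_comparable Y1 Y2 M x z : X Y1 -> X Y2 -> bd Y1 x -> bd Y2 z ->
  hil M x z -> Y1 = Y2.
Proof.
move=> X1 X2 b1 b2 xz.
have hx := bd_height (fam_O X1) b1.
have [[t t0 zE]|nprop] := pselect (exists2 t, 0 < t & z = t *: x).
  apply: (Xb X1 X2 (x := x)) => //; case: b2 => cl nO z0; split.
  - have -> : x = t^-1 *: z by rewrite zE scalerA mulVf ?gt_eqF// scale1r.
    by apply: cset_closureZ cl; [exact: fam_cset XH _ X2|rewrite invr_gt0].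
  - by case: b1.
  - by case: b1.
have bH1 := bd_fam_hull X1 b1; have bH2 := bd_fam_hull X2 b2.
have [|Y XY [clx clz]] := Xc bH1 bH2 (bd_sum_comparable hx bH1 bH2 xz).
  by move=> t t0 zE; apply: nprop; exists t.
have -> : Y1 = Y by apply: (Xb X1 XY b1); case: b1.
by apply: (Xb XY X2 _ b2); case: b2.
Qed.

(** The two families stay close between [w i] and [u i], and [u i] goes to infinity:
    their limits have comparable ideal points. *)
Lemma ulim_eq (I : Type) (U : set_system I) {UU : UltraFilter U}
    (Y Y' : I -> set V) M (w u : I -> V) lw lu :
  0 < M -> (forall i, X (Y i)) -> (forall i, X (Y' i)) ->
  (\forall i \near U, Y i (w i) /\ nb M (Y' i) (w i)) ->
  (\forall i \near U, Y i (u i) /\ nb M (Y' i) (u i)) ->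
  w i @[i --> U] --> lw -> u i @[i --> U] --> lu ->
  O lw -> K lu -> lu != 0 -> ~ O lu ->
  ulim U Y = ulim U Y' /\ X (ulim U Y).
Proof.
move=> M0 XY XY' Yw Yu wl ul Olw Klu lu0 nO.
have cY i : cset (Y i) by exact: fam_cset XH _ (XY i).
have cY' i : cset (Y' i) by exact: fam_cset XH _ (XY' i).
have wY : ulim U Y lw.
  by apply: (ulim_in Olw wl); apply: filterS Yw => i [].
have wY' : nb M (ulim U Y') lw.
  by apply: (nb_ulim cY' M0 Olw wl); apply: filterS Yw => i [].
have XZ : X (ulim U Y) by apply: Xa => //; exists lw.
have XZ' : X (ulim U Y') by apply: Xa => //; case: wY' => y Zy _; exists y.
split => //.
have bu : bd (ulim U Y) lu.
  apply: (@ulim_bd _ _ _ _ _ _ _ w u lw) => //.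
    by apply: filterS Yw => i [].
  by apply: filterS Yu => i [].
have [|y [ly [Yy yl [Ky KMy]]]] := nb_cvg (v := u) cY' M0 ul.
  by apply: filterS Yu => i [].
have [|x [lx [Yx xl [Kx KMx]]]] := nb_cvg (v := w) cY' M0 wl.
  by apply: filterS Yw => i [].
have Olx : O lx by rewrite -(subrK lw lx); exact: cclDO.
have xy : hil M lu ly by exists 1 => //; rewrite scale1r.
have Kly := hil_ccl Klu xy.
apply: (fam_eq_comparable XZ XZ' bu _ xy).
apply: (@ulim_bd _ _ _ _ _ _ _ x y lx) => //.
  exact: bd_hil_nO xy.
apply/eqP => ly0; move: Ky; rewrite ly0 sub0r => /ccl_height.
by rewrite heightN oppr_ge0 leNgt (height_gt0 Klu lu0).
Qed.

Lemma fam_far Y y M : X Y -> Y y -> exists2 z, Y z & ~ hil M y z.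
Proof.
move=> XY Yy; have cY := fam_cset XH XY; have Oy := csetO cY Yy.
apply: contrapT => nz.
have all z : Y z -> hil M y z.
  by move=> Yz; apply: contrapT => yz; apply: nz; exists z.
have M0 : 0 < M by apply: (hil_gt0 _ _ (all _ Yy)); exact: cint_height.
have [u [v [Yu Yv]]] := fam_unbounded XH XY (M * M); apply.
by apply: hil_trans (all _ Yv) => //; exact: hil_sym (all _ Yu).
Qed.

(** Used contrapositively: points that become far from a convergent family accumulate
    on the boundary. *)
Lemma near_hil_bound (I : Type) (U : set_system I) {UU : UltraFilter U}
    (w u : I -> V) lw lu : O lw -> O lu ->
  w i @[i --> U] --> lw -> u i @[i --> U] --> lu ->
  exists2 B, 0 < B & \forall i \near U, hil B (w i) (u i).
Proof.
move=> Ow Ou wl ul; have [B B1 HB] := hil_exists Ow Ou.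
have B0 : 0 < B by lra.
exists (2 * B * 2); first by rewrite !mulr_gt0.
have n1 : \forall i \near U, hil 2 lw (w i).
  by apply: (cvg_in wl); apply: near_hil => //; lra.
have n2 : \forall i \near U, hil 2 lu (u i).
  by apply: (cvg_in ul); apply: near_hil => //; lra.
apply: filterS2 n1 n2 => i h1 h2.
by apply: hil_trans h2 => //; apply: hil_trans HB => //; exact: hil_sym.
Qed.

(** A member is unbounded, so [ulim_eq] applies to the constant families along a
    sequence of points of [Y1] that goes to infinity. *)
Lemma fam_nb_eq Y1 Y2 M : 0 < M -> X Y1 -> X Y2 -> Y1 `<=` nb M Y2 -> Y1 = Y2.
Proof.
move=> M0 X1 X2 Y12.
have c1 := fam_cset XH X1; have c2 := fam_cset XH X2.
have [U UU Uoo] := free_ultrafilter.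
have {}Uoo n : \forall i \near U, (n <= i)%N by apply: Uoo; exact: nbhs_infty_ge.
have [y [_ [Yy _ _]]] := fam_unbounded XH X1 1.
have /choice[z zP] : forall n : nat, exists z, Y1 z /\ ~ hil n%:R y z.
  by move=> n; have [z Yz nz] := fam_far n%:R X1 Yy; exists z.
have Kz : \forall i \near U, K (z i) /\ z i != 0.
  apply: nearW => i; have Oz := fam_O X1 (zP i).1.
  by split; [exact: cint_ccl|exact: cint_nz Oz].
have [t [l [t0 Kl hl zl]]] := ultra_scale Kz.
have nl : ~ O l.
  move=> Ol.
  have [B B0] := near_hil_bound (fam_O X1 Yy) Ol (cvg_cst y) zl.
  have [n Bn] : exists n : nat, B <= n%:R.
    by exists (Num.bound B); apply/ltW/archi_boundP/ltW.
  move=> HB; have [i [[HBi ti] ni]] := near_ex (filterI (filterI HB t0) (Uoo n)).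
  apply: (zP i).2; apply: (@hil_le _ _ _ B); last by rewrite -(hilZr _ _ _ _ ti).
    by apply: (le_trans Bn); rewrite ler_nat.
  exact: (cint_ccl (fam_O X1 Yy)).
have := @ulim_eq _ U _ (fun=> Y1) (fun=> Y2) M (fun=> y) (fun i => t i *: z i) y l.
rewrite !ulim_cst//; case=> //.
- by apply: nearW => i; split => //; exact: Y12.
- by apply: filterS t0 => i ti; split;
    [exact: (csetZ c1 ti (zP i).1)|apply: nbZ => //; exact: Y12 (zP i).1].
- exact: cvg_cst.
- exact: fam_O Yy.
- by apply: (@height_neq0 _ _ C); rewrite hl.
Qed.

(** If overlaps were unbounded, there would be pairs of distinct members that stay
    close between two points at increasing distance. Translating one of the two points
    into a bounded region, the two families have the same limit by [ulim_eq]. As the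
    members are distinct, the first one leaves the [2]-neighbourhood of the second one
    at some point [w i], at distance [2] from it. These points go to infinity, since the
    limits agree. Translating [w i] into a bounded region, the members are close between
    [w i] and the translate of the first point, which now goes to infinity; hence the
    limits agree again, contradicting the distance at [w i]. *)
Lemma overlap_of_closed : bounded_overlap.
Proof.
move=> M M0; apply: contrapT => nD.
(* both points can be taken in the first member, at the price of squaring the constant *)
have far (n : nat) : exists p : (set V * set V) * (V * V),
    [/\ X p.1.1, X p.1.2, p.1.1 <> p.1.2 &
     [/\ p.1.1 p.2.1, nb (M * M) p.1.2 p.2.1, p.1.1 p.2.2, nb (M * M) p.1.2 p.2.2
       & ~ hil n%:R p.2.1 p.2.2]].
  apply: contrapT => np; apply: nD; exists (M * n%:R * M) => Y1 Y2 X1 X2 Y12 u v u1 u2 v1 v2.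
  have c1 := fam_cset XH X1; have c2 := fam_cset XH X2.
  have /(nbP C _ _ (csetZ c1))[y Yy uy] := u1.
  have /(nbP C _ _ (csetZ c1))[z Yz vz] := v1.
  apply: contrapT => uv; apply: np; exists ((Y1, Y2), (y, z)); split => //=; split => //.
  - by apply: nb_hil u2 _ => //; exact: hil_sym.
  - by apply: nb_hil v2 _ => //; exact: hil_sym.
  - move=> yz; apply: uv; apply: (@hil_trans _ _ _ _ _ _ z) => //.
      apply: (hil_trans _ uy yz); apply: (hil_gt0 _ _ yz).
        exact: (cint_height (fam_O X1 Yy)).
      exact: (cint_height (fam_O X1 Yz)).
    exact: hil_sym.
have MM0 : 0 < M * M by exact: mulr_gt0.
(* translate the first point into a bounded region *)
have /choice[p pP] := far.
have [U UU Uoo] := free_ultrafilter.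
have {}Uoo n : \forall i \near U, (n <= i)%N by apply: Uoo; exact: nbhs_infty_ge.
have [A [lu [GA Hlu ul]]] := hull_cocompact GH (u := fun i => (p i).2.1) UU
  (nearW _ (fun i => fam_hull XH (let: And4 X1 _ _ _ := pP i in X1)
     (let: And4 _ _ _ (And5 Yu _ _ _ _) := pP i in Yu))).
pose Y i := mximg (A i) (p i).1.1; pose Y' i := mximg (A i) (p i).1.2.
pose u i := A i *m (p i).2.1; pose v i := A i *m (p i).2.2.
have XY i : X (Y i) by have [X1 _ _ _] := pP i; exact: fam_inv XH _ _ X1 (GA i).
have XY' i : X (Y' i) by have [_ X1 _ _] := pP i; exact: fam_inv XH _ _ X1 (GA i).
have cY i : cset (Y i) by exact: fam_cset XH _ (XY i).
have cY' i : cset (Y' i) by exact: fam_cset XH _ (XY' i).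
have aA i : cone_aut C (A i) by exact: act_aut GH _ (GA i).
have YY' i : Y i <> Y' i.
  have [_ _ + _] := pP i; apply: contra_not => E.
  rewrite -(mximgK (p i).1.1 (aut_unit (aA i))) -(mximgK (p i).1.2 (aut_unit (aA i))).
  by congr mximg.
have Yu i : Y i (u i).
  by have [_ _ _ [Yu _ _ _ _]] := pP i; apply/mximgP => //; exact: aut_unit (aA i).
have Yv i : Y i (v i).
  by have [_ _ _ [_ _ Yv _ _]] := pP i; apply/mximgP => //; exact: aut_unit (aA i).
have nu i : nb (M * M) (Y' i) (u i).
  by have [_ _ _ [_ nu _ _ _]] := pP i; exact: nb_mximg (aA i) nu.
have nv i : nb (M * M) (Y' i) (v i).
  by have [_ _ _ [_ _ _ nv _]] := pP i; exact: nb_mximg (aA i) nv.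
have uv i : ~ hil i%:R (u i) (v i).
  by have [_ _ _ [_ _ _ _ uv]] := pP i; move=> /(aut_hilP _ _ _ (aA i)).
have Olu : O lu by exact: csetO (hull_cset GH) _ Hlu.
have Kv : \forall i \near U, K (v i) /\ v i != 0.
  apply: nearW => i; have Ov := csetO (cY i) (Yv i).
  by split; [exact: cint_ccl|exact: cint_nz Ov].
have [t [lv [t0 Klv hlv vl]]] := ultra_scale Kv.
have nlv : ~ O lv.
  move=> Olv; have [B B0 HB] := near_hil_bound Olu Olv ul vl.
  have [n Bn] : exists n : nat, B <= n%:R.
    by exists (Num.bound B); apply/ltW/archi_boundP/ltW.
  have [i [[HBi ti] ni]] := near_ex (filterI (filterI HB t0) (Uoo n)).
  apply: (uv i); apply: (@hil_le _ _ _ B); last by rewrite -(hilZr _ _ _ _ ti).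
    by apply: (le_trans Bn); rewrite ler_nat.
  exact: (cint_ccl (csetO (cY i) (Yu i))).
have [ZZ' XZ] : ulim U Y = ulim U Y' /\ X (ulim U Y).
  apply: (@ulim_eq _ U _ Y Y' (M * M) u (fun i => t i *: v i) lu lv) => //.
  - exact: nearW.
  - by apply: filterS t0 => i ti; split; [exact: csetZ|exact: nbZ].
  - by apply: (@height_neq0 _ _ C); rewrite hlv.
have Zu : ulim U Y lu by apply: (ulim_in Olu ul); exact: nearW.
have nu2 : \forall i \near U, nb 2 (Y' i) (u i).
  by apply: (@ulim_near _ _ _ _ _ _ _ _ lu) => //; [rewrite -ZZ'|lra].
(* the first member leaves the [2]-neighbourhood of the second one at [w i]; by the
   choice of a last point, [w i] is not in the smaller neighbourhood *)
have leave : \forall i \near U, exists w, Y i w /\ (nb 2 (Y' i) w /\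
    ~ nb (3 / 2) (Y' i) w).
  apply: filterS nu2 => i nui.
  have [q Yq nq] : exists2 q, Y i q & ~ nb 2 (Y' i) q.
    apply: contrapT => nq; apply: (YY' i); apply: (@fam_nb_eq _ _ 2) => // q Yq.
    by apply: contrapT => nnq; apply: nq; exists q.
  have Oq := csetO (cY i) Yq.
  have [s s0 [ns nNs]] := nb_crossing (cY' i) (ltr0n _ 2) nui Oq nq.
  exists (u i + s *: q); split; last by split => //; apply: nNs; lra.
  by apply: (cset_add_closure (cY i)) => //; exact: subset_closure.
have [w wP] := near_choice leave.
have Kw : \forall i \near U, K (w i) /\ w i != 0.
  apply: filterS wP => i [Yw _]; have Ow := csetO (cY i) Yw.
  by split; [exact: cint_ccl|exact: cint_nz Ow].
have [r [lw [r0 Klw hlw wl]]] := ultra_scale Kw.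
(* [w i] goes to infinity: a limit [lw] in the open cone would be in the common limit,
   and [w i] would be closer to the second member than it is *)
have nlw : ~ O lw.
  move=> Olw; have Zw : ulim U Y lw.
    apply: (ulim_in Olw wl); apply: filterS2 wP r0 => i [Yw _] ri; exact: csetZ.
  have n32 : \forall i \near U, nb (3 / 2) (Y' i) (r i *: w i).
    by apply: (@ulim_near _ _ _ _ _ _ _ _ lw) => //; [rewrite -ZZ'|lra].
  have [i [[ni ri] [_ [_ []]]]] := near_ex (filterI (filterI n32 r0) wP).
  have := nbZ (cY' i) (t := (r i)^-1) _ ni; rewrite scalerA mulVf ?gt_eqF// scale1r.
  by apply; rewrite invr_gt0.
(* translate [w i] into a bounded region; now the first point goes to infinity *)
have Hw : \forall i \near U, H (w i).
  by apply: filterS wP => i [Yw _]; exact: fam_hull XH _ (XY i) _ Yw.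
have [B [lw' [GB Hlw' wl']]] := hull_cocompact GH UU Hw.
have aB i : cone_aut C (B i) by exact: act_aut GH _ (GB i).
have Olw' : O lw' by exact: csetO (hull_cset GH) _ Hlw'.
have Ku : \forall i \near U, K (B i *m u i) /\ B i *m u i != 0.
  apply: nearW => i; have Ou := autO (aB i) (csetO (cY i) (Yu i)).
  by split; [exact: cint_ccl|exact: cint_nz Ou].
have [r' [lu' [r'0 Klu' hlu' ul']]] := ultra_scale Ku.
have nlu' : ~ O lu'.
  move=> Olu'; have [D D0 HD] := near_hil_bound Olw' Olu' wl' ul'.
  apply: nlw; apply: (hil_cint Olu (M := D)).
  apply: (@hil_cvg _ _ _ _ U _ _ u (fun i => r i *: w i)) => //.
  - apply: filterS3 HD r'0 r0 => i HDi r'i ri.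
    rewrite hilZr//; apply: hil_sym => //; rewrite -(aut_hilP _ _ _ (aB i)).
    by rewrite -(hilZr _ _ _ _ r'i).
  - exact: cint_height.
  - by rewrite hlw.
have XBY i : X (mximg (B i) (Y i)) by exact: fam_inv XH _ _ (XY i) (GB i).
have XBY' i : X (mximg (B i) (Y' i)) by exact: fam_inv XH _ _ (XY' i) (GB i).
have [E _] : ulim U (fun i => mximg (B i) (Y i)) = ulim U (fun i => mximg (B i) (Y' i)) /\
    X (ulim U (fun i => mximg (B i) (Y i))).
  apply: (@ulim_eq _ U _ _ _ 2 (fun i => B i *m w i) (fun i => r' i *: (B i *m u i))
    lw' lu') => //.
  - apply: filterS wP => i [Yw [nw _]]; split; last exact: nb_mximg.
    by apply/mximgP => //; exact: aut_unit (aB i).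
  - apply: filterS2 r'0 nu2 => i ri nui; rewrite scalemxAr; split.
      by apply/mximgP; [exact: aut_unit (aB i)|exact: csetZ].
    by apply: nb_mximg => //; exact: nbZ.
  - by apply: (@height_neq0 _ _ C); rewrite hlu'.
(* the limits of the new translates agree too, so the translate of [w i] is again too
   close to the second member *)
have Zw' : ulim U (fun i => mximg (B i) (Y i)) lw'.
  apply: (ulim_in Olw' wl'); apply: filterS wP => i [Yw _].
  by apply/mximgP => //; exact: aut_unit (aB i).
have n32 : \forall i \near U, nb (3 / 2) (mximg (B i) (Y' i)) (B i *m w i).
  apply: (@ulim_near _ _ _ _ _ _ _ _ lw') => //; [|by rewrite -E|lra].
  by move=> i; exact: fam_cset XH _ (XBY' i).
have [i [/(nb_mximgP _ _ _ (aB i)) ni [_ [_ []]]]] := near_ex (filterI n32 wP).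
exact: ni.
Qed.

(** Each edge at [v i0] lies in a member; these members share the ideal point [v i0]. *)
Lemma vertices_in_member (J : Type) (v : J -> V) i0 i1 : i0 <> i1 ->
  (forall i, bd H (v i)) -> (forall i, i <> i0 -> bd H (v i0 + v i)) ->
  (forall i t, i <> i0 -> v i <> t *: v i0) ->
  exists2 Y, X Y & forall i, closure Y (v i).
Proof.
move=> i01 bv bs nprop.
have edge i : i <> i0 -> exists2 Y, X Y & closure Y (v i0) /\ closure Y (v i).
  by move=> ii0; apply: (Xc (bv i0) (bv i) (bs i ii0)) => t _; exact: nprop.
have [Y XY [cl0 cl1]] := edge i1 (nesym i01).
have [_ nO v0] := bv i0.
have bY : bd Y (v i0) := And3 cl0 nO v0.
exists Y; first exact: XY.
move=> i; have [->|ii0] := pselect (i = i0); first exact: cl0.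
have [Z XZ [clZ0 clZi]] := edge i ii0.
by rewrite (Xb XY XZ bY (And3 clZ0 nO v0)).
Qed.

End Sufficient.
End Criterion.

(** * Consequences of bounded overlaps *)

Section Necessary.
Variables (R : realType) (d : nat) (C : proper_cone R d) (G : set 'M[R]_d)
  (H : set 'cV[R]_d) (X : set (set 'cV[R]_d)).
Hypotheses (GH : cocompact_action C G H) (XH : invariant_cfamily C G H X).
Local Notation V := 'cV[R]_d.
Local Notation O := (cint C).
Local Notation K := (ccl C).
Local Notation h := (height C).
Local Notation hil := (hil C).
Local Notation nb := (nb C).
Local Notation cset := (cset C).
Local Notation bd := (bd C).
Local Notation ulim := (ulim C).
Implicit Types (u v w x y z : V) (M N a b s t : R) (Y : set V).

Lemma ulim_near_eq (I : Type) (U : set_system I) {UU : UltraFilter U}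
    (Y Y' : I -> set V) : (\forall i \near U, Y i = Y' i) -> ulim U Y = ulim U Y'.
Proof.
move=> E; apply/seteqP; split=> v [Ov Yv]; split => // W /Yv.
  by apply: filterS2 E => i ->.
by apply: filterS2 E => i ->.
Qed.

(** Each member that comes close to [v] is unbounded and convex, so it has a point at a
    prescribed distance from [v]: the last point of a segment in a ball. The prescribed
    distance keeps these points in a bounded region, and the limit has one too. *)
Lemma ulim_unbounded (I : Type) (U : set_system I) {UU : UltraFilter U}
    (Y : I -> set V) v M : (forall i, X (Y i)) -> ulim U Y v -> 1 <= M ->
  exists2 w, ulim U Y w & ~ hil M v w.
Proof.
move=> XY [Ov Yv] M1; have M0 : 0 < M by lra.
have cY i : cset (Y i) by exact: fam_cset XH _ (XY i).
have M8 : 0 < 8 * M by lra.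
have : \forall i \near U, exists p : V * V, [/\ Y i p.2, hil 2 v p.1,
    hil (8 * M) p.2 p.1 & ~ hil (4 * M) p.2 p.1].
  have v2 : \forall y \near v, hil 2 v y by apply: near_hil => //; lra.
  apply: filterS (Yv _ v2) => i [y [Yy vy]].
  have Oy := csetO (cY i) Yy.
  have [z Yz yz] := fam_far XH (8 * M) (XY i) Yy.
  have M81 : 1 <= 8 * M by lra.
  have ny : nb (8 * M) (raycone y) y.
    by apply/nb_raycone; apply: hil_refl => //; exact: cint_ccl.
  have nz : ~ nb (8 * M) (raycone y) z.
    by move=> /nb_raycone /(hil_sym M8).
  have [s s0 [ns nNs]] := nb_crossing (cset_raycone Oy) M8 ny (csetO (cY i) Yz) nz.
  exists (y, y + s *: z); split => //=.
  - by apply: (cset_add_closure (cY i)) => //; exact: subset_closure.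
  - exact/nb_raycone.
  - by move=> /nb_raycone; apply: nNs; lra.
move=> /near_choice[p pP].
pose w i := (p i).2.
have Kw : \forall i \near U, K (w i) /\ w i != 0.
  apply: filterS pP => i [Yw _ _ _]; have Ow := csetO (cY i) Yw.
  by split; [exact: cint_ccl|exact: cint_nz Ow].
have [t [lw [t0 Klw hlw wl]]] := ultra_scale Kw.
have vw : hil (2 * (8 * M)) v lw.
  apply: (@hil_cvg _ _ _ _ U _ _ (fun=> v) (fun i => t i *: w i)) => //.
  - apply: filterS2 t0 pP => i ti [_ v2 w8 _]; rewrite hilZr//.
    by apply: hil_trans v2 _ => //; exact: hil_sym.
  - exact: cvg_cst.
  - exact: cint_height.
  - by rewrite hlw.
have Ow := hil_cint Ov vw.
exists lw.
  apply: (ulim_in Ow wl); apply: filterS2 t0 pP => i ti [Yw _ _ _].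
  exact: csetZ.
move=> vwM.
have n2 : \forall i \near U, hil 2 lw (t i *: w i).
  by apply: (cvg_in wl); apply: near_hil => //; lra.
have [i [[wi ti] [_ v2 _]]] := near_ex (filterI (filterI n2 t0) pP); apply.
have -> : 4 * M = 2 * M * 2 by ring.
rewrite -(hilZl _ _ _ _ ti); apply: hil_trans v2 => //.
apply: (@hil_trans _ _ _ 2 M _ lw) => //; exact: hil_sym.
Qed.

(** Translations preserve comparability, so [u i] and the inverse translate of [q] are
    comparable with constants tending to [1], and have the same normalized limit. *)
Lemma pull_back (I : Type) (U : set_system I) {UU : UltraFilter U}
    (B : I -> 'M[R]_d) (u : I -> V) (t : I -> R) q y :
  (forall i, cone_aut C (B i)) -> O q -> (\forall i \near U, K (u i)) ->
  B i *m u i @[i --> U] --> q -> (\forall i \near U, 0 < t i) ->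
  t i *: u i @[i --> U] --> y -> K y -> h y = 1 ->
  exists2 r : I -> R, (\forall i \near U, 0 < r i) &
    r i *: (invmx (B i) *m q) @[i --> U] --> y.
Proof.
move=> aB Oq Ku uq t0 uy Ky hy.
have OBq i : O (invmx (B i) *m q) by exact: autVO (aB i) _ Oq.
have Kv : \forall i \near U, K (invmx (B i) *m q) /\ invmx (B i) *m q != 0.
  by apply: nearW => i; split; [exact: cint_ccl|exact: cint_nz (OBq i)].
have [r [y' [r0 Ky' hy' vy']]] := ultra_scale Kv.
suff <- : y' = y by exists r.
apply: (@hil1 _ _ C) => // M M1.
apply: (@hil_cvg _ _ _ _ U _ _ (fun i => t i *: u i)
  (fun i => r i *: (invmx (B i) *m q))) => //; last 2 first.
- by rewrite hy.
- by rewrite hy'.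
have nq : \forall i \near U, hil M q (B i *m u i).
  by apply: (cvg_in uq); exact: near_hil.
apply: filterS3 nq t0 r0 => i nqi ti ri.
rewrite hilZr// hilZl//; apply: hil_sym; first lra.
by rewrite -(aut_hilP _ _ _ (aB i)) mulKVmx//; exact: aut_unit (aB i).
Qed.

Lemma closureZP Y x t : cset Y -> 0 < t -> closure Y (t *: x) -> closure Y x.
Proof.
move=> cY t0 cl; have -> : x = t^-1 *: (t *: x).
  by rewrite scalerA mulVf ?gt_eqF// scale1r.
by apply: (cset_closureZ cY _ cl); rewrite invr_gt0.
Qed.

Lemma harmonic_ray (U : set_system nat) {UF : Filter U} y x c : \oo `<=` U ->
  (harmonic n * c) *: (y + n.+1%:R *: x) @[n --> U] --> c *: (x : V).
Proof.
move=> Uoo.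
have -> : (fun n => (harmonic n * c) *: (y + n.+1%:R *: x)) =
    (fun n => (harmonic n : R) *: (c *: y) + c *: x).
  apply/funext => n; rewrite /harmonic /=; mxfield.
  by rewrite addrC natr1 pnatr_eq0.
apply: cvg_sub Uoo _.
rewrite -[X in _ --> X]add0r -(scale0r (c *: y)); apply: cvgD; last exact: cvg_cst.
by apply: cvgZr_tmp; exact: cvg_harmonic.
Qed.

(** Rays to [x] from a point [p] of the core stay at bounded distance from rays to
    [y]. Translating the former back into a bounded region makes the latter converge to
    a point [q] of the open cone; undoing the translations shows that [y] is a limit of
    the orbit of [q]. *)
Lemma hull_face x y M : bd H x -> hil M x y -> bd H y.
Proof.
move=> bx xy; have cH := hull_cset GH.
have hx := bd_height (csetO cH) bx; have [clx nx x0] := bx.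
have Kx := closure_ccl (csetO cH) clx.
have Ky := hil_ccl Kx xy.
have M1 := hil_ge1 hx xy; have M0 : 0 < M by lra.
have ny : ~ O y by apply: bd_hil_nO xy.
have [a a0 [K1 K2]] := xy.
have hy : 0 < h y.
  rewrite -(pmulr_rgt0 _ a0); have := ccl_height K1.
  by rewrite heightB heightZ subr_ge0; exact: lt_le_trans.
suff cly : closure H ((h y)^-1 *: y).
  split => //; last exact: (@height_neq0 _ _ C).
  by apply: (closureZP cH _ cly); rewrite invr_gt0.
have [p [Hp _]] : (H `&` setT) !=set0 by apply: clx; exact: filterT.
have Op := csetO cH Hp.
have [U UU Uoo] := free_ultrafilter.
pose u n := p + n.+1%:R *: x.
pose v n := p + n.+1%:R *: (a *: y).
have Hu n : H (u n) by exact: (cset_add_closure cH).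
have Ov n : O (v n) by apply: cintD => //; do 2 apply: cclZ => //; exact: ltW.
have uv n : hil M (u n) (v n).
  exists 1 => //; rewrite scale1r; split.
    have -> : v n - u n = n.+1%:R *: (a *: y - x) by rewrite /v /u; mxring.
    exact: cclZ.
  have -> : M *: u n - v n = (M - 1) *: p + n.+1%:R *: (M *: x - a *: y).
    by rewrite /v /u; mxring.
  by apply: cclD; apply: cclZ => //; [rewrite subr_ge0|exact: cint_ccl].
have [A [p' [GA Hp' up']]] := hull_cocompact GH UU (nearW _ Hu).
have aA i : cone_aut C (A i) by exact: act_aut GH _ (GA i).
have Op' := csetO cH Hp'.
have Kv : \forall i \near U, K (A i *m v i) /\ A i *m v i != 0.
  apply: nearW => i; have Oi := autO (aA i) (Ov i).
  by split; [exact: cint_ccl|exact: cint_nz Oi].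
have [s [q [s0 Kq hq vq]]] := ultra_scale Kv.
have Oq : O q.
  apply: (hil_cint Op' (M := M)).
  apply: (@hil_cvg _ _ _ _ U _ _ (fun i => A i *m u i) (fun i => s i *: (A i *m v i))) => //.
  - by apply: filterS s0 => i si; rewrite hilZr//; exact: aut_hil.
  - exact: cint_height.
  - by rewrite hq.
have hy0 := lt0r_neq0 hy; have a_neq0 := lt0r_neq0 a0.
have [r r0 rq] : exists2 r : nat -> R, (\forall i \near U, 0 < r i) &
    r i *: (invmx (A i) *m q) @[i --> U] --> (h y)^-1 *: y.
  apply: (@pull_back _ U _ A (fun i => s i *: v i)
    (fun i => (s i)^-1 * (harmonic i / (a * h y)))) => //.
  - apply: filterS s0 => i si; apply: cclZ; first exact: ltW.
    exact: cint_ccl.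
  - by under eq_fun do rewrite -scalemxAr.
  - apply: filterS s0 => i si; by rewrite mulr_gt0 ?invr_gt0// divr_gt0 ?mulr_gt0 ?invr_gt0.
  - rewrite (_ : (h y)^-1 *: y = (a * h y)^-1 *: (a *: y)).
      apply: cvg_near_eq (@harmonic_ray U _ p (a *: y) (a * h y)^-1 Uoo).
      apply: filterS s0 => i si; rewrite scalerA mulrAC mulVf ?mul1r//.
      exact: lt0r_neq0.
    by mxfield; rewrite hy0 a_neq0.
  - by apply: cclZ => //; rewrite invr_ge0 ltW.
  - by rewrite heightZ mulVf.
apply: (hull_limit GH (U := U) (A := fun i => invmx (A i)) (t := r) (p := q)) => //.
- by move=> i; exact: actV GH _ (GA i).
- by rewrite scaler_eq0 negb_or invr_eq0 hy0 (height_neq0 hy).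
- by rewrite cintZP ?invr_gt0.
Qed.

Section Overlap.
Hypothesis Xov : bounded_overlap C X.

(** The limit contains two points that are too far apart for the overlap of two distinct
    members; all members close to both points are therefore equal. *)
Lemma fam_isolated (I : Type) (U : set_system I) {UU : UltraFilter U}
    (Y : I -> set V) : (forall i, X (Y i)) -> ulim U Y !=set0 ->
  X (ulim U Y) /\ \forall i \near U, Y i = ulim U Y.
Proof.
move=> XY [v Zv].
have cY i : cset (Y i) by exact: fam_cset XH _ (XY i).
have Ov : O v by case: Zv.
have [D HD] := Xov (ltr0n _ 2).
have D0 : 1 <= Num.max D 1 by rewrite le_max lexx orbT.
have [w Zw vw] := ulim_unbounded XY Zv D0.
have nv : \forall i \near U, nb 2 (Y i) v.
  by apply: (ulim_near cY Zv (cvg_cst v)); lra.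
have nw : \forall i \near U, nb 2 (Y i) w.
  by apply: (ulim_near cY Zw (cvg_cst w)); lra.
have nvw : \forall i \near U, nb 2 (Y i) v /\ nb 2 (Y i) w by exact: filterI nv nw.
have [j [vj wj]] := near_ex nvw.
(* members close to [v] and [w] have an overlap that is too large to be distinct *)
have Ej : \forall i \near U, Y i = Y j.
  apply: filterS nvw => i [vi wi]; apply: contrapT => ij; apply: vw.
  apply: hil_le (HD _ _ (XY i) (XY j) ij _ _ vi vj wi wj); last exact: cint_ccl.
  by rewrite le_max lexx.
have -> : ulim U Y = Y j by rewrite (ulim_near_eq Ej) (ulim_cst (cY j)).
by [].
Qed.

(** Rays of two members to a common ideal point stay at bounded distance. *)
Lemma disjoint_of_overlap : disjoint_bd C X.
Proof.
move=> Y1 Y2 x X1 X2 b1 b2; apply: contrapT => Y12.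
have c1 := fam_cset XH X1; have c2 := fam_cset XH X2.
have [p1 [_ [Y1p _ _]]] := fam_unbounded XH X1 1.
have [p2 [_ [Y2p _ _]]] := fam_unbounded XH X2 1.
have O1 := csetO c1 Y1p; have O2 := csetO c2 Y2p.
have [M M1 [a a0 [K1 K2]]] := hil_exists O1 O2.
have M0 : 0 < M by lra.
have [D HD] := Xov M0.
have hx := bd_height (csetO c1) b1.
have [cl1 nx x0] := b1; have [cl2 _ _] := b2.
have Kx := closure_ccl (csetO c1) cl1.
(* the ray from [p1] to [x] is in [Y1] and close to the ray from [p2] to [x] *)
have n1 s : 0 <= s -> nb M Y1 (p1 + s *: x).
  move=> s0; apply: (nb_self M1 (csetO c1)); exact: (cset_add_closure c1).
have n2 s : 0 <= s -> nb M Y2 (p1 + s *: x).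
  move=> s0; exists (a *: (p2 + (s / a) *: x)).
    by apply: (csetZ c2) => //; apply: (cset_add_closure c2) => //; rewrite divr_ge0// ltW.
  have -> : a *: (p2 + (s / a) *: x) = a *: p2 + s *: x.
    by mxfield; exact: lt0r_neq0.
  split; first by have -> : a *: p2 + s *: x - (p1 + s *: x) = a *: p2 - p1 by mxring.
  have -> : M *: (p1 + s *: x) - (a *: p2 + s *: x) =
     (M *: p1 - a *: p2) + ((M - 1) * s) *: x by mxring.
  by apply: cclD => //; apply: cclZ => //; rewrite mulr_ge0// subr_ge0.
have close s : 0 <= s -> hil D p1 (p1 + s *: x).
  move=> s0; apply: (HD _ _ X1 X2 Y12); [| | exact: n1|exact: n2].
  - by have := n1 0 (lexx 0); rewrite scale0r addr0.
  - by have := n2 0 (lexx 0); rewrite scale0r addr0.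
apply: nx; apply: (hil_cint O1 (M := D)).
have [U UU Uoo] := free_ultrafilter.
apply: (@hil_cvg _ _ _ _ U _ _ (fun=> p1) (fun n => harmonic n *: p1 + x)).
- apply: nearW => n.
  have -> : harmonic n *: p1 + x = harmonic n *: (p1 + n.+1%:R *: x).
    rewrite /harmonic /=; mxfield; rewrite addrC natr1 pnatr_eq0//.
  by rewrite hilZr ?harmonic_gt0//; exact: close.
- exact: cvg_cst.
- rewrite -[X in _ --> X]add0r -(scale0r p1); apply: cvgD; last exact: cvg_cst.
  by apply: cvgZr_tmp; apply: cvg_sub Uoo _; exact: cvg_harmonic.
- exact: cint_height.
- exact: hx.
Qed.

(** Translate a ray of [Y] to [x] back into a bounded region. The translates of [Y]
    accumulate, hence are eventually constant by [fam_isolated]: composing with the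
    inverse of one of the translations yields elements that stabilize [Y]. *)
Lemma stab_limit Y x : X Y -> bd Y x ->
  exists (U : set_system nat) (A : nat -> 'M[R]_d) (t : nat -> R) p,
  [/\ UltraFilter U, O p, (\forall i \near U, [/\ G (A i), mximg (A i) Y = Y & 0 < t i])
    & t i *: (A i *m p) @[i --> U] --> (h x)^-1 *: x].
Proof.
move=> XY bx; have cY := fam_cset XH XY.
have hx := bd_height (csetO cY) bx; have [clx nx x0] := bx.
have Kx := closure_ccl (csetO cY) clx.
have [p [_ [Yp _ _]]] := fam_unbounded XH XY 1.
have [U UU Uoo] := free_ultrafilter.
pose u n := p + n.+1%:R *: x.
have Yu n : Y (u n) by exact: (cset_add_closure cY).
have Hu n : H (u n) by exact: fam_hull XH _ XY _ (Yu n).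
have [A [k [GA Hk uk]]] := hull_cocompact GH UU (nearW _ Hu).
have aA i : cone_aut C (A i) by exact: act_aut GH _ (GA i).
have Ok : O k by exact: csetO (hull_cset GH) _ Hk.
have XA i : X (mximg (A i) Y) by exact: fam_inv XH _ _ XY (GA i).
have Zk : ulim U (fun i => mximg (A i) Y) k.
  by apply: (ulim_in Ok uk); apply: nearW => i; exists (u i).
have [XZ nZ] := fam_isolated XA (ex_intro _ k Zk).
have [j jZ] := near_ex nZ.
(* [B i] sends [Y] to its [i]-th translate and then back, as that translate is equal to
   the [j]-th one *)
pose B i := invmx (A j) *m A i.
have GB i : G (B i) by apply: (actM GH) => //; exact: (actV GH).
have aB i : cone_aut C (B i) by exact: act_aut GH _ (GB i).
have BY : \forall i \near U, mximg (B i) Y = Y.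
  apply: filterS nZ => i iZ.
  rewrite -[RHS](mximgK Y (aut_unit (aA j))) jZ -iZ.
  apply/seteqP; split=> [_ [y Yy <-]|_ [_ [y Yy <-] <-]].
    by exists (A i *m y); [exists y|rewrite mulmxA].
  by exists y => //; rewrite /B mulmxA.
have hx0 := lt0r_neq0 hx.
have [r r0 rq] : exists2 r : nat -> R, (\forall i \near U, 0 < r i) &
    r i *: (invmx (B i) *m (invmx (A j) *m k)) @[i --> U] --> (h x)^-1 *: x.
  apply: (@pull_back _ U _ B u (fun i => harmonic i / h x)) => //.
  - exact: autVO (aA j) _ Ok.
  - by apply: nearW => i; exact: cint_ccl (csetO cY (Yu i)).
  - by under eq_fun do rewrite -mulmxA; exact: mulmx_cvg.
  - by apply: nearW => i; rewrite divr_gt0// invr_gt0.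
  - exact: harmonic_ray.
  - by apply: cclZ => //; rewrite invr_ge0 ltW.
  - by rewrite heightZ mulVf.
exists U, (fun i => invmx (B i)), r, (invmx (A j) *m k); split => //.
  exact: autVO (aA j) _ Ok.
apply: filterS2 BY r0 => i iY ri; split => //; first exact: (actV GH).
by rewrite -{1}iY mximgK//; exact: aut_unit (aB i).
Qed.

End Overlap.
End Necessary.

(** * Faces of the ideal boundary *)

Section Triangles.
Variables (R : realType) (d : nat) (C : proper_cone R d).
Local Notation V := 'cV[R]_d.
Local Notation O := (cint C).
Local Notation K := (ccl C).
Local Notation h := (height C).
Local Notation hil := (hil C).
Local Notation nb := (nb C).
Implicit Types (u v w x y z : V) (M N s t : R) (Y : set V).

Lemma max_sub u v : K u -> K v -> v != 0 ->
  exists2 s, 0 <= s & K (u - s *: v) /\ forall t, s < t -> ~ K (u - t *: v).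
Proof.
move=> Ku Kv v0; have hv := height_gt0 Kv v0.
pose S := [set s : R | 0 <= s /\ K (u - s *: v)].
have S0 : S 0 by split; rewrite // scale0r subr0.
have Sb : has_ubound S.
  exists (h u / h v) => s [s0 /ccl_height].
  by rewrite heightB heightZ subr_ge0 ler_pdivlMr.
have s0 : 0 <= sup S := ub_le_sup Sb S0.
exists (sup S) => //; split.
  rewrite ((closure_id K).1 (@ccl_closed _ _ C)).
  apply: (@closure_map _ _ (fun s : R => u - s *: v) S) (closure_sup (ex_intro _ _ S0) Sb).
    apply: (@cvgB _ _ _ (nbhs (sup S))); first exact: cvg_cst.
    by apply: (@cvgZr_tmp _ _ _ (nbhs (sup S))); exact: cvg_id.
  by move=> s [].
move=> t st Kt; have St : S t by split=> //; rewrite (le_trans s0)// ltW.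
by have := ub_le_sup Sb St; rewrite leNgt st.
Qed.

(** The segment is prolonged beyond [x] and [y] as far as the cone permits; an endpoint
    comparable to [x] would permit a further prolongation. *)
Lemma maximal_segment x y M : K x -> 0 < h x -> hil M x y ->
  (forall t, 0 < t -> y <> t *: x) ->
  exists a b, [/\ [/\ K a, K b, a != 0 & b != 0],
    exists c1 c2, [/\ 0 < c1, 0 < c2 & x = c1 *: a + c2 *: b],
    exists c1 c2, [/\ 0 < c1, 0 < c2 & y = c1 *: a + c2 *: b],
    exists2 c, 0 < c & K (c *: x - a) /\ K (c *: x - b) &
    forall N, ~ hil N x a /\ ~ hil N x b].
Proof.
move=> Kx hx xy nprop.
have Ky := hil_ccl Kx xy; have M1 := hil_ge1 hx xy; have M0 : 0 < M by lra.
have [c c0 [Kc1 Kc2]] := xy.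
have hy : 0 < h y.
  rewrite -(pmulr_rgt0 _ c0); have := ccl_height Kc1.
  by rewrite heightB heightZ subr_ge0; exact: lt_le_trans.
have [s s0 [Ks ns]] := max_sub Kx Ky (height_neq0 hy).
have [t t0 [Kt nt]] := max_sub Ky Kx (height_neq0 hx).
have {}s0 : 0 < s.
  rewrite ltNge; apply/negP => s_le0; apply: (ns (c / M)).
    by apply: (le_lt_trans s_le0); exact: divr_gt0.
  have -> : x - (c / M) *: y = M^-1 *: (M *: x - c *: y).
    by mxfield; exact: lt0r_neq0.
  by apply: cclZ => //; rewrite invr_ge0 ltW.
have {}t0 : 0 < t.
  rewrite ltNge; apply/negP => t_le0; apply: (nt c^-1).
    by apply: (le_lt_trans t_le0); rewrite invr_gt0.
  have -> : y - c^-1 *: x = c^-1 *: (c *: y - x).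
    by mxfield; exact: lt0r_neq0.
  by apply: cclZ => //; rewrite invr_ge0 ltW.
have a0 : x - s *: y != 0.
  rewrite subr_eq0; apply/eqP => xE; apply: (nprop s^-1); first by rewrite invr_gt0.
  by rewrite xE scalerA mulVf ?gt_eqF// scale1r.
have b0 : y - t *: x != 0.
  by rewrite subr_eq0; apply/eqP => yE; exact: (nprop t).
have ha := height_gt0 Ks a0; have hb := height_gt0 Kt b0.
have st1 : 0 < 1 - s * t.
  rewrite -(pmulr_lgt0 _ hx).
  have -> : (1 - s * t) * h x = h (x - s *: y) + s * h (y - t *: x).
    by rewrite !heightB !heightZ; ring.
  by rewrite addr_gt0// mulr_gt0.
have st_neq0 := lt0r_neq0 st1.
exists (x - s *: y), (y - t *: x); split => //.
- exists (1 - s * t)^-1, (s / (1 - s * t)).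
  by rewrite divr_gt0// invr_gt0; split => //; mxfield.
- exists (t / (1 - s * t)), (1 - s * t)^-1.
  by rewrite divr_gt0// invr_gt0; split => //; mxfield.
- exists (1 + M / c); first by rewrite addr_gt0// divr_gt0.
  have Kyx : K ((M / c) *: x - y).
    have -> : (M / c) *: x - y = c^-1 *: (M *: x - c *: y).
      by mxfield; exact: lt0r_neq0.
    by apply: cclZ => //; rewrite invr_ge0 ltW.
  split.
    have -> : (1 + M / c) *: x - (x - s *: y) = (M / c) *: x + s *: y by mxring.
    by apply: cclD; apply: cclZ => //; apply: ltW => //; exact: divr_gt0.
  have -> : (1 + M / c) *: x - (y - t *: x) = ((M / c) *: x - y) + (1 + t) *: x.
    by mxring.
  by apply: cclD => //; apply: cclZ => //; rewrite addr_ge0// ltW.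
- move=> N; split => -[e e0 [K1 _]].
    have := K1; have -> : e *: (x - s *: y) - x = (e - 1) *: x - (e * s) *: y by mxring.
    have [e1|e1] := leP e 1.
      move=> /ccl_height; rewrite heightB !heightZ subr_ge0 leNgt => /negP; apply.
      apply: (@le_lt_trans _ _ 0); last by rewrite !mulr_gt0.
      by apply: mulr_le0_ge0; [rewrite subr_le0|exact: ltW].
    have e10 : 0 < e - 1 by rewrite subr_gt0.
    have -> : (e - 1) *: x - (e * s) *: y = (e - 1) *: (x - (e * s / (e - 1)) *: y).
      by mxfield; exact: lt0r_neq0.
    rewrite cclZP// => /ns; apply; rewrite ltr_pdivlMr//; nra.
  have := K1; have -> : e *: (y - t *: x) - x = e *: (y - (t + e^-1) *: x).
    by mxfield; exact: lt0r_neq0.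
  by rewrite cclZP//; apply: nt; rewrite ltrDl invr_gt0.
Qed.

(** The coefficients are bounded by the heights, so they converge along the
    ultrafilter. *)
Lemma combo_cvg (I : Type) (U : set_system I) {UU : UltraFilter U}
    (al be ga : I -> R) (a b c u : I -> V) a' b' c' u' :
  (\forall i \near U, [/\ 0 <= al i, 0 <= be i & 0 <= ga i]) ->
  (\forall i \near U, [/\ K (a i), K (b i) & K (c i)]) ->
  a i @[i --> U] --> a' -> b i @[i --> U] --> b' -> c i @[i --> U] --> c' ->
  u i @[i --> U] --> u' -> h a' = 1 -> h b' = 1 -> h c' = 1 ->
  (\forall i \near U, u i = al i *: a i + be i *: b i + ga i *: c i) ->
  exists al' be' ga', [/\ 0 <= al', 0 <= be', 0 <= ga' &
    u' = al' *: a' + be' *: b' + ga' *: c'].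
Proof.
move=> abg Kabc al_ bl cl ul ha hb hc uE.
have hu : \forall i \near U, h (u i) < h u' + 1.
  by apply: cvg_near_lt (cvg_height ul) _; rewrite ltrDl.
have half (v : I -> V) v' : v i @[i --> U] --> v' -> h v' = 1 ->
    \forall i \near U, 1 / 2 < h (v i).
  by move=> vl hv; apply: cvg_near_gt (cvg_height vl) _; rewrite hv; lra.
have bnd : \forall i \near U, [/\ 0 <= al i <= 2 * (h u' + 1),
    0 <= be i <= 2 * (h u' + 1) & 0 <= ga i <= 2 * (h u' + 1)].
  near=> i.
  have [a0 b0 c0] : [/\ 0 <= al i, 0 <= be i & 0 <= ga i] by near: i.
  have [Ka Kb Kc] : [/\ K (a i), K (b i) & K (c i)] by near: i.
  have ha2 : 1 / 2 < h (a i) by near: i; exact: half ha.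
  have hb2 : 1 / 2 < h (b i) by near: i; exact: half hb.
  have hc2 : 1 / 2 < h (c i) by near: i; exact: half hc.
  have : h (u i) < h u' + 1 by near: i.
  have -> : u i = al i *: a i + be i *: b i + ga i *: c i by near: i.
  rewrite !heightD !heightZ a0 b0 c0 /=; split; nra.
have [al' /andP[al'0 _] all] := ultra_itv_cvg (filterS (fun i => fun '(And3 p _ _) => p) bnd).
have [be' /andP[be'0 _] bel] := ultra_itv_cvg (filterS (fun i => fun '(And3 _ p _) => p) bnd).
have [ga' /andP[ga'0 _] gal] := ultra_itv_cvg (filterS (fun i => fun '(And3 _ _ p) => p) bnd).
exists al', be', ga'; split => //.
have L : (al i *: a i + be i *: b i + ga i *: c i) @[i --> U] -->
  al' *: a' + be' *: b' + ga' *: c'.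
  by apply: cvgD; [apply: cvgD|]; exact: cvgZ.
exact: (cvg_unique (@norm_hausdorff _ _) ul (cvg_near_eq uE L)).
Unshelve. all: by end_near. Qed.

End Triangles.

Section TriangleCover.
Variables (R : realType) (d : nat) (C : proper_cone R d) (G : set 'M[R]_d)
  (H : set 'cV[R]_d) (X : set (set 'cV[R]_d)).
Hypotheses (GH : cocompact_action C G H) (XH : invariant_cfamily C G H X).
Local Notation V := 'cV[R]_d.
Local Notation O := (cint C).
Local Notation K := (ccl C).
Local Notation h := (height C).
Local Notation hil := (hil C).
Local Notation nb := (nb C).
Local Notation cset := (cset C).
Local Notation bd := (bd C).
Local Notation ulim := (ulim C).
Implicit Types (u v w x y z : V) (M N s t : R) (Y : set V).

(** The part of the third axiom of peripheral families that concerns triangles with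
    vertices in the boundary; the conditions express that the open triangle lies in [H]
    and its sides do not meet the open cone, i.e. that it is properly embedded. *)
Definition triangle_covered (D : R) := forall a b c : V, K a -> K b -> K c ->
  (forall r s t, 0 < r -> 0 < s -> 0 < t -> H (r *: a + s *: b + t *: c)) ->
  (forall s t, 0 <= s -> 0 <= t ->
    [/\ ~ O (s *: a + t *: b), ~ O (s *: b + t *: c) & ~ O (s *: a + t *: c)]) ->
  exists2 Y, X Y & forall r s t, 0 < r -> 0 < s -> 0 < t ->
    nb D Y (r *: a + s *: b + t *: c).

(** Exponential steps, so that consecutive points are at bounded distance. *)
Definition ray_pt p x n : V := p + (2 ^+ n : R) *: x.

Lemma exp2_gt0 n : 0 < (2 ^+ n : R). Proof. by rewrite exprn_gt0. Qed.

Lemma cvg_expV2 : (2 ^+ n)^-1 @[n --> \oo] --> (0 : R).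
Proof.
have -> : (fun n => (2 ^+ n)^-1) = (fun n => 2^-1 ^+ n : R).
  by apply/funext => n; rewrite exprVn.
by apply: cvg_expr; rewrite gtr0_norm ?invr_gt0//; lra.
Qed.

Lemma ray_pt_cvg (I : Type) (U : set_system I) {UF : Filter U} (N : I -> nat) p x :
  N i @[i --> U] --> \oo -> (2 ^+ N i)^-1 *: ray_pt p x (N i) @[i --> U] --> x.
Proof.
move=> NU; have -> : (fun i => (2 ^+ N i)^-1 *: ray_pt p x (N i)) =
    (fun i => (2 ^+ N i)^-1 *: p + x).
  apply/funext => i; rewrite /ray_pt; mxfield.
  by rewrite lt0r_neq0// exp2_gt0.
rewrite -[X in _ --> X]add0r -(scale0r p); apply: cvgD; last exact: cvg_cst.
by apply: cvgZr_tmp; exact: (cvg_comp _ _ NU cvg_expV2).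
Qed.

Section OneTriangle.
Variables (D : R) (D1 : 1 <= D) (cover : triangle_covered D).
Variables (p x a b : V) (c1 c2 c0 : R).
Hypotheses (Op : O p) (Ka : K a) (Kb : K b) (a0 : a != 0) (b0 : b != 0)
  (c1_gt0 : 0 < c1) (c2_gt0 : 0 < c2) (xE : x = c1 *: a + c2 *: b) (nOx : ~ O x)
  (Hx : 0 < h x) (c0_gt0 : 0 < c0) (Kxa : K (c0 *: x - a)) (Kxb : K (c0 *: x - b))
  (nab : forall N, ~ hil N x a /\ ~ hil N x b)
  (HT : forall r s t, 0 < r -> 0 < s -> 0 < t -> H (r *: a + s *: b + t *: p)).

Let T r s t : V := r *: a + s *: b + t *: p.
Let P n := ray_pt p x n.

Let Kx : K x.
Proof. by rewrite xE; apply: cclD; apply: cclZ => //; exact: ltW. Qed.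

Let PT n : P n = T (2 ^+ n * c1) (2 ^+ n * c2) 1.
Proof. by rewrite /P /T /ray_pt xE; mxring. Qed.

Let HP n : H (P n).
Proof. by rewrite PT; apply: HT => //; rewrite mulr_gt0// exp2_gt0. Qed.

Let nOab s t : 0 <= s -> 0 <= t -> ~ O (s *: a + t *: b).
Proof.
move=> s0 t0 Oab; apply: nOx.
have [m m0 Om] := cint_absorb x Oab.
suff : O ((m * (s + t + 1) * c0) *: x) by apply: (cintZP _ _ _).1; rewrite !mulr_gt0//; lra.
have -> : (m * (s + t + 1) * c0) *: x =
   m *: (s *: a + t *: b) + m *: (s *: (c0 *: x - a) + t *: (c0 *: x - b) + c0 *: x).
  by mxring.
apply: cintD; first exact: cintZ.
apply: cclZ; first exact: ltW.
by apply: cclD; [apply: cclD; exact: cclZ|apply: cclZ => //; exact: ltW].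
Qed.

Let side_far (e : V) (I : Type) (U : set_system I) {UU : UltraFilter U}
    (N : I -> nat) (s t : I -> R) B : K e -> e != 0 -> (forall N', ~ hil N' x e) ->
  N i @[i --> U] --> \oo -> (\forall i \near U, 0 <= s i /\ 0 <= t i) ->
  ~ (\forall i \near U, hil B (P (N i)) (s i *: e + t i *: p)).
Proof.
move=> Ke e0 ne NU st0 HB.
have OP n : O (P n) := csetO (hull_cset GH) (HP n).
have Kw : \forall i \near U, K (s i *: e + t i *: p) /\ s i *: e + t i *: p != 0.
  apply: filterS HB => i HBi; have Oi := hil_cint (OP _) HBi.
  by split; [exact: cint_ccl|exact: cint_nz Oi].
have [r [w [r0 Kw' hw wl]]] := ultra_scale Kw.
have he := height_gt0 Ke e0; have hp := cint_height Op.
have xw : hil B x w.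
  apply: (@hil_cvg _ _ _ _ U _ _ (fun i => (2 ^+ N i)^-1 *: P (N i))
     (fun i => r i *: (s i *: e + t i *: p))) => //.
  - apply: filterS2 r0 HB => i ri HBi; rewrite hilZr// hilZl// invr_gt0.
  - exact: ray_pt_cvg.
  - by rewrite hw.
have [al [be [ga [al0 be0 ga0 wE]]]] : exists al be ga, [/\ 0 <= al, 0 <= be, 0 <= ga &
    w = al *: ((h e)^-1 *: e) + be *: ((h p)^-1 *: p) + ga *: ((h p)^-1 *: p)].
  apply: (@combo_cvg _ _ C _ U _ (fun i => r i * s i * h e) (fun i => r i * t i * h p)
    (fun=> 0) (fun=> (h e)^-1 *: e) (fun=> (h p)^-1 *: p) (fun=> (h p)^-1 *: p) _ _ _ _ w
    _ _ _ _ _ wl).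
  - apply: filterS2 r0 st0 => i ri [si ti]; split => //.
      by rewrite !mulr_ge0// ltW.
    by rewrite !mulr_ge0// ltW.
  - apply: nearW => i; split; apply: cclZ => //; rewrite ?invr_ge0 ?ltW//;
      exact: cint_ccl.
  - exact: cvg_cst.
  - exact: cvg_cst.
  - exact: cvg_cst.
  - by rewrite heightZ mulVf// gt_eqF.
  - by rewrite heightZ mulVf// gt_eqF.
  - by rewrite heightZ mulVf// gt_eqF.
  - apply: nearW => i; mxfield; rewrite !lt0r_neq0//.
have [ga_be|ga_be] := ltP 0 (be + ga).
  have B0 := hil_gt0 Hx _ xw.
  apply: nOx; apply: (hil_cint (u := w) (M := B)); last first.
    by apply: hil_sym xw; apply: B0; rewrite hw.
  rewrite wE -addrA -scalerDl; apply: cclDO.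
    by do 2 (apply: cclZ => //); rewrite invr_ge0 ltW.
  by do 2 (apply: cintZ => //); rewrite invr_gt0.
have [be00 ga00] : be = 0 /\ ga = 0 by split; lra.
have al_gt0 : 0 < al.
  rewrite lt_def al0 andbT; apply/eqP => al00; move: hw.
  by rewrite wE al00 be00 ga00 !scale0r !addr0 height0 => /eqP; rewrite eq_sym oner_eq0.
apply: (ne B); move: xw; rewrite wE be00 ga00 !scale0r !addr0.
by rewrite !hilZr// invr_gt0.
Qed.

(** The triangle with vertices [a], [b] and [p] looks properly embedded from the points
    [P n], since its sides through [p] move away from them: translating [P n] into a
    bounded region, the limit triangle is properly embedded, hence covered by a member.
    Along a sequence of failures the translates of that member give a
    contradiction. *)
Lemma triangle_near M : exists n0, forall n, (n0 <= n)%N -> exists2 Y, X Y &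
  forall r s t, 0 < r -> 0 < s -> 0 < t -> hil M (P n) (T r s t) ->
    nb (2 * D) Y (T r s t).
Proof.
apply: contrapT => nn0.
(* a sequence of indices [N k] going to infinity such that every member is far from
   some point of the ball around [P (N k)] in the triangle *)
have : forall k : nat, exists n : nat, (k <= n)%N /\ forall Y, X Y -> exists q : R * R * R,
   [/\ 0 < q.1.1, 0 < q.1.2, 0 < q.2, hil M (P n) (T q.1.1 q.1.2 q.2) &
     ~ nb (2 * D) Y (T q.1.1 q.1.2 q.2)].
  move=> k; apply: contrapT => nk; apply: nn0; exists k => n kn.
  apply: contrapT => nY; apply: nk; exists n; split => // Y XY.
  apply: contrapT => nq; apply: nY; exists Y => // r s t r0 s0 t0 Hz.
  by apply: contrapT => nz; apply: nq; exists (r, s, t).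
move=> /choice[N NP].
have [U UU Uoo] := free_ultrafilter.
have NU : N i @[i --> U] --> \oo.
  move=> W [m _ mW]; have : \forall i \near U, (m <= i)%N.
    by apply: Uoo; exact: nbhs_infty_ge.
  by apply: filterS => i mi; apply: mW => /=; exact: leq_trans mi (NP i).1.
(* [a'], [b'], [c'] are the limits of the translated vertices, normalized *)
have [A [p' [GA Hp' pl]]] := hull_cocompact GH UU (nearW _ (fun i => HP (N i))).
have aA i : cone_aut C (A i) by exact: act_aut GH _ (GA i).
have Op' := csetO (hull_cset GH) Hp'.
have scaled (e : V) : K e -> e != 0 -> \forall i \near U, K (A i *m e) /\ A i *m e != 0.
  move=> Ke e0; apply: nearW => i; split; first exact: autK (aA i) _ Ke.
  apply: contra e0 => /eqP/(congr1 (mulmx (invmx (A i)))).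
  by rewrite mulKmx ?mulmx0 ?(aut_unit (aA i))// => ->.
have [ta [a' [ta0 Ka' ha' al]]] := ultra_scale (scaled _ Ka a0).
have [tb [b' [tb0 Kb' hb' bl]]] := ultra_scale (scaled _ Kb b0).
have [tp [c' [tp0 Kc' hc' cl]]] := ultra_scale (scaled _ (cint_ccl Op) (cint_nz Op)).
have lim r s t : (r * ta i *: (A i *m a)) + (s * tb i *: (A i *m b)) + (t * tp i *: (A i *m p))
    @[i --> U] --> r *: a' + s *: b' + t *: c'.
  under eq_fun do rewrite -!scalerA.
  by apply: cvgD; [apply: cvgD|]; exact: cvgZl_tmp.
have limO r s t : O (r *: a' + s *: b' + t *: c') ->
    \forall i \near U, O ((r * ta i) *: a + (s * tb i) *: b + (t * tp i) *: p).
  move=> Ol; have Ul : \forall i \near U, O (r * ta i *: (A i *m a) +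
      s * tb i *: (A i *m b) + t * tp i *: (A i *m p)).
    exact: (cvg_in (lim r s t) (near_cint Ol)).
  apply: filterS Ul => i; rewrite !scalemxAr -!mulmxDr.
  by move=> /(autVO (aA i)); rewrite mulKmx//; exact: aut_unit (aA i).
have limhil r s t : O (r *: a' + s *: b' + t *: c') -> exists B, \forall i \near U,
    hil B (P (N i)) ((r * ta i) *: a + (s * tb i) *: b + (t * tp i) *: p).
  move=> Ol; have [B B0 HB] := near_hil_bound Op' Ol pl (lim r s t).
  exists B; apply: filterS HB => i; rewrite !scalemxAr -!mulmxDr.
  by move=> /(aut_hilP _ _ _ (aA i)).
(* if a side of the limit triangle through [c'] met the open cone, points of the
   corresponding side through [p] would be at bounded distance from the points [P (N i)];
   if the third side did, so would the side from [a] to [b] *)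
have sides s t : 0 <= s -> 0 <= t -> [/\ ~ O (s *: a' + t *: b'),
    ~ O (s *: b' + t *: c') & ~ O (s *: a' + t *: c')].
  move=> s0 t0; split => Ol.
  - have /limO Ul : O (s *: a' + t *: b' + 0 *: c') by rewrite scale0r addr0.
    have [i [[Oi tai] tbi]] := near_ex (filterI (filterI Ul ta0) tb0).
    move: Oi; rewrite mul0r scale0r addr0; apply: nOab; rewrite mulr_ge0//; exact: ltW.
  - have /limhil[B] : O (0 *: a' + s *: b' + t *: c') by rewrite scale0r add0r.
    under eq_near do rewrite mul0r scale0r add0r.
    apply: (side_far Kb b0 (fun N' => (nab N').2) NU).
    by apply: filterS2 tb0 tp0 => i /ltW tbi /ltW tpi; rewrite !mulr_ge0.
  - have /limhil[B] : O (s *: a' + 0 *: b' + t *: c') by rewrite scale0r addr0.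
    under eq_near do rewrite mul0r scale0r addr0.
    apply: (side_far Ka a0 (fun N' => (nab N').1) NU).
    by apply: filterS2 ta0 tp0 => i /ltW tbi /ltW tpi; rewrite !mulr_ge0.
have pos r s t : 0 <= r -> 0 <= s -> 0 <= t -> O (r *: a' + s *: b' + t *: c') ->
    [/\ 0 < r, 0 < s & 0 < t].
  move=> r0 s0 t0 Ol; rewrite !lt_def r0 s0 t0 !andbT; split; apply/eqP => E.
  - by move: Ol; rewrite E scale0r add0r; have [] := sides s t s0 t0.
  - by move: Ol; rewrite E scale0r addr0; have [] := sides r t r0 t0.
  - by move: Ol; rewrite E scale0r addr0; have [] := sides r s r0 s0.
(* a limit in the open cone of points of the translated triangles is in the open limit
   triangle *)
have combo (u : nat -> V) (r s t : nat -> R) u' :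
    (\forall i \near U, [/\ 0 <= r i, 0 <= s i & 0 <= t i]) ->
    (\forall i \near U, u i = r i *: (A i *m a) + s i *: (A i *m b) + t i *: (A i *m p)) ->
    u i @[i --> U] --> u' -> O u' ->
    exists r' s' t', [/\ 0 < r', 0 < s', 0 < t' & u' = r' *: a' + s' *: b' + t' *: c'].
  move=> rst0 uE ul Ou'.
  have [r' [s' [t' [r'0 s'0 t'0 u'E]]]] : exists r' s' t', [/\ 0 <= r', 0 <= s', 0 <= t' &
      u' = r' *: a' + s' *: b' + t' *: c'].
    apply: (@combo_cvg _ _ C _ U _ (fun i => r i / ta i) (fun i => s i / tb i)
      (fun i => t i / tp i) _ _ _ _ _ _ _ _ _ _ al bl cl ul) => //.
    - near=> i.
      have [ri si ti] : [/\ 0 <= r i, 0 <= s i & 0 <= t i] by near: i.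
      by split; apply: divr_ge0 => //; apply: ltW; near: i.
    - near=> i; split; apply: cclZ.
      + by apply: ltW; near: i.
      + exact: autK (aA i) _ Ka.
      + by apply: ltW; near: i.
      + exact: autK (aA i) _ Kb.
      + by apply: ltW; near: i.
      + exact: autK (aA i) _ (cint_ccl Op).
    - near=> i.
      have -> : u i = r i *: (A i *m a) + s i *: (A i *m b) + t i *: (A i *m p) by near: i.
      have tai : 0 < ta i by near: i.
      have tbi : 0 < tb i by near: i.
      have tpi : 0 < tp i by near: i.
      by rewrite !scalerA !divfK// gt_eqF.
  exists r', s', t'; have [|] := pos r' s' t' r'0 s'0 t'0; first by rewrite -u'E.
  by split.
have [e1 [e2 [e3 [e1_gt0 e2_gt0 e3_gt0 p'E]]]] : exists r' s' t',
    [/\ 0 < r', 0 < s', 0 < t' & p' = r' *: a' + s' *: b' + t' *: c'].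
  apply: (combo _ (fun i => 2 ^+ N i * c1) (fun i => 2 ^+ N i * c2) (fun=> 1)) pl Op'.
    by apply: nearW => i; split => //; rewrite mulr_ge0// ltW// exp2_gt0.
  by apply: nearW => i; rewrite PT /T !mulmxDr -!scalemxAr.
have HT' r s t : 0 < r -> 0 < s -> 0 < t -> H (r *: a' + s *: b' + t *: c').
  move=> r0 s0 t0; apply: (cset_closed (hull_cset GH)); split.
    apply: (cvg_closure _ (lim r s t)); near=> i.
    rewrite !scalemxAr -!mulmxDr; apply: (hull_inv GH) => //; apply: HT;
      by rewrite mulr_gt0//; near: i.
  (* compare with the interior point [p'] of the limit triangle *)
  pose e := Num.min (r / e1) (Num.min (s / e2) (t / e3)).
  have e_gt0 : 0 < e by rewrite !lt_min !divr_gt0.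
  have er : e * e1 <= r by rewrite -ler_pdivlMr// ge_min lexx.
  have es : e * e2 <= s by rewrite -ler_pdivlMr// !ge_min lexx orbT.
  have et : e * e3 <= t by rewrite -ler_pdivlMr// !ge_min lexx !orbT.
  have -> : r *: a' + s *: b' + t *: c' = e *: p' + ((r - e * e1) *: a' +
     (s - e * e2) *: b' + (t - e * e3) *: c') by rewrite p'E; mxring.
  apply: cintD; first exact: cintZ.
  by apply: cclD; [apply: cclD|]; apply: cclZ => //; rewrite subr_ge0.
(* the member that covers the limit triangle, translated back, is far from a point
   [z i] of the ball; the translates of these points converge in the limit triangle *)
have [Y XY nY] := cover Ka' Kb' Kc' HT' sides.
have cY := fam_cset XH XY.
have XV i : X (mximg (invmx (A i)) Y).
  by apply: (fam_inv XH) => //; exact: (actV GH).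
have /choice[q qP] : forall i, exists q : R * R * R,
   [/\ 0 < q.1.1, 0 < q.1.2, 0 < q.2, hil M (P (N i)) (T q.1.1 q.1.2 q.2) &
     ~ nb (2 * D) (mximg (invmx (A i)) Y) (T q.1.1 q.1.2 q.2)].
  by move=> i; apply: (NP i).2.
pose z i := T (q i).1.1 (q i).1.2 (q i).2.
have Oz i : O (z i).
  by have [_ _ _ Hz _] := qP i; apply: hil_cint Hz; exact: csetO (hull_cset GH) _ (HP _).
have Kz : \forall i \near U, K (A i *m z i) /\ A i *m z i != 0.
  apply: nearW => i; have Oi := autO (aA i) (Oz i).
  by split; [exact: cint_ccl|exact: cint_nz Oi].
have [tz [z' [tz0 Kz' hz' zl]]] := ultra_scale Kz.
have Oz' : O z'.
  apply: (hil_cint Op' (M := M)).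
  apply: (@hil_cvg _ _ _ _ U _ _ (fun i => A i *m P (N i)) (fun i => tz i *: (A i *m z i))) => //.
  - apply: filterS tz0 => i ti; rewrite hilZr//; apply: aut_hil => //.
    by have [] := qP i.
  - exact: cint_height.
  - by rewrite hz'.
have [r [s [t [r0 s0 t0 z'E]]]] : exists r' s' t',
    [/\ 0 < r', 0 < s', 0 < t' & z' = r' *: a' + s' *: b' + t' *: c'].
  apply: (combo _ (fun i => tz i * (q i).1.1) (fun i => tz i * (q i).1.2)
    (fun i => tz i * (q i).2)) zl Oz'.
    apply: filterS tz0 => i ti; have [q1 q2 q3 _ _] := qP i.
    by split; rewrite mulr_ge0//; exact: ltW.
  by apply: nearW => i; rewrite /z /T !mulmxDr -!scalemxAr !scalerDr !scalerA.
have n2 : \forall i \near U, hil 2 z' (tz i *: (A i *m z i)).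
  by apply: (cvg_in zl); apply: near_hil => //; lra.
have [i [zi ti]] := near_ex (filterI n2 tz0).
have [_ _ _ _] := qP i; apply.
have nz' : nb D Y z' by rewrite z'E; exact: nY.
have : nb (2 * D) Y (tz i *: (A i *m z i)).
  apply: (nb_hil cY _ nz'); last exact: hil_sym.
  exact: lt_le_trans D1.
move=> /(nbZ cY (t := (tz i)^-1)); rewrite scalerA mulVf ?gt_eqF// scale1r invr_gt0.
move=> /(_ ti) /(nb_mximg (cone_autV (aA i))).
by rewrite mulKmx//; exact: aut_unit (aA i).
Unshelve. all: by end_near. Qed.

Section Member.
Hypothesis Xov : bounded_overlap C X.

Let D0 : 0 < 2 * D. Proof. by rewrite mulr_gt0// (lt_le_trans _ D1). Qed.

Let OP n : O (P n). Proof. exact: csetO (hull_cset GH) _ (HP n). Qed.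

Let ray_far B n : exists m, ~ hil B (P n) (P m).
Proof.
apply: contrapT => nm; apply: nOx; apply: (hil_cint (OP n) (M := B)).
have [U UU Uoo] := free_ultrafilter.
apply: (@hil_cvg _ _ C _ U _ _ (fun=> P n) (fun i => (2 ^+ i)^-1 *: P i)) => //.
- apply: nearW => m; rewrite hilZr ?invr_gt0 ?exp2_gt0//.
  by apply: contrapT => nH; apply: nm; exists m.
- exact: cvg_cst.
- by apply: ray_pt_cvg => W Wm; exact: Uoo.
- exact: cint_height.
Qed.

Let ray_step n : hil 2 (P n.+1) (P n).
Proof.
apply: hil_sym => //; exists 1 => //; rewrite scale1r /P /ray_pt exprS; split.
  have -> : p + (2 * 2 ^+ n) *: x - (p + 2 ^+ n *: x) = 2 ^+ n *: x by mxring.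
  by apply: cclZ => //; rewrite ltW// exp2_gt0.
have -> : 2 *: (p + 2 ^+ n *: x) - (p + (2 * 2 ^+ n) *: x) = p by mxring.
exact: cint_ccl.
Qed.

Let far_witness B n : 1 <= B -> exists r s t,
  [/\ 0 < r, 0 < s, 0 < t, hil (2 * B) (P n) (T r s t) & ~ hil B (P n) (T r s t)].
Proof.
move=> B1; have B0 : 0 < 2 * B by lra.
have [m nm] := ray_far (2 * B) n.
have ny : nb (2 * B) (raycone (P n)) (P n).
  by apply/nb_raycone; apply: hil_refl; [lra|exact: cint_ccl].
have nz : ~ nb (2 * B) (raycone (P n)) (P m) by move=> /nb_raycone /(hil_sym B0).
have [s s0 [ns nNs]] := nb_crossing (cset_raycone (OP n)) B0 ny (OP m) nz.
have E : P n + s *: P m = T (2 ^+ n * c1 + s * (2 ^+ m * c1))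
    (2 ^+ n * c2 + s * (2 ^+ m * c2)) (1 + s) by rewrite !PT /T; mxring.
exists (2 ^+ n * c1 + s * (2 ^+ m * c1)), (2 ^+ n * c2 + s * (2 ^+ m * c2)), (1 + s).
have en := exp2_gt0 n; have em := exp2_gt0 m.
rewrite -E; split.
- by rewrite ltr_pwDl ?mulr_gt0// !mulr_ge0// ltW.
- by rewrite ltr_pwDl ?mulr_gt0// !mulr_ge0// ltW.
- by rewrite ltr_pwDl.
- by apply: hil_sym => //; exact/nb_raycone.
- move=> Hb; apply: (nNs B); [lra|lra|].
  by apply/nb_raycone; apply: hil_sym => //; lra.
Qed.

(** Two consecutive members given by [triangle_near] both cover a large ball of the
    triangle, so they are equal because overlaps are bounded. *)
Lemma triangle_member : exists2 Y, X Y & forall M, exists n0, forall n, (n0 <= n)%N ->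
  forall r s t, 0 < r -> 0 < s -> 0 < t -> hil M (P n) (T r s t) ->
    nb (2 * D) Y (T r s t).
Proof.
have [E HE] := Xov D0.
pose E1 := Num.max E 1.
have E11 : 1 <= E1 by rewrite le_max lexx orbT.
have EE1 : E <= E1 by rewrite le_max lexx.
pose valid n Y := forall r s t, 0 < r -> 0 < s -> 0 < t ->
  hil (2 * (2 * E1)) (P n) (T r s t) -> nb (2 * D) Y (T r s t).
have Pself n Y : valid n Y -> nb (2 * D) Y (P n).
  have en := exp2_gt0 n.
  move=> vn; rewrite PT; apply: vn; rewrite ?mulr_gt0// -PT.
  by apply: hil_refl; [lra|exact: cint_ccl].
have valid_eq n Y1 Y2 : X Y1 -> X Y2 -> valid n Y1 ->
    (valid n Y2 \/ valid n.+1 Y2) -> Y1 = Y2.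
  move=> X1 X2 v1 v2; apply: contrapT => Y12.
  have [r [s [t [r0 s0 t0 cl far]]]] := far_witness n E11.
  have en := exp2_gt0 n.
  have n2 : nb (2 * D) Y2 (P n) /\ nb (2 * D) Y2 (T r s t).
    case: v2 => v2; split.
    - exact: Pself v2.
    - by apply: v2 => //; apply: hil_le cl; [lra|exact: cint_ccl].
    - rewrite PT; apply: v2; rewrite ?mulr_gt0// -PT.
      by apply: hil_le (ray_step n); [lra|exact: cint_ccl].
    - by apply: v2 => //; apply: hil_trans cl => //; lra.
  have n1 : nb (2 * D) Y1 (P n) /\ nb (2 * D) Y1 (T r s t).
    split; first exact: Pself v1.
    by apply: v1 => //; apply: hil_le cl; [lra|exact: cint_ccl].
  apply: far; apply: hil_le EE1 _ _; first exact: cint_ccl.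
  by apply: (HE _ _ X1 X2 Y12); case: n1; case: n2.
have [n0 Hn0] := triangle_near (2 * (2 * E1)).
have [Y0 XY0 v0] := Hn0 n0 (leqnn n0).
have validY n : (n0 <= n)%N -> valid n Y0.
  move=> /subnK <-; elim: (n - n0)%N => [|k IH]; first by rewrite add0n.
  have [Y1 XY1 v1] := Hn0 (k.+1 + n0)%N (leq_addl _ _).
  by rewrite (valid_eq (k + n0)%N Y0 Y1) //; right; rewrite -addSn.
exists Y0 => // M.
have [n1 Hn1] := triangle_near (Num.max M (2 * (2 * E1))).
exists (maxn n0 n1) => n; rewrite geq_max => /andP[n0n n1n] r s t r0 s0 t0 HM.
have [Y1 XY1 v1] := Hn1 n n1n.
have -> : Y0 = Y1.
  apply: (valid_eq n) => //; first exact: validY.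
  left => r' s' t' r'0 s'0 t'0 Hrst; apply: v1 => //.
  by apply: hil_le Hrst; [rewrite le_max lexx orbT|exact: cint_ccl].
by apply: v1 => //; apply: hil_le HM; [rewrite le_max lexx|exact: cint_ccl].
Qed.

(** The rays of the triangle towards the points of its side through [a] and [b] stay at
    bounded distance from the rays [P n], where a single member covers them; its
    closure contains limits of nearby points. *)
Lemma triangle_trace : exists Y, [/\ X Y,
  exists n0, forall n, (n0 <= n)%N -> nb (2 * D) Y (P n) &
  forall d1 d2, 0 < d1 -> 0 < d2 -> exists z,
    [/\ closure Y z, K (z - (d1 *: a + d2 *: b)) & K ((2 * D) *: (d1 *: a + d2 *: b) - z)]].
Proof.
have [Y XY HY] := triangle_member; exists Y; split => //.
  have [n0 Hn0] := HY 1; exists n0 => n n0n; rewrite PT; have en := exp2_gt0 n.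
  apply: (Hn0 n) => //; rewrite ?mulr_gt0// -PT.
  by apply: hil_refl => //; exact: cint_ccl.
move=> d1 d2 d1_gt0 d2_gt0; pose y := d1 *: a + d2 *: b.
(* a constant that dominates the four ratios of coefficients *)
pose k := 1 + c1 / d1 + c2 / d2 + d1 / c1 + d2 / c2.
have [k1 k2 k3 k4] : [/\ 0 < c1 / d1, 0 < c2 / d2, 0 < d1 / c1 & 0 < d2 / c2].
  by split; exact: divr_gt0.
have k0 : 1 <= k by rewrite /k; lra.
have kd1 : c1 <= k * d1 by rewrite -ler_pdivrMr// /k; lra.
have kd2 : c2 <= k * d2 by rewrite -ler_pdivrMr// /k; lra.
have kc1 : d1 <= k * c1 by rewrite -ler_pdivrMr// /k; lra.
have kc2 : d2 <= k * c2 by rewrite -ler_pdivrMr// /k; lra.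
have Hq n : hil (k * k) (P n) (T (2 ^+ n * d1) (2 ^+ n * d2) 1).
  have en := exp2_gt0 n; have Kp := cint_ccl Op.
  exists k; first lra.
  rewrite PT /T; split.
    have -> : k *: ((2 ^+ n * d1) *: a + (2 ^+ n * d2) *: b + 1 *: p) -
      ((2 ^+ n * c1) *: a + (2 ^+ n * c2) *: b + 1 *: p) =
      (2 ^+ n * (k * d1 - c1)) *: a + (2 ^+ n * (k * d2 - c2)) *: b + (k - 1) *: p by mxring.
    by apply: cclD; [apply: cclD|]; apply: cclZ => //; rewrite ?mulr_ge0 ?subr_ge0// ltW.
  have -> : (k * k) *: ((2 ^+ n * c1) *: a + (2 ^+ n * c2) *: b + 1 *: p) -
      k *: ((2 ^+ n * d1) *: a + (2 ^+ n * d2) *: b + 1 *: p) =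
      k *: ((2 ^+ n * (k * c1 - d1)) *: a + (2 ^+ n * (k * c2 - d2)) *: b + (k - 1) *: p) by mxring.
  apply: cclZ; first lra.
  by apply: cclD; [apply: cclD|]; apply: cclZ => //; rewrite ?mulr_ge0 ?subr_ge0// ltW.
have [n0 Hn0] := HY (k * k).
have [U UU Uoo] := free_ultrafilter.
have cY := fam_cset XH XY.
have qE n : T (2 ^+ n * d1) (2 ^+ n * d2) 1 = ray_pt p y n by rewrite /T /ray_pt /y; mxring.
have nq : \forall n \near U, nb (2 * D) Y ((2 ^+ n)^-1 *: ray_pt p y n).
  have Un : \forall n \near U, (n0 <= n)%N by apply: Uoo; exact: nbhs_infty_ge.
  apply: filterS Un => n n0n; apply: (nbZ cY); first by rewrite invr_gt0 exp2_gt0.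
  by rewrite -qE; apply: (Hn0 n) => //; rewrite mulr_gt0// exp2_gt0.
have ql : (2 ^+ n)^-1 *: ray_pt p y n @[n --> U] --> y.
  by apply: ray_pt_cvg => W Wm; exact: Uoo.
have [z [lz [Yz zl [K1 K2]]]] := nb_cvg (fun=> cY) D0 ql nq.
by exists lz; split => //; exact: cvg_closure Yz zl.
Qed.

End Member.
End OneTriangle.

(** Half of the point [z] near [y] can be subtracted from [y]: the remainder is still
    comparable to [x], and its height has dropped by a fixed factor. Iterating expresses
    [y] as a convergent sum of elements of the closure. *)
Lemma face_sub_closure Y x D : cset Y -> K x -> 0 < h x -> 1 <= D ->
  (forall y N, hil N x y -> exists z, [/\ closure Y z, K (z - y) & K (D *: y - z)]) ->
  forall y N, hil N x y -> closure Y y.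
Proof.
move=> cY Kx hx D1 near y N xy.
have D0 : 0 < 2 * D by lra.
have D_neq0 := lt0r_neq0 D0; have D_neq0' : D != 0 by rewrite lt0r_neq0//; lra.
have hilK v B : hil B x v -> K v by exact: hil_ccl.
pose e := (2 * D)^-1.
have e0 : 0 < e by rewrite invr_gt0.
have e1 : e <= 1 by rewrite invf_le1//; lra.
have step v B : hil B x v -> exists a r, [/\ closure Y a, v = a + r, hil (B * 2) x r &
    h r <= (1 - e) * h v].
  move=> xv; have Kv := hilK _ _ xv.
  have [z [clz K1 K2]] := near v B xv.
  exists (e *: z), (v - e *: z); split.
  - exact: (cset_closureZ cY e0 clz).
  - by rewrite addrC subrK.
  - apply: (hil_trans _ xv) => //; exists 2 => //; split.
      have -> : 2 *: (v - e *: z) - v = D^-1 *: (D *: v - z).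
        by rewrite /e; mxfield.
      by apply: cclZ => //; rewrite invr_ge0; lra.
    have -> : 2 *: v - 2 *: (v - e *: z) = (2 * e) *: z by mxring.
    apply: cclZ; first by rewrite mulr_ge0// ltW.
    by rewrite -(subrK v z); exact: cclD.
  - have := ccl_height K1; rewrite !heightB heightZ subr_ge0 mulrBl mul1r => H1.
    by rewrite lerB// ler_pM2l.
have e10 : 0 <= 1 - e by rewrite subr_ge0.
have iter n : exists a r B, [/\ closure Y a, y = a + r, hil B x r &
    h r <= (1 - e) ^+ n.+1 * h y].
  elim: n => [|n [a [r [B [cla yE xr hr]]]]].
    by have [a [r [cla yE xr hr]]] := step _ _ xy; exists a, r, (N * 2).
  have [a' [r' [cla' rE xr' hr']]] := step _ _ xr.
  exists (a + a'), r', (B * 2); split => //.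
  - exact: (cset_closureD cY).
  - by rewrite yE {1}rE addrA.
  - by apply: (le_trans hr'); rewrite exprS -mulrA ler_wpM2l.
have /choice[q qP] : forall n, exists q : V * V, [/\ closure Y q.1, y = q.1 + q.2,
    K q.2 & h q.2 <= (1 - e) ^+ n.+1 * h y].
  move=> n; have [a [r [B [cla yE xr hr]]]] := iter n.
  by exists (a, r); split => //; exact: hilK xr.
have [U UU Uoo] := free_ultrafilter.
have hy : 0 <= h y by apply: (ccl_height (C := C)); exact: hilK xy.
have [l Kl ql] : exists2 l, K l & (q i).2 @[i --> U] --> l.
  apply: (@ultra_bounded_cvg _ _ _ _ _ _ _ (h y)); apply: nearW => i.
  have [_ _ Kq hq] := qP i; split => //; apply: (le_trans hq).
  rewrite ler_piMl// exprn_ile1//; lra.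
have l0 : l = 0.
  apply: (@ccl_height0 _ _ C) => //.
  have B0 : ((1 - e) ^+ i.+1 * h y) @[i --> U] --> 0.
    rewrite -[X in _ --> X](mul0r (h y)).
    apply: cvgM; last exact: cvg_cst.
    apply: cvg_sub Uoo _.
    have -> : (fun i => (1 - e) ^+ i.+1) = (fun i => (1 - e) ^+ i * (1 - e)).
      by apply/funext => i; rewrite exprSr.
    rewrite -[X in _ --> X](mul0r (1 - e)).
    apply: cvgM; last exact: cvg_cst.
    by apply: cvg_expr; rewrite ger0_norm//; lra.
  have hl' : h (q i).2 @[i --> U] --> h l by exact: cvg_height.
  rewrite leNgt; apply/negP => hl0.
  have n1 : \forall i \near U, h l / 2 < h (q i).2 by apply: (cvg_near_gt hl'); lra.
  have n2 : \forall i \near U, (1 - e) ^+ i.+1 * h y < h l / 2.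
    by apply: (cvg_near_lt B0); lra.
  have [i [n1i n2i]] := near_ex (filterI n1 n2).
  by have [_ _ _ hq] := qP i; move: (lt_trans (le_lt_trans hq n2i) n1i); rewrite ltxx.
have al : (q i).1 @[i --> U] --> y.
  have -> : (fun i => (q i).1) = (fun i => y - (q i).2).
    by apply/funext => i; have [_ -> _ _] := qP i; rewrite addrK.
  by rewrite -[X in _ --> X]subr0 -l0; apply: cvgB => //; exact: cvg_cst.
rewrite ((closure_id (closure Y)).1 (@closed_closure _ _)).
by apply: cvg_closure al; apply: nearW => i; have [] := qP i.
Qed.

(** A maximal segment through [x] in its face and a point [p] of the core bound a
    triangle, which determines a member that traces the segment. That member stays close
    to the ray from [p] to [x], so it is the same for all segments through [x]: it comes
    within bounded distance of every point of the face, and [face_sub_closure]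
    applies. *)
Lemma face_in_member D x y0 M : 1 <= D -> triangle_covered D -> bounded_overlap C X ->
  bd H x -> hil M x y0 -> (forall t, 0 < t -> y0 <> t *: x) ->
  exists2 Y, X Y & forall y N, hil N x y -> closure Y y.
Proof.
move=> D1 cover Xov bx xy0 nprop0; have cH := hull_cset GH.
have hx := bd_height (csetO cH) bx; have [clx nx x0] := bx.
have Kx := closure_ccl (csetO cH) clx.
have [p [Hp _]] : (H `&` setT) !=set0 by apply: clx; exact: filterT.
have Op := csetO cH Hp.
have D0 : 0 < 2 * D by lra.
have face y N : hil N x y -> closure H y by move=> /(hull_face GH bx)[].
have trace y N : hil N x y -> (forall t, 0 < t -> y <> t *: x) -> exists Y, [/\ X Y,
    exists n0, forall n, (n0 <= n)%N -> nb (2 * D) Y (ray_pt p x n),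
    exists z, [/\ closure Y z, K (z - y) & K ((2 * D) *: y - z)] &
    exists z, [/\ closure Y z, K (z - x) & K ((2 * D) *: x - z)]].
  move=> xy nprop.
  have [a [b [[Ka Kb a0 b0] [c1 [c2 [c10 c20 xE]]] [d1 [d2 [d10 d20 yE]]]
    [c c0 [Kxa Kxb]] nab]]] := maximal_segment Kx hx xy nprop.
  (* an endpoint of the maximal segment is only a limit of points comparable to [x] *)
  have in_face e : K e -> K (c *: x - e) -> closure H e.
    move=> Ke Kce; rewrite ((closure_id (closure H)).1 (@closed_closure _ _)).
    have -> : e = e + (0 : R) *: x by rewrite scale0r addr0.
    apply: (@cvg_closure _ (0 : R)^'+ _ _ (fun s : R => e + s *: x)).
      near=> s; have s0 : 0 < s by near: s; exact: nbhs_right_gt.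
      apply: (face _ ((c + s) * s^-1)); apply: hil_sym; first by rewrite mulr_gt0 ?addr_gt0 ?invr_gt0.
      exists (c + s); first exact: addr_gt0.
      split.
        have -> : (c + s) *: x - (e + s *: x) = c *: x - e by mxring.
        exact: Kce.
      have -> : ((c + s) / s) *: (e + s *: x) - (c + s) *: x = ((c + s) / s) *: e.
        by mxfield; exact: lt0r_neq0.
      by apply: cclZ => //; rewrite divr_ge0// ltW// addr_gt0.
    apply: cvg_at_right_filter; apply: (@cvgD _ _ _ (nbhs (0 : R))); first exact: cvg_cst.
    by apply: (@cvgZr_tmp _ _ _ (nbhs (0 : R))); exact: cvg_id.
  have cla := in_face a Ka Kxa; have clb := in_face b Kb Kxb.
  have HT r s t : 0 < r -> 0 < s -> 0 < t -> H (r *: a + s *: b + t *: p).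
    move=> r0 s0 t0.
    have -> : r *: a + s *: b + t *: p = t *: p + r *: a + s *: b by mxring.
    do 2 (apply: (cset_add_closure cH) => //; last exact: ltW).
    exact: (csetZ cH).
  have [Y [XY n0 tr]] := triangle_trace D1 cover Op Ka Kb a0 b0 c10 c20 xE nx hx c0
    Kxa Kxb nab HT Xov.
  exists Y; split => //.
    by rewrite yE; exact: tr.
  by rewrite {1 2}xE; exact: tr.
have [Y [XY [n0 Yn0] _ trx]] := trace _ _ xy0 nprop0.
exists Y => //; apply: (@face_sub_closure _ _ (2 * D)) => //.
- exact: fam_cset XH _ XY.
- lra.
move=> y N xy.
have [[t t0 yE]|nprop] := pselect (exists2 t, 0 < t & y = t *: x).
  have [z [clz K1 K2]] := trx; exists (t *: z); rewrite yE; split.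
  - exact: (cset_closureZ (fam_cset XH XY)).
  - by rewrite -scalerBr; apply: cclZ => //; exact: ltW.
  - have -> : (2 * D) *: (t *: x) - t *: z = t *: ((2 * D) *: x - z) by mxring.
    by apply: cclZ => //; exact: ltW.
have [|Y' [XY' [n1 Yn1] try _]] := trace _ _ xy.
  by move=> t t0 yE; apply: nprop; exists t.
(* both members stay close to the ray from [p] to [x] *)
suff -> : Y = Y' by [].
apply: contrapT => YY'.
have [E HE] := Xov _ D0.
pose n := maxn n0 n1.
have OP m : O (ray_pt p x m).
  by apply: cintD => //; apply: cclZ => //; rewrite ltW// exp2_gt0.
apply: nx; apply: (hil_cint (OP n) (M := E)).
have [U UU Uoo] := free_ultrafilter.
apply: (@hil_cvg _ _ C _ U _ _ (fun=> ray_pt p x n) (fun i => (2 ^+ i)^-1 *: ray_pt p x i)) => //.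
- have Un : \forall i \near U, (n <= i)%N by apply: Uoo; exact: nbhs_infty_ge.
  apply: filterS Un => m nm; rewrite hilZr ?invr_gt0 ?exp2_gt0//.
  apply: (HE _ _ XY XY' YY').
  + by apply: Yn0; rewrite leq_maxl.
  + by apply: Yn1; rewrite leq_maxr.
  + by apply: Yn0; apply: leq_trans nm; rewrite leq_maxl.
  + by apply: Yn1; apply: leq_trans nm; rewrite leq_maxr.
- exact: cvg_cst.
- by apply: ray_pt_cvg => W Wm; exact: Uoo.
- exact: cint_height.
Unshelve. all: by end_near. Qed.

End TriangleCover.

(** * Hausdorff convergence to a limit along an ultrafilter *)

Section UltraHausdorff.
Variables (R : realType) (d : nat) (C : proper_cone R d).
Local Notation V := 'cV[R]_d.
Local Notation O := (cint C).
Local Notation K := (ccl C).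
Local Notation h := (height C).
Local Notation hil := (hil C).
Implicit Types (u v w x y z : V) (M N a b s t : R) (A Y Z : set V).

(** Moving [z] slightly towards a point [z0] of the open ball brings it inside the open
    ball, by convexity. *)
Lemma ball_inner Z x0 M M0 z0 z N : cset C Z -> 1 < N -> M0 < M ->
  Z z0 -> hil M0 x0 z0 -> Z z -> hil M x0 z ->
  exists z', [/\ Z z', exists2 M', M' < M & hil M' x0 z' & hil N z z'].
Proof.
move=> cZ N1 MM Zz0 [b b0 [b1 b2]] Zz [a a0 [a1 a2]].
have [m m0 Om] := cint_absorb z0 (csetO cZ Zz).
have [an bn mn] : [/\ a != 0, b != 0 & m != 0] by split; exact: lt0r_neq0.
pose s := (N - 1) * a / (m * b).
have s0 : 0 < s by rewrite divr_gt0 ?mulr_gt0// subr_gt0.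
have s1 : 0 < 1 + s by lra.
have s1n : 1 + s != 0 := lt0r_neq0 s1.
exists (a *: z + (s * b) *: z0); split.
- by apply: (csetD cZ); apply: (csetZ cZ) => //; exact: mulr_gt0.
- exists ((M + s * M0) / (1 + s)); first by rewrite ltr_pdivrMr//; nra.
  exists (1 + s)^-1; first by rewrite invr_gt0.
  have i0 : 0 <= (1 + s)^-1 by rewrite invr_ge0 ltW.
  split.
    have -> : (1 + s)^-1 *: (a *: z + (s * b) *: z0) - x0 =
      (1 + s)^-1 *: ((a *: z - x0) + s *: (b *: z0 - x0)) by mxfield.
    by apply: cclZ => //; apply: cclD => //; apply: cclZ => //; exact: ltW.
  have -> : ((M + s * M0) / (1 + s)) *: x0 - (1 + s)^-1 *: (a *: z + (s * b) *: z0) =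
      (1 + s)^-1 *: ((M *: x0 - a *: z) + s *: (M0 *: x0 - b *: z0)) by mxfield.
  by apply: cclZ => //; apply: cclD => //; apply: cclZ => //; exact: ltW.
- exists a^-1; first by rewrite invr_gt0.
  split.
    have -> : a^-1 *: (a *: z + (s * b) *: z0) - z = (a^-1 * (s * b)) *: z0 by mxfield.
    apply: cclZ.
      by apply: mulr_ge0; [rewrite invr_ge0 ltW|apply: mulr_ge0; exact: ltW].
    exact: cint_ccl (csetO cZ Zz0).
  have -> : N *: z - a^-1 *: (a *: z + (s * b) *: z0) = ((N - 1) / m) *: (m *: z - z0).
    by rewrite /s; mxfield; rewrite an bn mn.
  apply: cclZ; first by rewrite divr_ge0 ?ltW// subr_gt0.
  exact: cint_ccl.
Qed.

Context {I : Type} (U : set_system I) {UU : UltraFilter U}.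
Variable Y : I -> set V.
Hypothesis cY : forall i, cset C (Y i).
Local Notation Z := (ulim C U Y).

Variables (x0 z0 : V) (M M0 N : R).
Hypotheses (Ox0 : O x0) (MM : M0 < M) (N1 : 1 < N) (Zz0 : Z z0) (Hz0 : hil M0 x0 z0).

Let cZ : cset C Z := cset_ulim (U := U) cY.

Let rescale (z : I -> V) : (\forall i \near U, hil M x0 (z i)) ->
  exists (t : I -> R) l, [/\ \forall i \near U, 0 < t i, hil M x0 l, h l = 1, O l &
    t i *: z i @[i --> U] --> l].
Proof.
move=> Uz.
have [|t [l [t0 Kl hl tl]]] := @ultra_scale _ _ C _ U UU z.
  apply: filterS Uz => i /(hil_cint Ox0) Oi; split; first exact: cint_ccl.
  exact: cint_nz Oi.
have xl : hil M x0 l.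
  apply: (hil_cvg _ (cvg_cst _) tl) => //; last by rewrite hl.
    by apply: filterS2 Uz t0 => i zi ti; rewrite hilZr.
  exact: cint_height.
by exists t, l; split => //; exact: hil_cint xl.
Qed.

(** Together with the converse below: in every ball whose interior meets the limit, the
    family converges to its limit for the Hausdorff distance. A sequence of points of the
    limit that violates this has a limit point in the closed ball; by [ball_inner] it can
    be replaced by a nearby point of the open ball, which the family approaches. *)
Lemma ulim_hausdorff_l : \forall i \near U, forall z, Z z -> hil M x0 z ->
  exists y, [/\ Y i y, exists2 M', M' < M & hil M' x0 y & hil N z y].
Proof.
apply: contrapT => /ultra_or bad.
have [z zP] : exists z : I -> V, \forall i \near U, [/\ Z (z i), hil M x0 (z i) &
    forall y, Y i y -> (exists2 M', M' < M & hil M' x0 y) -> ~ hil N (z i) y].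
  apply: (near_choice (P := fun i z => [/\ Z z, hil M x0 z &
    forall y, Y i y -> (exists2 M', M' < M & hil M' x0 y) -> ~ hil N z y])).
  apply: filterS bad => i /existsNP[z /not_implyP[Zz /not_implyP[Hz nz]]].
  by exists z; split => // y Yy My zy; apply: nz; exists y.
have [|t [l [t0 xl hl Ol tl]]] := @rescale z; first by apply: filterS zP => i [].
have Zl : Z l.
  apply: (cset_closed cZ); split => //; apply: cvg_closure tl.
  by apply: filterS2 zP t0 => i [Zi _ _] ti; exact: (csetZ cZ).
have [P P1 PN] := sqrt_le N1; have [Q Q1 QP] := sqrt_le P1.
have [z' [Zz' [M' M'M Hz'] lz']] := ball_inner cZ Q1 MM Zz0 Hz0 Zl xl.
have Oz' := csetO cZ Zz'.
have M'0 : 0 < M' := hil_gt0 (cint_height Ox0) (cint_height Oz') Hz'.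
pose Q2 := (M / M' + 1) / 2.
have Q21 : 1 < Q2.
  have : 1 < M / M' by rewrite ltr_pdivlMr// mul1r.
  by rewrite /Q2; lra.
have Q2M : M' * Q2 < M.
  have -> : M' * Q2 = (M + M') / 2 by rewrite /Q2; field; exact: lt0r_neq0.
  lra.
have nW : nbhs z' [set u | hil Q z' u /\ hil Q2 z' u].
  exact: filterI (near_hil Oz' Q1) (near_hil Oz' Q21).
have Yn := Zz'.2 _ nW.
have ln : \forall i \near U, hil Q l (t i *: z i) by apply: (cvg_in tl); exact: near_hil.
have [i [[[Zi xi ni] ti] [[y [Yy [zy zy2]]] li]]] :=
  near_ex (filterI (filterI zP t0) (filterI Yn ln)).
have Q0 : 0 < Q by lra.
apply: (ni y Yy).
  by exists (M' * Q2) => //; apply: hil_trans zy2 => //; lra.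
have Ki : K (z i) := cint_ccl (csetO cZ Zi).
apply: (hil_le (M := Q * (Q * Q))) => //; first by nra.
apply: (hil_trans (v := l)); [exact: mulr_gt0| |].
  by move/(hil_sym Q0) : li => /(hilZl C _ _ _ ti).
exact: hil_trans Q0 lz' zy.
Qed.

Lemma ulim_hausdorff_r : \forall i \near U, forall y, Y i y -> hil M x0 y ->
  exists z, [/\ Z z, exists2 M', M' < M & hil M' x0 z & hil N y z].
Proof.
apply: contrapT => /ultra_or bad.
have [y yP] : exists y : I -> V, \forall i \near U, [/\ Y i (y i), hil M x0 (y i) &
    forall z, Z z -> (exists2 M', M' < M & hil M' x0 z) -> ~ hil N (y i) z].
  apply: (near_choice (P := fun i y => [/\ Y i y, hil M x0 y &
    forall z, Z z -> (exists2 M', M' < M & hil M' x0 z) -> ~ hil N y z])).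
  apply: filterS bad => i /existsNP[y /not_implyP[Yy /not_implyP[Hy ny]]].
  by exists y; split => // z Zz Mz yz; apply: ny; exists z.
have [|t [l [t0 xl hl Ol tl]]] := @rescale y; first by apply: filterS yP => i [].
have Zl : Z l.
  apply: (ulim_in Ol tl).
  by apply: filterS2 yP t0 => i [Yi _ _] ti; exact: (csetZ (cY i)).
have [Q Q1 QN] := sqrt_le N1.
have [z' [Zz' [M' M'M Hz'] lz']] := ball_inner cZ Q1 MM Zz0 Hz0 Zl xl.
have ln : \forall i \near U, hil Q l (t i *: y i) by apply: (cvg_in tl); exact: near_hil.
have [i [[[Yi xi ni] ti] li]] := near_ex (filterI (filterI yP t0) ln).
have Q0 : 0 < Q by lra.
apply: (ni z' Zz'); first by exists M'.
have Ki : K (y i) := cint_ccl (csetO (cY i) Yi).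
apply: (hil_le QN) => //; apply: (hil_trans Q0 _ lz').
by move/(hil_sym Q0) : li => /(hilZl C _ _ _ ti).
Qed.

End UltraHausdorff.

(** * Chords and comparability *)

Section HilbertCone.
Variables (R : realType) (d : nat) (C : proper_cone R d).
Local Notation V := 'cV[R]_d.
Local Notation O := (cint C).
Local Notation K := (ccl C).
Local Notation h := (height C).
Implicit Types (A B X Y u v : V).

(** The multiples of [Y] that dominate [X] are read off at the endpoint [B] of the
    chord, where the coefficient of [A] vanishes, and symmetrically. *)
Lemma hil_chord A B X Y (s t : R) M : K A -> K B -> ~ O A -> ~ O B -> O X -> O Y ->
  0 < s -> s < t -> t < 1 -> X = (1 - s) *: A + s *: B -> Y = (1 - t) *: A + t *: B ->
  hil C M X Y <-> ((1 - s) * t) / (s * (1 - t)) <= M.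
Proof.
move=> KA KB nA nB OX OY s0 st t1 XE YE.
have t0 : 0 < t by exact: lt_trans st.
have t1' : 0 < 1 - t by rewrite subr_gt0.
have s1' : 0 < 1 - s by lra.
have [s_n0 t_n0 t1_n0 s1_n0] : [/\ s != 0, t != 0, 1 - t != 0 & 1 - s != 0].
  by split; exact: lt0r_neq0.
have D : ((1 - s) * t) / (s * (1 - t)) = (1 - s) / (1 - t) * (t / s).
  by field; rewrite s_n0 t1_n0.
have low a : 0 < a -> K (a *: Y - X) <-> (1 - s) / (1 - t) <= a.
  move=> a0; split=> [Ka|].
    rewrite leNgt; apply/negP => a1; apply: nB.
    pose k := (1 - s) / (1 - t) * t - s.
    have k0 : 0 < k.
      have -> : k = (t - s) / (1 - t) by rewrite /k; field.
      by rewrite divr_gt0// subr_gt0.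
    apply/(cintZP C _ k0).
    have -> : k *: B = (a *: Y - X) + ((1 - s) / (1 - t) - a) *: Y.
      rewrite XE YE /k; mxfield; exact: t1_n0.
    by apply: cclDO => //; apply: cintZ => //; rewrite subr_gt0.
  rewrite ler_pdivrMr// => a1.
  have -> : a *: Y - X = (a * (1 - t) - (1 - s)) *: A + (a * t - s) *: B.
    by rewrite XE YE; mxring.
  by apply: cclD; apply: cclZ => //; nra.
have up m : 0 < m -> K (m *: X - Y) <-> t / s <= m.
  move=> m0; split=> [Km|].
    rewrite leNgt; apply/negP => m1; apply: nA.
    pose k := t / s * (1 - s) - (1 - t).
    have k0 : 0 < k.
      have -> : k = (t - s) / s by rewrite /k; field.
      by rewrite divr_gt0// subr_gt0.
    apply/(cintZP C _ k0).
    have -> : k *: A = (m *: X - Y) + (t / s - m) *: X.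
      rewrite XE YE /k; mxfield; exact: s_n0.
    by apply: cclDO => //; apply: cintZ => //; rewrite subr_gt0.
  rewrite ler_pdivrMr// => m1.
  have -> : m *: X - Y = (m * (1 - s) - (1 - t)) *: A + (m * s - t) *: B.
    by rewrite XE YE; mxring.
  by apply: cclD; apply: cclZ => //; nra.
have r1 : 0 < (1 - s) / (1 - t) by exact: divr_gt0.
have r2 : 0 < t / s by exact: divr_gt0.
have up' a : 0 < a -> 0 < M -> K (M *: X - a *: Y) <-> t / s <= M / a.
  move=> a0 M0; rewrite -up ?divr_gt0//.
  have -> : M *: X - a *: Y = a *: ((M / a) *: X - Y).
    by mxfield; exact: lt0r_neq0.
  exact: cclZP.
rewrite D; split=> [HM|DM].
  have M0 := hil_gt0 (cint_height OX) (cint_height OY) HM.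
  case: HM => a a0 [/low-/(_ a0) a1 /up'-/(_ a0 M0)].
  rewrite ler_pdivlMr// => /(le_trans _); apply.
  by rewrite mulrC ler_pM2l.
have M0 : 0 < M by apply: lt_le_trans DM; exact: mulr_gt0.
exists ((1 - s) / (1 - t)) => //; split; first by apply/low.
by apply/up' => //; rewrite ler_pdivlMr// mulrC.
Qed.

Lemma max_sub_nO u v s : (forall t, s < t -> ~ K (u - t *: v)) -> ~ O (u - s *: v).
Proof.
move=> ns Ouv; have [m m0 Om] := cint_absorb v Ouv.
apply: (ns (s + m^-1)); first by rewrite ltrDl invr_gt0.
have -> : u - (s + m^-1) *: v = m^-1 *: (m *: (u - s *: v) - v).
  by mxfield; exact: lt0r_neq0.
by apply: cclZ; [rewrite invr_ge0 ltW|exact: cint_ccl].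
Qed.

Lemma max_sub_gt0 u v s : O u -> (forall t, s < t -> ~ K (u - t *: v)) -> 0 < s.
Proof.
move=> Ou ns; rewrite ltNge; apply/negP => s0.
have [m m0 Om] := cint_absorb v Ou.
apply: (ns m^-1); first by apply: (le_lt_trans s0); rewrite invr_gt0.
have -> : u - m^-1 *: v = m^-1 *: (m *: u - v).
  by mxfield; exact: lt0r_neq0.
by apply: cclZ; [rewrite invr_ge0 ltW|exact: cint_ccl].
Qed.

(** The endpoints are reached by subtracting from each point the largest possible
    multiple of the other one; the constants come from solving for [X] and [Y]. *)
Lemma chord_exists X Y : O X -> O Y -> h X = 1 -> h Y = 1 -> X <> Y ->
  exists A B (s t : R), [/\ [/\ K A, K B, ~ O A & ~ O B], h A = 1, h B = 1,
    [/\ 0 < s, s < t & t < 1] & X = A + s *: (B - A) /\ Y = A + t *: (B - A)].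
Proof.
move=> OX OY hX hY XY.
have KX := cint_ccl OX; have KY := cint_ccl OY.
have [a a0 [Ka na]] := max_sub KY KX (cint_nz OX).
have [b b0 [Kb nb]] := max_sub KX KY (cint_nz OY).
have {}a0 := max_sub_gt0 OY na; have {}b0 := max_sub_gt0 OX nb.
have a1 : 0 < 1 - a.
  have := ccl_height Ka; rewrite heightB heightZ hX hY mulr1 le_eqVlt => /orP[/eqP e0|//].
  exfalso; apply: XY; apply/esym/eqP; rewrite -subr_eq0.
  have a1 : a = 1 by lra.
  apply/eqP; apply: (@ccl_height0 _ _ C); first by rewrite a1 scale1r in Ka.
  by rewrite heightB hX hY subrr.
have b1 : 0 < 1 - b.
  have := ccl_height Kb; rewrite heightB heightZ hX hY mulr1 le_eqVlt => /orP[/eqP e0|//].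
  exfalso; apply: XY; apply/eqP; rewrite -subr_eq0.
  have b1 : b = 1 by lra.
  apply/eqP; apply: (@ccl_height0 _ _ C); first by rewrite b1 scale1r in Kb.
  by rewrite heightB hX hY subrr.
have ab1 : 0 < 1 - a * b by nra.
have [n1 n2 n3] : [/\ 1 - a != 0, 1 - b != 0 & 1 - a * b != 0].
  by split; exact: lt0r_neq0.
(* [A] and [B] are [X - b *: Y] and [Y - a *: X], normalized *)
exists ((1 - b)^-1 *: (X - b *: Y)), ((1 - a)^-1 *: (Y - a *: X)),
  (b * (1 - a) / (1 - a * b)), ((1 - a) / (1 - a * b)); split.
- split.
  + by apply: cclZ => //; rewrite invr_ge0 ltW.
  + by apply: cclZ => //; rewrite invr_ge0 ltW.
  + by rewrite cintZP ?invr_gt0//; exact: max_sub_nO.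
  + by rewrite cintZP ?invr_gt0//; exact: max_sub_nO.
- by rewrite heightZ heightB heightZ hX hY mulr1 mulVf.
- by rewrite heightZ heightB heightZ hX hY mulr1 mulVf.
- split; first by rewrite divr_gt0// mulr_gt0.
    by rewrite ltr_pM2r ?invr_gt0// -subr_gt0; nra.
  by rewrite ltr_pdivrMr// mul1r; nra.
- by split; mxfield; rewrite n1 n2 n3.
Qed.

End HilbertCone.

(** * Independent vectors *)

(** The vectors are the columns of a matrix of full rank, and Gaussian elimination
    completes that matrix to an invertible one. *)
Lemma frame_exists (R : realType) (d k : nat) (b : 'I_k -> 'cV[R]_d) :
  (forall c : 'I_k -> R, \sum_i c i *: b i = 0 -> forall i, c i = 0) ->
  exists (kd : (k <= d)%N) (A : 'M[R]_d), A \in unitmx /\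
    forall v : 'cV[R]_d, (forall j : 'I_d, (k <= j)%N -> v j 0 = 0) ->
      A *m v = \sum_i v (widen_ord kd i) 0 *: b i.
Proof.
move=> ind; pose M : 'M[R]_(d, k) := \matrix_(i, j) b j i 0.
have ME (v : 'cV_k) : M *m v = \sum_i v i 0 *: b i.
  apply/matrixP => i j; rewrite ord1 !mxE summxE; apply: eq_bigr => l _.
  by rewrite !mxE mulrC.
have rM : \rank M = k.
  rewrite -mxrank_tr; apply/eqP; apply: inj_row_free => v vM0.
  have : M *m v^T = 0 by rewrite -[M]trmxK -trmx_mul vM0 trmx0.
  rewrite ME => /ind v0; apply/matrixP => i j; rewrite ord1.
  by have := v0 j; rewrite !mxE.
have kd : (k <= d)%N by rewrite -rM rank_leq_row.
exists kd; have [n dE] : exists n, d = (k + n)%N by exists (d - k)%N; rewrite subnKC.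
subst d.
exists (col_ebase M *m block_mx (row_ebase M) 0 0 1%:M); split.
  rewrite unitmx_mul col_ebase_unit /= unitmxE det_ublock det1 mulr1 -unitmxE.
  exact: row_ebase_unit.
move=> v v0; have -> : v = col_mx (usubmx v) 0.
  rewrite -[LHS]vsubmxK; congr col_mx; apply/matrixP => i j; rewrite ord1 !mxE v0//=.
  by rewrite leq_addr.
rewrite -mulmxA mul_block_col !mul0mx !mulmx0 !addr0.
have -> : col_mx (row_ebase M *m usubmx v) 0 = pid_mx (\rank M) *m (row_ebase M *m usubmx v) :> 'cV[R]_(k + n).
  by rewrite [in RHS]rM pid_mx_col mul_col_mx mul1mx mul0mx.
transitivity (M *m usubmx v); first by rewrite -[X in _ = X *m _](mulmx_ebase M) !mulmxA.
rewrite ME; apply: eq_bigr => i _; congr (_ *: _).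
have -> : widen_ord kd i = lshift n i by exact: val_inj.
by rewrite col_mxEu.
Qed.

Section TriangleIndependence.
Variables (R : realType) (d : nat) (C : proper_cone R d).
Local Notation V := 'cV[R]_d.
Local Notation O := (cint C).
Local Notation K := (ccl C).
Variables a b c : V.
Hypothesis Oabc : O (a + b + c).
Hypothesis sides : forall s t : R, 0 <= s -> 0 <= t ->
    [/\ ~ O (s *: a + t *: b), ~ O (s *: b + t *: c) & ~ O (s *: a + t *: c)].

(** Adding to [a + b + c] a suitable multiple of a linear relation cancels one of the
    three coefficients and keeps the others nonnegative; this would put an interior
    point on a side. *)
Lemma triangle_independent x y z : x *: a + y *: b + z *: c = 0 ->
  [/\ x = 0, y = 0 & z = 0].
Proof.
have pos (k m : R) : 0 < k -> - k <= m -> 0 <= 1 + m / k.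
  by move=> k0 km; rewrite -(pmulr_rge0 _ k0) mulrDr mulr1 mulrCA divff ?gt_eqF// mulr1 addrC -lerBlDr sub0r.
have ge0 x' y' z' : x' *: a + y' *: b + z' *: c = 0 -> [/\ 0 <= x', 0 <= y' & 0 <= z'].
  move=> E.
  have na : x' < 0 -> x' <= y' -> x' <= z' -> False.
    move=> x0 xy xz; have k0 : 0 < - x' by lra.
    have [||s1 s2 s3] := @sides (1 + y' / - x') (1 + z' / - x'); [by apply: pos; rewrite ?opprK|by apply: pos; rewrite ?opprK|].
    apply: s2; have -> : (1 + y' / - x') *: b + (1 + z' / - x') *: c =
      a + b + c + (- x')^-1 *: (x' *: a + y' *: b + z' *: c).
      by mxfield; rewrite lt_eqF.
    by rewrite E scaler0 addr0.
  have nb : y' < 0 -> y' <= x' -> y' <= z' -> False.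
    move=> x0 xy xz; have k0 : 0 < - y' by lra.
    have [||s1 s2 s3] := @sides (1 + x' / - y') (1 + z' / - y'); [by apply: pos; rewrite ?opprK|by apply: pos; rewrite ?opprK|].
    apply: s3; have -> : (1 + x' / - y') *: a + (1 + z' / - y') *: c =
      a + b + c + (- y')^-1 *: (x' *: a + y' *: b + z' *: c).
      by mxfield; rewrite lt_eqF.
    by rewrite E scaler0 addr0.
  have nc : z' < 0 -> z' <= x' -> z' <= y' -> False.
    move=> x0 xy xz; have k0 : 0 < - z' by lra.
    have [||s1 s2 s3] := @sides (1 + x' / - z') (1 + y' / - z'); [by apply: pos; rewrite ?opprK|by apply: pos; rewrite ?opprK|].
    apply: s1; have -> : (1 + x' / - z') *: a + (1 + y' / - z') *: b =
      a + b + c + (- z')^-1 *: (x' *: a + y' *: b + z' *: c).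
      by mxfield; rewrite lt_eqF.
    by rewrite E scaler0 addr0.
  clear E.
  have nneg (u v w : R) : (u < 0 -> u <= v -> u <= w -> False) -> u <= v -> u <= w ->
      [/\ 0 <= u, 0 <= v & 0 <= w].
    move=> nu uv uw; have u0 : 0 <= u by rewrite leNgt; apply/negP => /nu; exact.
    by split => //; [exact: le_trans uv|exact: le_trans uw].
  have [xy|/ltW yx] := leP x' y'.
    have [xz|/ltW zx] := leP x' z'; first exact: nneg.
    by have [|z0 x0 y0] := nneg _ _ _ nc zx; [exact: le_trans xy|].
  have [yz|/ltW zy] := leP y' z'.
    by have [y0 x0 z0] := nneg _ _ _ nb yx yz.
  by have [|z0 x0 y0] := nneg _ _ _ nc _ zy; [exact: le_trans yx|].
move=> E; have [x0 y0 z0] := ge0 _ _ _ E.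
have [|x1 y1 z1] := ge0 (- x) (- y) (- z).
  by rewrite !scaleNr -!opprD E oppr0.
by clear E; split; lra.
Qed.

End TriangleIndependence.

(** * Projective points and vectors *)

Section ProjectivePoints.
Variables (R : realType) (d : nat).
Local Notation V := 'cV[R]_d.
Implicit Types (u v : V) (w : @nonzero R d) (p : pspace R d) (f : 'rV[R]_d).

Definition nz v (v0 : v != 0) : @nonzero R d := SigSub (@mem_set _ (@nonzero R d) v v0).

Lemma val_neq0 w : \val w != 0.
Proof. exact: (@set_valP _ (@nonzero R d) w). Qed.

Lemma pt_scale w w' (c : R) : \val w' = c *: \val w -> pt w' = pt w.
Proof.
move=> E; apply/eq_pt; exists c => //.
by apply: contraNneq (val_neq0 w') => c0; rewrite E c0 scale0r.
Qed.

Lemma vec_pt w : exists2 c : R, c != 0 & \val (vec (pt w)) = c *: \val w.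
Proof. exact: ((eq_pt _ _).1 (vecK (pt w))). Qed.

Definition lfun f v : R := (f *m v) 0 0.

Lemma lfunD f u v : lfun f (u + v) = lfun f u + lfun f v.
Proof. by rewrite /lfun mulmxDr addmxE. Qed.

Lemma lfunZ f t v : lfun f (t *: v) = t * lfun f v.
Proof. by rewrite /lfun -scalemxAr scalemxE. Qed.

Lemma lfun0 f : lfun f 0 = 0.
Proof. by rewrite /lfun mulmx0 zeromxE. Qed.

Lemma lfunN f v : lfun f (- v) = - lfun f v.
Proof. by rewrite -scaleN1r lfunZ mulN1r. Qed.

Lemma lfun_continuous f : continuous (lfun f).
Proof.
move=> v; apply: (@continuous_comp _ _ _ (mulmx f) (fun M : 'M[R]_1 => M 0 0)).
  exact: mulmx_continuous.
exact: coord_continuous.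
Qed.

Lemma lfun_neq0 f v : lfun f v != 0 -> v != 0.
Proof. by apply: contra_neq => ->; exact: lfun0. Qed.

Lemma chart_coord_pt f w : chart_coord f (pt w) = (lfun f (\val w))^-1 *: \val w.
Proof.
have [c c0 E] := vec_pt w; rewrite /chart_coord /lform E -/(lfun f _) lfunZ.
by rewrite scalerA invfM mulrAC mulVf ?mul1r.
Qed.

Lemma affine_chart_pt f w : affine_chart f (pt w) <-> lfun f (\val w) != 0.
Proof.
have [c c0 E] := vec_pt w; rewrite /affine_chart /lform /= E -/(lfun f _) lfunZ.
by rewrite mulf_eq0 negb_or c0.
Qed.

(** Vectors, rather than points of a chart: projective points and their closures are
    compared with a cone of [R^d] independently of the choice of representatives. *)
Definition cone_over f (A : set (pspace R d)) : set V :=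
  [set v | 0 < lfun f v /\ exists2 w : @nonzero R d, \val w = v & A (pt w)].

Lemma overP f A w : 0 < lfun f (\val w) -> cone_over f A (\val w) <-> A (pt w).
Proof.
move=> fw; split=> [[_ [w' /val_inj ->//]]|Aw]; split => //; by exists w.
Qed.

Lemma over_pt f A v : cone_over f A v -> exists w : @nonzero R d, \val w = v /\ A (pt w).
Proof. by move=> [_ [w wv Aw]]; exists w. Qed.

Lemma over_sub f A B : A `<=` B -> cone_over f A `<=` cone_over f B.
Proof. by move=> AB v [fv [w wv Aw]]; split => //; exists w => //; exact: AB. Qed.

Lemma overZ f A t v : 0 < t -> cone_over f A v -> cone_over f A (t *: v).
Proof.
move=> t0 [fv [w wv Aw]]; rewrite -wv; have tw0 : t *: \val w != 0.
  by rewrite scaler_eq0 negb_or gt_eqF//= val_neq0.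
split; first by rewrite lfunZ wv mulr_gt0.
by exists (nz tw0) => //; rewrite (@pt_scale w _ t).
Qed.

Lemma pt_continuous : continuous (@pt R d).
Proof. exact: pi_continuous. Qed.

Lemma nbhs_nz (w : @nonzero R d) (W : set (@nonzero R d)) : nbhs w W ->
  exists2 B : set V, nbhs (\val w) B & forall w', B (\val w') -> W w'.
Proof.
rewrite nbhsE => -[W' [[B oB BW'] W'w] W'W]; exists B.
  by apply: open_nbhs_nbhs; split => //; move: W'w; rewrite -BW'.
by move=> w' Bw'; apply: W'W; rewrite -BW'.
Qed.

Lemma val_cvg (w : @nonzero R d) (B : set V) : nbhs (\val w) B ->
  nbhs w [set w' : @nonzero R d | B (\val w')].
Proof.
rewrite nbhsE => -[B' [oB' B'w] B'B]; rewrite nbhsE.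
exists [set w' : @nonzero R d | B' (\val w')] => /=; last by move=> w' /B'B.
by split => //; exists B'.
Qed.

(** The saturation of an open set of vectors is a union of its multiples. *)
Lemma open_pt_image (B : set V) : open B ->
  open [set p : pspace R d | exists2 w, pt w = p & B (\val w)].
Proof.
move=> oB; rewrite openE => p [w <- Bw].
have oS : open ((@pt R d) @^-1` [set p : pspace R d | exists2 w, pt w = p & B (\val w)]).
  rewrite openE => w1 [w2 E Bw2].
  have [c c0 wE] := (eq_pt _ _).1 E.
  have : nbhs (\val w1) [set v | B (c *: v)].
    apply: (@scaler_continuous _ V c (\val w1)); rewrite -wE.
    by apply: open_nbhs_nbhs.
  move=> /val_cvg; apply: filterS => w3 /= Bw3.
  have cw3 : c *: \val w3 != 0 by rewrite scaler_eq0 negb_or c0 val_neq0.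
  by exists (nz cw3) => //; rewrite (@pt_scale w3 _ c).
by apply: open_nbhs_nbhs; split; [exact: oS|exists w].
Qed.

Lemma over_open f A : open A -> open (cone_over f A).
Proof.
move=> oA; rewrite openE => v [fv [w wv Aw]].
have nw : nbhs w (@pt R d @^-1` A).
  by apply: pt_continuous; apply: open_nbhs_nbhs.
have [B Bw BA] := nbhs_nz nw.
have nf : \forall v' \near v, 0 < lfun f v'.
  apply: (@lfun_continuous f v [set x | 0 < x]).
  by apply: open_nbhs_nbhs; split => //; exact: open_gt.
rewrite -wv in nf *.
near=> v'; have fv' : 0 < lfun f v' by near: v'.
have v'0 : v' != 0 by apply: (@lfun_neq0 f); rewrite gt_eqF.
split => //; exists (nz v'0) => //; apply: BA => /=; near: v'; exact: Bw.
Unshelve. all: by end_near. Qed.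

Lemma over_closure_pt f A w : closure (cone_over f A) (\val w) -> closure A (pt w).
Proof.
move=> cl W Ww; have nw : nbhs w (@pt R d @^-1` W) by exact: pt_continuous.
have [B Bw BW] := nbhs_nz nw.
have [_ [[_ [w' <- Aw']] Bw']] := cl B Bw.
by exists (pt w'); split => //; exact: BW.
Qed.

Lemma pt_closure_over f A w : 0 < lfun f (\val w) -> closure A (pt w) ->
  closure (cone_over f A) (\val w).
Proof.
move=> fw cl W; rewrite nbhsE => -[B [oB Bw] BW].
pose B' := B `&` [set v | 0 < lfun f v].
have oB' : open B'.
  apply: openI => //; apply: (@open_comp _ _ (lfun f) [set x | 0 < x]); last exact: open_gt.
  by move=> v _; exact: lfun_continuous.
have [|p [Ap [w' w'p [Bw' fw']]]] := cl [set p | exists2 w, pt w = p & B' (\val w)].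
  by apply: open_nbhs_nbhs; split; [exact: open_pt_image|exists w].
exists (\val w'); split; last exact: BW.
by apply/overP => //; rewrite w'p.
Qed.

(** Convexity in an affine chart, for positive combinations of vectors: normalizing
    them in the chart turns the combination into a convex one. *)
Lemma convex_in_chartD g A (w1 w2 w : @nonzero R d) (s t : R) : convex_in_chart g A ->
  A (pt w1) -> A (pt w2) -> 0 < s * lfun g (\val w1) -> 0 < t * lfun g (\val w2) ->
  \val w = s *: \val w1 + t *: \val w2 -> A (pt w).
Proof.
move=> [Ag cA] A1 A2 s1 t2 wE.
have g1 : lfun g (\val w1) != 0 by apply/affine_chart_pt; exact: Ag.
have g2 : lfun g (\val w2) != 0 by apply/affine_chart_pt; exact: Ag.
pose S := s * lfun g (\val w1) + t * lfun g (\val w2).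
have S0 : 0 < S by exact: addr_gt0.
have l0 : 0 <= s * lfun g (\val w1) / S by rewrite divr_ge0// ltW.
have l1 : s * lfun g (\val w1) / S <= 1.
  by rewrite ler_pdivrMr// mul1r lerDl ltW.
have : (chart_coord g @` A) (conv (Itv01 l0 l1) (chart_coord g (pt w1) : convex_lmodType V)
    (chart_coord g (pt w2))).
  by apply/set_mem; apply: cA; apply/mem_set; [exists (pt w1)|exists (pt w2)].
move=> [q Aq]; rewrite !chart_coord_pt.
rewrite -(vecK q) chart_coord_pt => E.
have gq : lfun g (\val (vec q)) != 0.
  by apply/affine_chart_pt; rewrite vecK; exact: Ag.
suff -> : pt w = q by [].
rewrite -[q]vecK; apply: (@pt_scale _ _ (S * (lfun g (\val (vec q)))^-1)).
rewrite -scalerA E wE /conv /=.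
have S_neq0 := lt0r_neq0 S0.
rewrite scalerDr !scalerA /unstable.onem /S in S_neq0 *; congr (_ *: _ + _ *: _).
  by field; rewrite g1 S_neq0.
by field; rewrite g2 S_neq0.
Qed.

End ProjectivePoints.

Section ProjectiveAction.
Variables (R : realType) (d : nat).
Local Notation V := 'cV[R]_d.
Implicit Types (g h : PGL R d) (p q : pspace R d).

Lemma act_pt g w : act g (pt w) = pt (actGL (mx g) w).
Proof. by rewrite -[g in LHS]mxK actE. Qed.

Lemma act_comp g h p : act (g * h)%g p = act g (act h p).
Proof.
rewrite -[p]vecK (act_pt h) (act_pt g).
rewrite -[(g * h)%g]/(pgl (mulGL (mx g) (mx h))) actE; congr pt; apply: val_inj.
by rewrite /= mulmxA.
Qed.

Lemma act1 p : act 1%g p = p.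
Proof.
rewrite -[p]vecK -[1%g]/(PGL_one R d) actE; congr pt; apply: val_inj.
by rewrite /= mul1mx.
Qed.

Lemma actK g p : act g^-1%g (act g p) = p.
Proof. by rewrite -act_comp mulVg act1. Qed.

Lemma actKV g p : act g (act g^-1%g p) = p.
Proof. by rewrite -act_comp mulgV act1. Qed.

Lemma act_image_comp g h (Y : set (pspace R d)) :
  act g @` (act h @` Y) = act (g * h)%g @` Y.
Proof.
apply/seteqP; split=> [_ [_ [p Yp <-] <-]|_ [p Yp <-]].
  by exists p => //; rewrite act_comp.
by exists (act h p); [exists p|rewrite act_comp].
Qed.

Lemma act_image1 (Y : set (pspace R d)) : act 1%g @` Y = Y.
Proof.
by apply/seteqP; split=> [_ [p Yp <-]|p Yp]; [rewrite act1|exists p; rewrite ?act1].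
Qed.

Lemma actGL_continuous (A : @invertible R d) : continuous (actGL A).
Proof.
move=> w W /nbhs_nz[B Bw BW].
have : nbhs (\val w) [set v : V | B (\val A *m v)].
  exact: (@mulmx_continuous R d d (\val A) (\val w)).
by move=> /val_cvg; apply: filterS => w' Bw'; apply: BW.
Qed.

Lemma act_continuous g : continuous (act g).
Proof.
apply/(@quotient_continuous _ {eq_quot (gen_equiv_rel (@proportional_vec R d))}).
have -> : act g \o \pi_(quotient_topology {eq_quot gen_equiv_rel (proportional_vec (d:=d))})%qT =
    @pt R d \o actGL (mx g).
  by apply/funext => w /=; rewrite -[g in LHS]mxK -actE.
move=> w; apply: (@continuous_comp _ _ _ (actGL (mx g)) (@pt R d)).
  exact: actGL_continuous.
exact: pt_continuous.
Qed.

Lemma act_closure g A p : closure A p -> closure (act g @` A) (act g p).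
Proof.
apply: closure_map; first exact: act_continuous.
by move=> q Aq; exists q.
Qed.

Lemma proj_convex_preimage g A : proj_convex A -> proj_convex (act g @^-1` A).
Proof.
move=> [f f0 [Af cA]]; set B := mx g.
pose f' := f *m \val B.
have uB : \val B \in unitmx by exact: (@set_valP _ (@invertible R d) B).
have fE v : lfun f' v = lfun f (\val B *m v) by rewrite /lfun /f' mulmxA.
have Apt w : (act g @^-1` A) (pt w) <-> A (pt (actGL B w)) by rewrite /= -actE mxK.
have coordE w : \val B *m chart_coord f' (pt w) = chart_coord f (pt (actGL B w)).
  by rewrite !chart_coord_pt fE -scalemxAr.
exists f'.
  apply: contraNneq f0 => f'0; have := mulmxK uB f; rewrite -/f' f'0 mul0mx => <-.
  by [].
split=> [p Ap|].
  rewrite -[p]vecK; apply/affine_chart_pt; rewrite fE.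
  apply/(affine_chart_pt f (actGL B (vec p))); apply: Af.
  by rewrite -actE mxK vecK.
move=> x y l /set_mem[p Ap px] /set_mem[q Aq qy]; apply/mem_set.
have : (chart_coord f @` A) (conv l (chart_coord f (act g p) : convex_lmodType V)
    (chart_coord f (act g q))).
  by apply/set_mem; apply: cA; apply/mem_set; [exists (act g p)|exists (act g q)].
move=> [r Ar rE]; exists (act g^-1%g r); first by rewrite /= actKV.
have E p' : chart_coord f' p' = invmx (\val B) *m chart_coord f (act g p').
  rewrite -[p' in LHS]vecK -[LHS](mulKmx uB) coordE; congr (_ *m chart_coord f _).
rewrite E actKV rE -px -qy !E /conv /= mulmxDr -!scalemxAr.
by [].
Qed.

End ProjectiveAction.

Section ChartContinuity.
Variables (R : realType) (d : nat).
Local Notation V := 'cV[R]_d.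

Lemma chart_coord_continuous (f : 'rV[R]_d) (p : pspace R d) : affine_chart f p ->
  {for p, continuous (chart_coord f)}.
Proof.
rewrite -[p]vecK; set w := vec p => /affine_chart_pt fw W.
rewrite chart_coord_pt => Ww.
have : nbhs (\val w) [set v : V | lfun f v != 0 /\ W ((lfun f v)^-1 *: v)].
  have cf : lfun f v @[v --> \val w] --> lfun f (\val w) := @lfun_continuous R d f (\val w).
  have n1 : \forall v \near \val w, lfun f v != 0.
    by apply: (cvg_in cf (A := [set x | x != 0])); apply: open_nbhs_nbhs; split => //; exact: open_neq.
  have c2 : (lfun f v)^-1 *: v @[v --> \val w] --> (lfun f (\val w))^-1 *: \val w.
    have ci : (lfun f v)^-1 @[v --> \val w] --> (lfun f (\val w))^-1 by exact: cvgV fw cf.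
    exact: (@cvgZ _ _ _ (nbhs (\val w)) _ _ id _ _ ci (@cvg_id _ (nbhs (\val w)))).
  have n2 : \forall v \near \val w, W ((lfun f v)^-1 *: v) by exact: (c2 _ Ww).
  exact: filterS2 n1 n2.
rewrite nbhsE => -[B [oB Bw] BW].
have oP := open_pt_image oB.
apply: filterS (open_nbhs_nbhs (conj oP (ex_intro2 _ _ w erefl Bw))).
by move=> q [w' <- /BW[_ Ww']]; rewrite /= chart_coord_pt.
Qed.

Lemma curve_continuous (T : topologicalType) (c : T -> V) (cn : forall t, c t != 0) :
  continuous c -> continuous (fun t => pt (nz (cn t))).
Proof.
move=> cc t; apply: (@continuous_comp _ _ _ (fun t => nz (cn t)) (@pt R d)).
  move=> W /nbhs_nz[B Bw BW].
  have nB : nbhs t (c @^-1` B) by exact: cc.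
  by apply: filterS nB => s Bs; exact: BW.
exact: pt_continuous.
Qed.

(** A nonzero minor, used as a coordinate on the plane of the two vectors. *)
Lemma minor_neq0 (a b : V) : (forall s t, s *: a = t *: b -> s = 0 /\ t = 0) ->
  exists i j, a i 0 * b j 0 - a j 0 * b i 0 != 0.
Proof.
move=> ind; apply: contrapT => nz0.
have E i j : a i 0 * b j 0 = a j 0 * b i 0.
  by apply/eqP; rewrite -subr_eq0; apply/negP => /negP ne; apply: nz0; exists i, j.
have a0 i : a i 0 = 0.
  have [|_ //] := ind (b i 0) (a i 0).
  by apply/matrixP => j k; rewrite ord1 !mxE mulrC E.
have := @ind 1 0; rewrite scale0r => H.
have [|/eqP] := H; last by rewrite oner_eq0.
by apply/matrixP => j k; rewrite ord1 !mxE a0 mulr0.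
Qed.

End ChartContinuity.

(** * Comparison of topological quotients *)

Section QuotientComparison.
Variables (T : topologicalType).
Implicit Types r s : T -> T -> Prop.

Lemma closure_rel_incl r s : (forall x y, r x y -> clos_refl_sym_trans T s x y) ->
  forall x y, clos_refl_sym_trans T r x y -> clos_refl_sym_trans T s x y.
Proof.
move=> rs x y; elim=> [a b /rs//|a|a b _|a b c _ ab _ bc].
- exact: rst_refl.
- exact: rst_sym.
- exact: rst_trans ab bc.
Qed.

Lemma quot_map_continuous r s (h : quot_by r -> quot_by s) :
  (forall x, h (qpi r x) = qpi s x) -> continuous h.
Proof.
move=> hE; apply/(@quotient_continuous _ {eq_quot (gen_equiv_rel r)}).
have -> : h \o \pi_(quotient_topology {eq_quot gen_equiv_rel r})%qT = qpi s.
  by apply/funext => x /=; exact: hE.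
exact: pi_continuous.
Qed.

(** The two relations generate the same equivalence relation. *)
Lemma same_quotient_of_equiv r s :
  (forall x y, r x y -> clos_refl_sym_trans T s x y) ->
  (forall x y, s x y -> clos_refl_sym_trans T r x y) -> same_quotient r s.
Proof.
move=> rs sr.
pose h (p : quot_by r) := qpi s (qrepr p); pose k (p : quot_by s) := qpi r (qrepr p).
have hE x : h (qpi r x) = qpi s x.
  by apply/eq_qpi/(closure_rel_incl rs)/eq_qpi; exact: qreprK.
have kE x : k (qpi s x) = qpi r x.
  by apply/eq_qpi/(closure_rel_incl sr)/eq_qpi; exact: qreprK.
exists h, k; split => //.
- by move=> p; rewrite -[RHS]qreprK -kE.
- by move=> p; rewrite -[RHS]qreprK -hE.
- exact: quot_map_continuous.
- exact: quot_map_continuous.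
Qed.

End QuotientComparison.

Lemma cV_bounded_compact (R : realType) (d : nat) (A : set 'cV[R]_d) (B : R) :
  closed A -> (forall v j, A v -> `|v j 0| <= B) -> compact A.
Proof.
move=> cA bA; rewrite compact_ultra => F UF FA.
have lim j : exists l : R, v j 0 @[v --> F] --> l.
  have [|l _ ul] := @ultra_itv_cvg R _ F UF (fun v : 'cV[R]_d => v j 0) (- B) B.
    by apply: filterS FA => v Av; rewrite -ler_norml; exact: bA.
  by exists l.
have /choice[l ll] := lim.
have Fl : F --> (\col_j l j : 'cV[R]_d).
  have E (v : 'cV[R]_d) : v = \sum_j v j 0 *: delta_mx j 0.
    by rewrite [LHS]matrix_sum_delta; apply: eq_bigr => j _; rewrite big_ord1.
  have c : (\sum_j v j 0 *: delta_mx j 0) @[v --> F] --> (\col_j l j : 'cV[R]_d).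
    rewrite [X in _ --> X]E; apply: cvg_sum_seq => j; rewrite mxE.
    by apply: cvgZr_tmp; exact: ll.
  move=> W Wl; have := c W Wl.
  suff E' : [set v : 'cV[R]_d | W (\sum_j v j 0 *: delta_mx j 0)] = W.
    by rewrite /fmap /= => FW; rewrite -E'.
  by apply/funext => v; rewrite /= -E.
exists (\col_j l j : 'cV[R]_d); split => //.
exact: (@cvg_closed _ F _ _ id).
Qed.

Lemma coord_le_norm (R : realType) (d : nat) (v : 'cV[R]_d) j : `|v j 0| <= `|v|.
Proof.
rewrite [leRHS]/Num.norm /= mx_normrE.
by apply/bigmax_geP; right => /=; exists (j, 0).
Qed.

(** * The cone over a properly convex domain *)

Section ConvexDomain.
Variables (R : realType) (d : nat) (Omega : set (pspace R d)) (f : 'rV[R]_d).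
Hypotheses (oO : open Omega) (chartO : properly_convex_in_chart f Omega)
  (Omega0 : Omega !=set0).
Local Notation V := 'cV[R]_d.
Local Notation O := (cone_over f Omega).
Local Notation K := (closure O).
Local Notation dist := (hilbert_dist Omega).
Implicit Types (u v : V) (p q : pspace R d) (Y : set (pspace R d)).

Section DomainCone.
Local Notation h := (lfun f).
Implicit Types w : @nonzero R d.

Lemma over_chart w : Omega (pt w) -> h (\val w) != 0.
Proof. by case: chartO => _ [cO _] _ Ow; apply/affine_chart_pt; exact: cO. Qed.

Lemma over_nonempty : exists v, O v.
Proof.
have [p] := Omega0; rewrite -(vecK p) => Op.
have := over_chart Op; set w := vec p => hw.
have [hw0|hw0] := ltP 0 (h (\val w)); first by exists (\val w); exact/overP.
have nw : - \val w != 0 by rewrite oppr_eq0 val_neq0.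
exists (- \val w); split; first by rewrite lfunN oppr_gt0 lt_neqAle hw.
by exists (nz nw) => //; rewrite (@pt_scale _ _ w _ (-1)) // scaleN1r.
Qed.

Lemma overD u v : O u -> O v -> O (u + v).
Proof.
move=> [hu [w1 w1u O1]] [hv [w2 w2v O2]].
have huv : 0 < h (u + v) by rewrite lfunD addr_gt0.
have uv0 : u + v != 0 by apply: (@lfun_neq0 _ _ f); rewrite gt_eqF.
split => //; exists (nz uv0) => //.
case: chartO => _ cvx _; apply: (convex_in_chartD (s := 1) (t := 1) cvx O1 O2).
- by rewrite mul1r w1u.
- by rewrite mul1r w2v.
- by rewrite /= w1u w2v !scale1r.
Qed.

(** Boundedness in an affine chart says that the linear form of the chart controls the
    norm on the cone; the inequality passes to the closure. *)
Lemma closure_bounded g : properly_convex_in_chart g Omega ->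
  exists2 B, 0 < B & forall v, K v -> `|v| <= B * `|lfun g v|.
Proof.
move=> [_ [Og _] [M [_ HM]]]; exists (`|M| + 1); first by rewrite ltr_wpDl.
pose S := [set v : V | `|v| - (`|M| + 1) * `|lfun g v| <= 0].
have cl : closed S.
  apply: (@closed_comp _ _ (fun v : V => `|v| - (`|M| + 1) * `|lfun g v|) [set x | x <= 0]);
    last exact: closed_le.
  move=> x _; apply: (@cvgB _ _ _ (nbhs x)); first exact: norm_continuous.
  apply: (@cvgM _ _ (nbhs x)); first exact: cvg_cst.
  by apply: cvg_norm; exact: lfun_continuous.
have OS : O `<=` S.
  move=> v [hv [w wv Ow]]; rewrite /S /= subr_le0.
  have gv : 0 < `|lfun g v| by rewrite normr_gt0 -wv; apply/affine_chart_pt; exact: Og.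
  have M1 : M < `|M| + 1 by rewrite (le_lt_trans (ler_norm M))// ltrDl.
  have := HM _ M1 (chart_coord g (pt w)) (ex_intro2 _ _ _ Ow erefl).
  by rewrite /= chart_coord_pt wv normrZ normfV mulrC ler_pdivrMr.
move=> v Kv; rewrite -subr_le0; have := closure_subset OS Kv.
by rewrite -((closure_id S).1 cl).
Qed.

Lemma chart_neq0 g v : properly_convex_in_chart g Omega -> K v -> v != 0 -> lfun g v != 0.
Proof.
move=> /closure_bounded[B B0 HB] /HB Bv; apply: contra_neq => gv.
by apply/eqP; rewrite -normr_le0 (le_trans Bv)// gv normr0 mulr0.
Qed.

Lemma K_height v : K v -> v != 0 -> 0 < h v.
Proof.
move=> Kv v0; rewrite lt_def (chart_neq0 chartO Kv v0).
apply: (@cvg_closed _ (within O (nbhs v)) (within_nbhs_proper Kv) _ h (h v) [set x | 0 <= x]).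
- exact: closed_ge.
- have nO : \forall u \near within O (nbhs v), O u by exact: withinT.
  by apply: filterS nO => u [/ltW].
- by apply: cvg_within_filter; exact: lfun_continuous.
Qed.

Lemma K_bounded : exists2 B, 0 < B & forall v, K v -> `|v| <= B * h v.
Proof.
have [B B0 HB] := closure_bounded chartO; exists B => // v Kv.
have [->|v0] := eqVneq v 0; first by rewrite normr0 lfun0 mulr0.
by have := HB _ Kv; rewrite gtr0_norm// K_height.
Qed.

Lemma KZ t u : 0 <= t -> K u -> K (t *: u).
Proof.
rewrite le_eqVlt => /orP[/eqP <- Ku|t0]; last first.
  apply: closure_map; first exact: scaler_continuous.
  by move=> y; exact: overZ.
rewrite scale0r; have [v Ov] := over_nonempty.
apply: (@cvg_closure _ (0 : R)^'+ _ _ (fun s : R => s *: v)).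
  by near=> s; apply: overZ => //; near: s; exact: nbhs_right_gt.
apply: cvg_at_right_filter; rewrite -(scale0r v).
by apply: (@cvgZr_tmp _ _ _ (nbhs (0 : R))); exact: cvg_id.
Unshelve. all: by end_near. Qed.

Lemma KD u v : K u -> K v -> K (u + v).
Proof.
move=> clu clv W Wuv.
have [[/= W1 W2] [W1x W2y] sW] := @add_continuous V (u, v) W Wuv.
have [u' [Ou Wu]] := clu _ W1x; have [v' [Ov Wv]] := clv _ W2y.
by exists (u' + v'); split; [exact: overD|exact: (sW (u', v'))].
Qed.

Lemma OKD u v : O u -> K v -> O (u + v).
Proof.
move=> Ou Kv.
have c : (fun x => u + v - x) @ v --> u.
  rewrite -[X in _ --> X](addrK v u).
  exact: (cvgB (cvg_cst (u + v)) (@cvg_id _ (nbhs v))).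
have n1 : \forall x \near v, O (u + v - x).
  by apply: (c O); apply: open_nbhs_nbhs; split => //; exact: over_open.
have [x [Ox Oux]] := Kv _ n1.
by rewrite -(subrK x (u + v)); exact: overD.
Qed.

Lemma slice_compactK : compact [set u : V | K u /\ h u = 1].
Proof.
have [B B0 HB] := K_bounded; apply: (@cV_bounded_compact _ _ _ B).
  rewrite (_ : [set u | _] = K `&` [set u | h u = 1]) //.
  apply: closedI; first exact: closed_closure.
  apply: (@closed_comp _ _ h [set x | x = 1]); last exact: closed_eq.
  by move=> x _; exact: lfun_continuous.
move=> v j [Kv hv]; apply: (le_trans (coord_le_norm v j)).
by have := HB _ Kv; rewrite hv mulr1.
Qed.

Lemma O0 : ~ O 0.
Proof. by move=> [+ _]; rewrite lfun0 ltxx. Qed.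

Definition domain_cone : proper_cone R d :=
  ProperCone (over_open oO) (@closed_closure _ O) (@subset_closure _ O) KD KZ OKD
    (fun t u t0 => overZ t0) (lfunD f) (lfunZ f) (@lfun_continuous R d f)
    K_height O0 slice_compactK.

Local Notation C := domain_cone.

(** Off the closed cone and its opposite there is an open set of vectors, whose
    projective points miss the domain. *)
Lemma closure_domain p : closure Omega p -> exists w, pt w = p /\ K (\val w).
Proof.
rewrite -(vecK p); set w := vec p => clp.
apply: contrapT => nw.
pose B : set V := [set v | ~ K v /\ ~ K (- v)].
have oB : open B.
  apply: openI; apply: closed_openC; first exact: closed_closure.
  apply: (@closed_comp _ _ (fun v : V => - v) K); last exact: closed_closure.
  by move=> x _; exact: opp_continuous.
have Bw : B (\val w).
  split => Kw; apply: nw; first by exists w.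
  have nw0 : - \val w != 0 by rewrite oppr_eq0 val_neq0.
  by exists (nz nw0); split => //; rewrite (@pt_scale _ _ w _ (-1)) // scaleN1r.
have [|q [Oq [w' w'q [nK nKN]]]] := clp [set p | exists2 w, pt w = p & B (\val w)].
  by apply: open_nbhs_nbhs; split; [exact: open_pt_image|exists w].
rewrite -w'q in Oq.
have hw' := over_chart Oq.
have [h0|h0] := ltP 0 (h (\val w')).
  by apply: nK; apply: subset_closure; exact/overP.
apply: nKN; apply: subset_closure; have nw0 : - \val w' != 0 by rewrite oppr_eq0 val_neq0.
split; first by rewrite lfunN oppr_gt0 lt_neqAle hw'.
by exists (nz nw0) => //; rewrite (@pt_scale _ _ w' _ (-1)) // scaleN1r.
Qed.

Lemma closure_domainP w : 0 < h (\val w) -> closure Omega (pt w) <-> K (\val w).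
Proof.
move=> hw; split; first exact: pt_closure_over.
exact: over_closure_pt.
Qed.

Definition rep (p : pspace R d) : V := chart_coord f p.

Lemma rep_spec p : closure Omega p -> exists w,
  [/\ pt w = p, \val w = rep p, K (rep p) & h (rep p) = 1].
Proof.
move=> /closure_domain[w [wp Kw]].
have hw := K_height Kw (val_neq0 w).
have E : rep p = (h (\val w))^-1 *: \val w by rewrite /rep -wp chart_coord_pt.
have r0 : rep p != 0 by rewrite E scaler_eq0 negb_or invr_eq0 gt_eqF//= val_neq0.
exists (nz r0); split => //.
- by rewrite (@pt_scale _ _ w _ (h (\val w))^-1).
- by rewrite E; apply: KZ => //; rewrite invr_ge0 ltW.
- by rewrite E lfunZ mulVf ?gt_eqF.
Qed.

Lemma over_rep A p : closure Omega p -> cone_over f A (rep p) <-> A p.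
Proof.
move=> /rep_spec[w [<- wE Kr hr]]; rewrite -wE; apply: overP.
by rewrite wE hr.
Qed.

Lemma rep_inj p q t : closure Omega p -> closure Omega q -> rep p = t *: rep q -> p = q.
Proof.
move=> /rep_spec[w [<- wE _ _]] /rep_spec[w' [<- wE' _ _]] E.
by apply: (@pt_scale _ _ w' w t); rewrite wE wE'.
Qed.

Lemma cone_over_K A : A `<=` closure Omega -> cone_over f A `<=` K.
Proof.
move=> AO v [hu [w wv Aw]]; rewrite -wv in hu *.
by apply/closure_domainP => //; exact: AO.
Qed.

Lemma closure_overP A v : A `<=` closure Omega -> v != 0 ->
  closure (cone_over f A) v <-> cone_over f (closure A) v.
Proof.
move=> AO v0; split=> [cl|[hv [w wv cl]]].
  have Kv : K v.
    have := closure_subset (cone_over_K AO) cl.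
    by rewrite -(closure_id K).1//; exact: closed_closure.
  split; first exact: K_height.
  by exists (nz v0) => //; exact: (@over_closure_pt _ _ f _ (nz v0)).
by rewrite -wv; apply: pt_closure_over => //; rewrite wv.
Qed.

Lemma boundaryE : boundary Omega = closure Omega `\` Omega.
Proof. by rewrite /boundary; move: oO => /interior_id ->. Qed.

Lemma ideal_boundaryP Y v : Y `<=` Omega ->
  cone_over f (ideal_boundary Omega Y) v <-> bd C (cone_over f Y) v.
Proof.
move=> YO; have YcO : Y `<=` closure Omega by move=> p /YO; exact: subset_closure.
split=> [[hv [w wv [clY]]]|[clY nO v0]].
  rewrite boundaryE => -[clO nO]; have v0 : v != 0 by rewrite -wv val_neq0.
  split => //; first by apply/closure_overP => //; split => //; exists w.
  by move=> [_ [w']]; rewrite -wv => /val_inj ->.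
have /closure_overP[//|//|hv [w wv clw]] := clY.
split => //; exists w => //; split => //; rewrite boundaryE; split.
  exact: (closure_subset YO).
by move=> Ow; apply: nO; split => //; exists w.
Qed.

(** Convexity of a subset of the closed domain in some chart is convexity in the chart of
    the domain: otherwise the two points would be joined through the hyperplane at
    infinity of the latter chart, by a point that is not in the closed domain. *)
Lemma proj_convexD Y u v : Y `<=` closure Omega -> proj_convex Y ->
  cone_over f Y u -> cone_over f Y v -> cone_over f Y (u + v).
Proof.
move=> YO [g g0 cY] [hu [w1 w1u Y1]] [hv [w2 w2v Y2]].
have huv : 0 < h (u + v) by rewrite lfunD addr_gt0.
have uv0 : u + v != 0 by apply: (@lfun_neq0 _ _ f); rewrite gt_eqF.
split => //; exists (nz uv0) => //.
have [Yg _] := cY.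
have g1 : lfun g u != 0 by rewrite -w1u; apply/affine_chart_pt; exact: Yg.
have g2 : lfun g v != 0 by rewrite -w2v; apply/affine_chart_pt; exact: Yg.
have [gg|gg] := ltP 0 (lfun g u * lfun g v).
  pose s := lfun g u; pose q := nz uv0.
  have sq : s *: (u + v) != 0 by rewrite scaler_eq0 negb_or g1.
  rewrite -(@pt_scale _ _ q (nz sq) s)//.
  apply: (convex_in_chartD (s := s) (t := s) cY Y1 Y2).
  - by rewrite w1u -expr2 lt_def sqr_ge0 sqrf_eq0 g1.
  - by rewrite w2v.
  - by rewrite /= w1u w2v scalerDr.
(* the combination [z] of the two points lies in [Y] and at infinity for [f] *)
exfalso; have {}gg : lfun g u * lfun g v < 0 by rewrite lt_neqAle mulf_neq0.
pose z := (lfun g u * h v) *: u - (lfun g u * h u) *: v.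
have gz : 0 < lfun g z.
  rewrite /z -scaleNr lfunD !lfunZ.
  have : 0 < lfun g u ^+ 2 by rewrite lt_def sqr_ge0 sqrf_eq0 g1.
  by rewrite expr2; nra.
have hz : h z = 0 by rewrite /z -scaleNr lfunD !lfunZ; ring.
have z0 : z != 0 by apply: (@lfun_neq0 _ _ g); rewrite gt_eqF.
have : Y (pt (nz z0)).
  apply: (convex_in_chartD (s := lfun g u * h v) (t := - (lfun g u * h u)) cY Y1 Y2).
  - rewrite w1u mulrAC -expr2 mulr_gt0// lt_def sqr_ge0 sqrf_eq0 g1//.
  - by rewrite w2v; nra.
  - by rewrite /= w1u w2v /z scaleNr.
move=> /YO /rep_spec[w [/eq_pt[c c0 wE] wr _ hr]].
by move: hr; rewrite -wr wE lfunZ /= hz mulr0 => /eqP; rewrite eq_sym oner_eq0.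
Qed.

Lemma over_cset Y : closed_in Omega Y -> proj_convex Y -> cset C (cone_over f Y).
Proof.
move=> [YO cY] cvY; split.
- exact: over_sub.
- by move=> u v; apply: proj_convexD => // p /YO; exact: subset_closure.
- by move=> t u; exact: overZ.
- move=> v [clv [hv [w wv Ow]]]; split => //; exists w => //; apply: cY; split => //.
  by apply: (@over_closure_pt _ _ f); rewrite wv.
Qed.

(** * Matrices that represent automorphisms *)

(** Of the two signs of a matrix that represents [g], the one that preserves the cone. *)
Definition lifts (A : 'M[R]_d) (g : PGL R d) := exists B : @invertible R d,
  [/\ \val B = A, pgl B = g & forall v, O v -> O (A *m v)].

(** The height of the image does not vanish on the cone, which is convex, so its sign is
    constant. *)
Lemma lift_exists g : Aut Omega g -> exists A, lifts A g.
Proof.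
move=> autg; pose B := mx g; have gB : pgl B = g := mxK g.
have hB v : O v -> h (\val B *m v) != 0.
  move=> [hv [w wv Ow]]; rewrite -wv; apply: (@over_chart (actGL B w)).
  by rewrite -actE gB -autg; exists (pt w).
have [v0 Ov0] := over_nonempty; set c := h (\val B *m v0).
have c0 : c != 0 by exact: hB.
have pos v : O v -> 0 < c * h (\val B *m v).
  move=> Ov; rewrite ltNge; apply/negP => neg.
  have {}neg : c * h (\val B *m v) < 0 by rewrite lt_neqAle neg mulf_neq0// hB.
  have Oz : O ((- (c * h (\val B *m v))) *: v0 + c ^+ 2 *: v).
    apply: overD; apply: overZ => //; first by rewrite oppr_gt0.
    by rewrite lt_def sqr_ge0 sqrf_eq0 c0.
  have := hB _ Oz; rewrite mulmxDr -!scalemxAr lfunD !lfunZ -/c => /eqP; apply; ring.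
have cB : c *: \val B \in @invertible R d.
  apply/mem_set; rewrite /invertible /= unitmxZ ?unitfE//.
  exact: (@set_valP _ (@invertible R d) B).
exists (c *: \val B), (SigSub cB); split => //.
  by rewrite -gB; apply/eq_pgl; exists c.
move=> v Ov; have hAv : 0 < h (c *: \val B *m v) by rewrite -scalemxAl lfunZ pos.
case: Ov => [hv [w wv Ow]]; split => //.
exists (actGL (SigSub cB) w); first by rewrite /= wv.
rewrite -actE (_ : pgl _ = g); last by rewrite -gB; apply/eq_pgl; exists c.
by rewrite -autg; exists (pt w).
Qed.

Lemma lift_unit A g : lifts A g -> A \in unitmx.
Proof. by move=> [B [<- _ _]]; exact: (@set_valP _ (@invertible R d) B). Qed.

Lemma lift_act A g w : lifts A g ->
  exists2 w', \val w' = A *m \val w & pt w' = act g (pt w).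
Proof. by move=> [B [<- <- _]]; exists (actGL B w) => //; rewrite actE. Qed.

Lemma lift_K A g v : lifts A g -> K v -> K (A *m v).
Proof.
move=> [B [_ _ AO]]; apply: closure_map; first exact: mulmx_continuous.
exact: AO.
Qed.

Lemma lift_preimage A g v p : lifts A g -> 0 < h v -> closure Omega p ->
  (exists2 w, \val w = v & pt w = act g p) ->
  exists2 c, 0 < c & A *m rep p = c *: v.
Proof.
move=> lA hv clp [w wv wp]; have [w1 [w1p w1r Kr hr]] := rep_spec clp.
have [w2 w2A w2p] := lift_act w1 lA.
have /eq_pt[c c0 E] : pt w2 = pt w by rewrite w2p w1p wp.
exists c; last by rewrite -wv -E w2A w1r.
have : 0 < h (A *m rep p).
  apply: K_height; first exact: lift_K lA Kr.
  by rewrite -w1r -w2A val_neq0.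
by rewrite -w1r -w2A E wv lfunZ pmulr_lgt0.
Qed.

Lemma lift_cone_aut A g : Aut Omega g -> lifts A g -> cone_aut C A.
Proof.
move=> autg lA; have uA := lift_unit lA.
have VO v : O v -> O (invmx A *m v).
  move=> [hv [w wv Ow]].
  have [q Oq qw] : (act g @` Omega) (pt w) by rewrite autg.
  have clq : closure Omega q by exact: subset_closure.
  have [|c c0 E] := lift_preimage lA hv clq; first by exists w.
  have -> : invmx A *m v = c^-1 *: rep q.
    by rewrite -[rep q](mulKmx uA) E -scalemxAr scalerA mulVf ?gt_eqF// scale1r.
  by apply: overZ; [rewrite invr_gt0|apply/over_rep].
split => //.
- by have [B [_ _]] := lA.
- by move=> v; exact: lift_K lA.
- by move=> v; apply: closure_map VO; exact: mulmx_continuous.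
Qed.

Lemma lift_over A g Y : lifts A g -> Y `<=` closure Omega ->
  cone_over f (act g @` Y) = mximg A (cone_over f Y).
Proof.
move=> lA YO; apply/seteqP; split=> [v [hv [w wv [p Yp pw]]]|_ [u [hu [w wu Yw]] <-]].
  have clp := YO _ Yp.
  have [|c c0 E] := lift_preimage lA hv clp; first by exists w.
  exists (c^-1 *: rep p); first by apply: overZ; [rewrite invr_gt0|apply/over_rep].
  by rewrite -scalemxAr E scalerA mulVf ?gt_eqF// scale1r.
have [w' w'A w'p] := lift_act w lA.
split; last by exists w'; [rewrite w'A wu|rewrite w'p; exists (pt w)].
rewrite -wu -w'A; apply: K_height; last exact: val_neq0.
rewrite w'A; apply: lift_K lA _; apply/closure_domainP; first by rewrite wu.
exact: YO.
Qed.

End DomainCone.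

Local Notation C := domain_cone.

Lemma rep_O p : Omega p -> O (rep p).
Proof. by move=> Op; apply/over_rep => //; exact: subset_closure. Qed.

Lemma rep_h p : closure Omega p -> lfun f (rep p) = 1.
Proof. by move=> /rep_spec[w []]. Qed.

Lemma rep_K p : closure Omega p -> K (rep p).
Proof. by move=> /rep_spec[w []]. Qed.

(** * Hilbert distance and comparability *)

(** The linear form of a chart does not vanish on the cone, which is convex. *)
Lemma chart_sign g : properly_convex_in_chart g Omega ->
  exists2 c : R, c != 0 & forall v, K v -> v != 0 -> 0 < c * lfun g v.
Proof.
move=> chartg.
have gK v := @chart_neq0 g v chartg.
have [v0 Ov0] := over_nonempty.
have Kv0 : K v0 by exact: subset_closure.
have v00 : v0 != 0 by apply: (@lfun_neq0 _ _ f); case: Ov0 => /lt0r_neq0.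
have c0 := gK _ Kv0 v00; exists (lfun g v0) => // v Kv v_n0.
rewrite ltNge; apply/negP => neg.
have {}neg : lfun g v0 * lfun g v < 0 by rewrite lt_neqAle neg mulf_neq0// gK.
have Oz : O ((- (lfun g v0 * lfun g v)) *: v0 + lfun g v0 ^+ 2 *: v).
  apply: OKD; first by apply: overZ => //; rewrite oppr_gt0.
  by apply: KZ => //; rewrite sqr_ge0.
have z0 : (- (lfun g v0 * lfun g v)) *: v0 + lfun g v0 ^+ 2 *: v != 0.
  by apply: (@lfun_neq0 _ _ f); case: Oz => /lt0r_neq0.
have := gK _ (subset_closure Oz) z0; rewrite lfunD !lfunZ => /eqP; apply; ring.
Qed.

Lemma chart_coord_rep g p : closure Omega p ->
  chart_coord g p = (lfun g (rep p))^-1 *: rep p.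
Proof.
by move=> /rep_spec[w [<- wr _ _]]; rewrite chart_coord_pt -wr.
Qed.

(** The cross-ratio that defines the distance depends only on the positions of the two
    points on the chord, as the common direction of the four points cancels; [hil_chord]
    expresses comparability by the same cross-ratio. The chart in the definition need not
    be [f], but its coordinates are proportional to the vectors of the cone by
    [chart_sign]. *)
Lemma hilbert_value_le p q r s : Omega p -> Omega q -> hilbert_value Omega p q r ->
  r <= s <-> hil C (expR (2 * s)) (rep p) (rep q).
Proof.
move=> Op Oq [g [a [b [chartg]]]]; rewrite boundaryE => -[cla na] [clb nb].
have clp : closure Omega p by exact: subset_closure.
have clq : closure Omega q by exact: subset_closure.
rewrite !chart_coord_rep//= => -[[s1 [t1 [s0 st t11 XE YE]]] ->].
have [c c0 cP] := chart_sign chartg.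
have nz0 x : closure Omega x -> rep x != 0.
  by move=> clx; apply: (@lfun_neq0 _ _ f); rewrite rep_h// oner_eq0.
pose mu x := (c * lfun g (rep x))^-1.
have mu0 x : closure Omega x -> 0 < mu x.
  by move=> clx; rewrite invr_gt0; apply: cP; [exact: rep_K|exact: nz0].
have muE x : (lfun g (rep x))^-1 *: rep x = c *: (mu x *: rep x).
  have -> : (lfun g (rep x))^-1 = c * mu x by rewrite /mu invfM mulrA divff // mul1r.
  by rewrite -scalerA.
move: XE YE; rewrite !muE; set X := mu p *: _; set A := mu a *: _; set B := mu b *: _;
  set Y := mu q *: _ => XE YE.
have XE' : X = A + s1 *: (B - A).
  apply: (scalerI c0); rewrite XE; mxring.
have YE' : Y = A + t1 *: (B - A).
  apply: (scalerI c0); rewrite YE; mxring.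
have OX : cint C X by apply: overZ; [exact: mu0|exact: rep_O].
have OY : cint C Y by apply: overZ; [exact: mu0|exact: rep_O].
have KA : ccl C A by apply: (@cclZ _ _ C); [exact/ltW/mu0|exact: rep_K].
have KB : ccl C B by apply: (@cclZ _ _ C); [exact/ltW/mu0|exact: rep_K].
have nA : ~ cint C A.
  by move=> /(cintZP C _ (mu0 _ cla)) /over_rep-/(_ cla).
have nB : ~ cint C B.
  by move=> /(cintZP C _ (mu0 _ clb)) /over_rep-/(_ clb).
have AB : 0 < `|B - A|.
  rewrite normr_gt0 subr_eq0; apply/eqP => E; apply: nA.
  by move: OX; rewrite XE' E subrr scaler0 addr0.
have s1n : 0 < 1 - s1 by lra.
have t1n : 0 < 1 - t1 by lra.
have c00 : 0 < `|c| by rewrite normr_gt0.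
have nX (k : R) (u v : V) : 0 < k -> u - v = k *: (B - A) \/ u - v = k *: (A - B) ->
    `|c *: u - c *: v| = `|c| * (k * `|B - A|).
  move=> k0 E; rewrite -scalerBr normrZ; case: E => ->.
    by rewrite normrZ (gtr0_norm k0).
  by rewrite normrZ (gtr0_norm k0) distrC.
have t10 : 0 < t1 by lra.
rewrite (nX (1 - s1)); [|done|by right; rewrite XE'; mxring].
rewrite (nX t1); [|done|by left; rewrite YE'; mxring].
rewrite (nX s1); [|done|by left; rewrite XE'; mxring].
rewrite (nX (1 - t1)); [|done|by right; rewrite YE'; mxring].
have -> : `|c| * ((1 - s1) * `|B - A|) * (`|c| * (t1 * `|B - A|)) /
  (`|c| * (s1 * `|B - A|) * (`|c| * ((1 - t1) * `|B - A|))) =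
  ((1 - s1) * t1) / (s1 * (1 - t1)).
  by field; rewrite !lt0r_neq0.
have Hc := @hil_chord _ _ C A B X Y s1 t1 (expR (2 * s)) KA KB nA nB OX OY s0 st t11.
have -> : hil C (expR (2 * s)) (rep p) (rep q) <-> hil C (expR (2 * s)) X Y.
  by apply: iff_sym; apply: iff_trans (hilZl C _ _ _ (mu0 _ clp)) (hilZr C _ _ _ (mu0 _ clq)).
rewrite Hc; [|by rewrite XE'; mxring|by rewrite YE'; mxring].
set Q := _ / _; have Q0 : 0 < Q by rewrite divr_gt0// mulr_gt0.
by rewrite -[X in _ <-> X <= _](lnK (_ : Q \is Num.pos)) ?posrE// ler_expR; split => ?; lra.
Qed.

Lemma hilbert_value_exists p q : Omega p -> Omega q -> p <> q ->
  exists r, hilbert_value Omega p q r.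
Proof.
move=> Op Oq pq.
have clp : closure Omega p by exact: subset_closure.
have clq : closure Omega q by exact: subset_closure.
have rpq : rep p <> rep q.
  by move=> E; apply: pq; apply: (rep_inj (t := 1)) => //; rewrite scale1r.
have [A [B [s [t [[KA KB nA nB] hA hB st [XE YE]]]]]] :=
  @chord_exists _ _ C _ _ (rep_O Op) (rep_O Oq) (rep_h clp) (rep_h clq) rpq.
have A0 : A != 0 by apply: (@height_neq0 _ _ C); rewrite hA.
have B0 : B != 0 by apply: (@height_neq0 _ _ C); rewrite hB.
have bnd w : K (\val w) -> ~ O (\val w) -> lfun f (\val w) = 1 -> boundary Omega (pt w).
  move=> Kw nw hw; rewrite boundaryE; split.
    by apply/(@closure_domainP w); rewrite ?hw.
  by move=> Ow; apply: nw; apply/overP; rewrite ?hw.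
eexists; exists f, (pt (nz A0)), (pt (nz B0)); split => //.
- exact: (bnd (nz A0)).
- exact: (bnd (nz B0)).
- rewrite (chart_coord_pt f (nz A0)) (chart_coord_pt f (nz B0)) /=.
  have -> : lfun f A = 1 by exact: hA.
  have -> : lfun f B = 1 by exact: hB.
  rewrite invr1 !scale1r; split; last by reflexivity.
  by exists s, t; case: st.
Qed.

Lemma hilbert_dist_le p q s : Omega p -> Omega q ->
  hilbert_dist Omega p q <= s <-> hil C (expR (2 * s)) (rep p) (rep q).
Proof.
move=> Op Oq; rewrite /hilbert_dist; case: eqP => [<-|pq].
  have Krp : ccl C (rep p) by apply: rep_K; exact: subset_closure.
  split=> [s0|].
    by apply: hil_refl => //; rewrite -expR0 ler_expR mulr_ge0.
  move=> /hil_ge1; rewrite -[X in X <= _]expR0 ler_expR => H.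
  have : 0 <= 2 * s by apply: H; exact: (cint_height (C := C) (rep_O Op)).
  by rewrite pmulr_rge0.
have [r Hr] := hilbert_value_exists Op Oq pq.
apply: hilbert_value_le => //; exact: (@xgetPex _ 0 _ (ex_intro _ r Hr)).
Qed.

Lemma cone_over_rep Y y : Y `<=` closure Omega -> cone_over f Y y ->
  exists q t, [/\ Y q, 0 < t & y = t *: rep q].
Proof.
move=> YO [hy [w wy Yw]]; exists (pt w), (lfun f y); split => //.
by rewrite /rep chart_coord_pt wy scalerA divff ?scale1r// gt_eqF.
Qed.

Lemma rep_cint p : Omega p -> cint C (rep p).
Proof. exact: rep_O. Qed.

Lemma rep_ccl p : Omega p -> ccl C (rep p).
Proof. by move=> /rep_cint; exact: cint_ccl. Qed.

Lemma dist_le_hil p q s : Omega p -> Omega q ->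
  dist p q <= s <-> hil C (expR (2 * s)) (rep p) (rep q).
Proof. exact: hilbert_dist_le. Qed.

Lemma hnbhdP Y r p : hnbhd Omega Y r p <-> Omega p /\ exists2 q, Y q & dist p q < r.
Proof.
split=> -[Op].
  by move=> /ereal_inf_lt[_ [q Yq <-]]; rewrite lte_fin => pq; split => //; exists q.
move=> [q Yq pq]; split => //; apply: (@le_lt_trans _ _ (dist p q)%:E); last by rewrite lte_fin.
by apply: ereal_inf_lbound; exists q.
Qed.

Lemma hnbhd_nb Y r p : Y `<=` Omega -> hnbhd Omega Y r p ->
  nb C (expR (2 * r)) (cone_over f Y) (rep p).
Proof.
move=> YO /hnbhdP[Op [q Yq pq]]; have Oq := YO _ Yq.
apply/(nbP C); first by move=> t u; exact: overZ.
exists (rep q); first by apply/over_rep => //; exact: subset_closure.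
by apply/dist_le_hil => //; exact: ltW.
Qed.

Lemma nb_hnbhd Y r s p : Y `<=` Omega -> Omega p -> s < r ->
  nb C (expR (2 * s)) (cone_over f Y) (rep p) -> hnbhd Omega Y r p.
Proof.
move=> YO Op sr /(nbP C); case; first by move=> t u; exact: overZ.
move=> y /cone_over_rep[|q [t [Yq t0 ->]]].
  by move=> q /YO; exact: subset_closure.
rewrite (hilZr C _ _ _ t0) => pq; apply/hnbhdP; split => //; exists q => //.
by apply: le_lt_trans sr; apply/dist_le_hil => //; exact: YO.
Qed.

Lemma hdiam_le (A : set (pspace R d)) (D : R) :
  (hdiam Omega A <= D%:E)%E <-> forall p q, A p -> A q -> dist p q <= D.
Proof.
split=> [H p q Ap Aq|H].
  rewrite -lee_fin; apply: le_trans H; apply: ereal_sup_ubound.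
  by exists p => //; exists q.
by apply: ge_ereal_sup => _ [p Ap [q Aq <-]]; rewrite lee_fin; exact: H.
Qed.

Lemma expR_ge_id (M : R) : M <= expR (2 * `|M|).
Proof.
apply: (@le_trans _ _ (1 + 2 * `|M|)); last exact: expR_ge1Dx.
by have := ler_norm M; have := normr_ge0 M; lra.
Qed.

Lemma unbounded_hil Y : Y `<=` Omega -> unbounded Omega Y <->
  forall M, exists u v, [/\ cone_over f Y u, cone_over f Y v & ~ hil C M u v].
Proof.
move=> YO.
have YcO : Y `<=` closure Omega by move=> p /YO; exact: subset_closure.
split=> [unb M|H]; last first.
  rewrite /unbounded; apply/eqP; rewrite -leye_eq leNgt; apply/negP => lt.
  have [D HD] : exists D : R, (hdiam Omega Y <= D%:E)%E.
    by case: (hdiam Omega Y) lt => [D _|//|_]; [exists D|exists 0; exact: leNye].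
  have [u [v [Yu Yv nuv]]] := H (expR (2 * D)); apply: nuv.
  have [p [s [Yp s0 ->]]] := cone_over_rep YcO Yu.
  have [q [t [Yq t0 ->]]] := cone_over_rep YcO Yv.
  apply/(hilZr C _ _ _ t0)/(hilZl C _ _ _ s0)/dist_le_hil; [exact: YO|exact: YO|].
  by move/hdiam_le: HD; exact.
apply: contrapT => bnd; have : (hdiam Omega Y <= (`|M|)%:E)%E.
  apply/hdiam_le => p q Yp Yq; have [Op Oq] := (YO _ Yp, YO _ Yq).
  apply/dist_le_hil => //; apply: (hil_le (expR_ge_id M)); first exact: rep_ccl.
  apply: contrapT => npq; apply: bnd; exists (rep p), (rep q); split => //.
    by apply/over_rep => //; exact: YcO.
  by apply/over_rep => //; exact: YcO.
by rewrite unb leye_eq.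
Qed.

Lemma hil_dist p q : Omega p -> Omega q -> hil C (expR (2 * dist p q)) (rep p) (rep q).
Proof. by move=> Op Oq; apply/dist_le_hil. Qed.

Lemma dist_lt_hil p q s : Omega p -> Omega q ->
  dist p q < s <-> exists2 M, M < expR (2 * s) & hil C M (rep p) (rep q).
Proof.
move=> Op Oq; split=> [pq|[M Ms Mpq]].
  by exists (expR (2 * dist p q)); [rewrite ltr_expR ltr_pM2l|exact: hil_dist].
have M0 : 0 < M := hil_gt0 (cint_height (rep_cint Op)) (cint_height (rep_cint Oq)) Mpq.
have lnE : expR (2 * (ln M / 2)) = M by rewrite mulrC divfK ?pnatr_eq0// lnK// posrE.
apply: (@le_lt_trans _ _ (ln M / 2)).
  by apply/(dist_le_hil _ Op Oq); rewrite lnE.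
by rewrite -(ltr_pM2l (ltr0n R 2)) -ltr_expR lnE.
Qed.

Lemma dist_triangle p q r : Omega p -> Omega q -> Omega r ->
  dist p r <= dist p q + dist q r.
Proof.
move=> Op Oq Or; apply/dist_le_hil => //.
rewrite mulrDr expRD; apply: hil_trans; [exact: expR_gt0| |]; exact: hil_dist.
Qed.

Lemma distxx p : dist p p = 0.
Proof. by rewrite /hilbert_dist eqxx. Qed.

(** * Hausdorff distances *)

(** Strict inequalities between suprema of infima are replaced by a uniform bound on
    distances to points. *)
Lemma hausdorff_distP A B e : (hausdorff_dist Omega A B < e%:E)%E <->
  exists2 e1, e1 < e & (forall a, A a -> exists2 b, B b & dist a b < e1) /\
    (forall b, B b -> exists2 a, A a & dist b a < e1).
Proof.
split=> [lt|[e1 e1e [HA HB]]]; last first.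
  apply: (@le_lt_trans _ _ e1%:E); last by rewrite lte_fin.
  rewrite /hausdorff_dist ge_max; apply/andP; split; apply: ge_ereal_sup => _ [x Ax <-].
    have [y By xy] := HA _ Ax; apply: (@le_trans _ _ (dist x y)%:E).
      by apply: ereal_inf_lbound; exists y.
    by rewrite lee_fin ltW.
  have [y By xy] := HB _ Ax; apply: (@le_trans _ _ (dist x y)%:E).
    by apply: ereal_inf_lbound; exists y.
  by rewrite lee_fin ltW.
have [e1 lt1 e1e] : exists2 e1, (hausdorff_dist Omega A B < e1%:E)%E & e1 < e.
  case: (hausdorff_dist Omega A B) lt => [r|//|_].
    rewrite lte_fin => re; exists ((r + e) / 2); last by lra.
    by rewrite lte_fin; lra.
  by exists (e - 1); [exact: ltNyr|lra].
exists e1 => //; move: lt1; rewrite /hausdorff_dist gt_max => /andP[lA lB].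
split=> [a Aa|b Bb].
  have : (hdist_set Omega a B < e1%:E)%E.
    by apply: le_lt_trans lA; apply: ereal_sup_ubound; exists a.
  by move=> /ereal_inf_lt[_ [b Bb <-]]; rewrite lte_fin; exists b.
have : (hdist_set Omega b A < e1%:E)%E.
  by apply: le_lt_trans lB; apply: ereal_sup_ubound; exists b.
by move=> /ereal_inf_lt[_ [a Aa <-]]; rewrite lte_fin; exists a.
Qed.

(** For normalized vectors the difference is controlled by the comparability constants,
    through heights. *)
Lemma nbhs_dist p (W : set V) : Omega p -> nbhs (rep p) W ->
  exists2 e, 0 < e & forall q, Omega q -> dist p q < e -> W (rep q).
Proof.
move=> Op; have [B B0 HB] := K_bounded.
rewrite -nbhs_ballE => -[r /= r0 rW].
have E0 : 0 < r / (4 * B) by rewrite divr_gt0// mulr_gt0.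
pose N := 1 + r / (4 * B); have N1 : 1 < N by rewrite /N ltrDl.
exists (ln N / 2); first by rewrite divr_gt0// ln_gt0.
move=> q Oq; rewrite dist_lt_hil// => -[M MN [a a0 [K1 K2]]].
have [clp clq] : closure Omega p /\ closure Omega q by split; exact: subset_closure.
have hp : height C (rep p) = 1 := rep_h clp.
have hq : height C (rep q) = 1 := rep_h clq.
have {}MN : M < N.
  by move: MN; rewrite mulrC divfK ?pnatr_eq0// lnK// posrE; lra.
have h1 : height C (a *: rep q - rep p) = a - 1 by rewrite heightB heightZ hp hq mulr1.
have h2 : height C (M *: rep p - a *: rep q) = M - a by rewrite heightB (@heightZ _ _ C M) (@heightZ _ _ C a) hp hq !mulr1.
have a1 : 0 <= a - 1 by rewrite -h1; exact: ccl_height.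
have aM : 0 <= M - a by rewrite -h2; exact: ccl_height.
apply: rW; rewrite -ball_normE /=.
have n1 := HB _ K1; change (lfun f (a *: rep q - rep p) = a - 1) in h1; rewrite h1 in n1.
have n2 : `|rep q| <= B by rewrite -[B]mulr1 -hq; apply: HB; exact: rep_K.
have -> : rep p - rep q = (a - 1) *: rep q - (a *: rep q - rep p).
  by move: (rep p) (rep q) => P Q; mxring.
apply: (le_lt_trans (ler_normB _ _)); rewrite normrZ ger0_norm//.
have n3 : (a - 1) * `|rep q| <= (a - 1) * B by exact: ler_wpM2l.
apply: (@le_lt_trans _ _ (2 * B * (a - 1))); first by lra.
apply: (@le_lt_trans _ _ (2 * B * (N - 1))).
  by rewrite ler_wpM2l// ?mulr_ge0// ?ltW//; lra.
have -> : 2 * B * (N - 1) = r / 2 by rewrite /N; field; exact: lt0r_neq0.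
lra.
Qed.

(** * The action on the convex core *)

Variable Gamma : set (PGL R d).
Hypothesis cc : convex_cocompact Omega Gamma.
Local Notation core := (core Omega Gamma).
Local Notation H := (cone_over f core).
Local Notation L := (limit_set Omega Gamma).

Lemma Gamma1 : Gamma 1%g.
Proof. by case: cc => -[/set_mem]. Qed.

Lemma GammaM g h : Gamma g -> Gamma h -> Gamma (g * h)%g.
Proof.
case: cc => gG _ _ _ _ Gg Gh; apply/set_mem.
by apply: (group_closedM gG); exact/mem_set.
Qed.

Lemma GammaV g : Gamma g -> Gamma g^-1%g.
Proof.
case: cc => gG _ _ _ _ Gg; apply/set_mem.
by apply: (group_closedV gG); exact/mem_set.
Qed.

Lemma GammaAut g : Gamma g -> act g @` Omega = Omega.
Proof. by case: cc => _ + _ _ _ => /[apply]. Qed.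

Lemma Gamma_Omega g p : Gamma g -> Omega p -> Omega (act g p).
Proof. by move=> /GammaAut gO Op; rewrite -gO; exists p. Qed.

Lemma Gamma_closure g p : Gamma g -> closure Omega p -> closure Omega (act g p).
Proof. by move=> /GammaAut gO Op; rewrite -gO; exact: act_closure. Qed.

Lemma Gamma_limit g y : Gamma g -> L y -> L (act g y).
Proof.
move=> Gg [+ [p Op clp]]; rewrite boundaryE => -[clO nO].
split; last first.
  exists p => //; have := act_closure (g := g) clp.
  apply: closure_subset => _ [_ [h Gh <-] <-].
  by exists (g * h)%g; [exact: GammaM|rewrite act_comp].
rewrite boundaryE; split; first exact: Gamma_closure.
by move=> /(Gamma_Omega (GammaV Gg)); rewrite actK.
Qed.

(** The group permutes the closed convex sets whose intersection is the core. *)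
Lemma Gamma_core g p : Gamma g -> core p -> core (act g p).
Proof.
move=> Gg [Op cp]; split; first exact: Gamma_Omega.
move=> Y [cY cvY LY YO]; apply: (cp (act g @^-1` Y)); split.
- by apply: closed_comp => // ? _; exact: act_continuous.
- exact: proj_convex_preimage.
- by move=> y Ly /=; apply: LY; exact: Gamma_limit.
- move=> q /= /YO /(Gamma_closure (GammaV Gg)); by rewrite actK.
Qed.

Lemma core_sub : core `<=` Omega.
Proof. by move=> p []. Qed.

Lemma core_cset : cset C (cone_over f core).
Proof.
split.
- exact: over_sub core_sub.
- move=> u v cu cv.
  have [/= huv [w wE Ow]] := overD (over_sub core_sub cu) (over_sub core_sub cv).
  split => //; exists w => //; split => // Y FY.
  have [_ cvY _ YO] := FY.
  have sY : cone_over f core `<=` cone_over f Y by apply: over_sub => p [_ /(_ Y FY)].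
  have [_ [w' w'E Yw']] := proj_convexD YO cvY (sY _ cu) (sY _ cv).
  by have -> : w = w' by apply: val_inj; rewrite /= wE w'E.
- by move=> t u; exact: overZ.
- move=> v [clv [hv [w wv Ow]]]; split => //; exists w => //; split => // Y FY.
  have [cY _ _ _] := FY; apply: cY.
  apply: closure_subset (_ : closure core (pt w)); first by move=> p [_ /(_ Y FY)].
  by apply: (@over_closure_pt _ _ f); rewrite wv.
Qed.

(** Every closed convex set that defines the core contains the segment from a point of
    the core to a limit point, hence so does the core. *)
Lemma limit_closure_core v : cone_over f L v -> closure (cone_over f core) v.
Proof.
move=> [hv [w wv Lw]]; case: cc => _ _ _ [c cc0] _.
have Oc := core_sub cc0.
have clc : closure Omega c by exact: subset_closure.
have clw : closure Omega (pt w) by case: Lw; rewrite boundaryE => -[].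
have Kv : K v by rewrite -wv; apply/closure_domainP; rewrite ?wv.
apply: (closure_ray (y := rep c) (A := cone_over f core)).
  by move=> t u; exact: overZ.
move=> s s0; have Os : O (rep c + s *: v).
  apply: OKD; first by apply: rep_O.
  exact: KZ.
have [/= hs [w' w'E Ow']] := Os; split => //; exists w' => //; split => // Y FY.
have [_ cvY LY YO] := FY.
have Yc : cone_over f Y (rep c).
  by apply/over_rep => //; case: cc0 => _ /(_ Y FY).
move: s0; rewrite le_eqVlt => /orP[/eqP s0|s0].
  move: w'E Yc; rewrite -s0 scale0r addr0 => w'E [_ [w'' w''E]].
  by have -> : w' = w'' by apply: val_inj; rewrite /= w'E w''E.
have Yv : cone_over f Y (s *: v).
  by apply: overZ => //; split => //; exists w => //; exact: LY.
have [_ [w'' w''E Yw']] := proj_convexD YO cvY Yc Yv.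
by have -> : w' = w'' by apply: val_inj; rewrite /= w'E w''E.
Qed.

(** All lifts that preserve the cone: a group of matrices that is stable under positive
    scaling. *)
Definition cone_group : set 'M[R]_d := [set A | exists2 g, Gamma g & lifts A g].

Local Notation G := cone_group.

Lemma group_lift g : Gamma g -> exists2 A, lifts A g & G A.
Proof.
move=> Gg; have [A lA] := lift_exists (GammaAut Gg).
by exists A => //; exists g.
Qed.

Lemma lift_scale A g t : 0 < t -> lifts A g -> lifts (t *: A) g.
Proof.
move=> t0 lA; have uA := lift_unit lA; case: lA => B [BA Bg AO].
have tA : t *: A \in @invertible R d.
  by apply/mem_set; rewrite /invertible /= unitmxZ// unitfE gt_eqF.
exists (SigSub tA); split => //.
  by rewrite -Bg; apply/eq_pgl; exists t; rewrite ?gt_eqF//= BA.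
by move=> v Ov; rewrite -scalemxAl; apply: overZ => //; exact: AO.
Qed.

Lemma liftM A B g h : lifts A g -> lifts B h ->
  lifts (A *m B) (g * h)%g.
Proof.
move=> [A' [<- <- AO]] [B' [<- <- BO]]; exists (mulGL A' B'); split => //.
  by rewrite -PGL_mulE.
by move=> v /BO/AO; rewrite mulmxA.
Qed.

Lemma liftV A g : Gamma g -> lifts A g -> lifts (invmx A) g^-1%g.
Proof.
move=> Gg lA; have cA := lift_cone_aut (GammaAut Gg) lA.
have [A' [A'A A'g _]] := lA; exists (invGL A'); split => //=.
- by rewrite A'A.
- by rewrite -A'g -PGL_invE.
- exact: (autVO cA).
Qed.

Lemma group_aut A : G A -> cone_aut C A.
Proof. by move=> [g Gg]; exact: lift_cone_aut (GammaAut Gg). Qed.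

Lemma groupZ t A : 0 < t -> G A -> G (t *: A).
Proof. by move=> t0 [g Gg lA]; exists g => //; exact: lift_scale. Qed.

Lemma group_inv A v : G A -> cone_over f core v -> cone_over f core (A *m v).
Proof.
move=> [g Gg lA] cv; have H := lift_over lA (Y := core).
have : mximg A (cone_over f core) (A *m v) by exists v.
rewrite -H; last by move=> p /core_sub; exact: subset_closure.
by apply: over_sub => _ [p cp <-]; exact: Gamma_core.
Qed.

Lemma orbit_relP (x y : core) : qpi (orbit_rel Gamma (C := core)) x = qpi (orbit_rel Gamma (C := core)) y <->
  orbit_rel Gamma x y.
Proof.
apply: eq_qpi_equiv => [z|a b [g Gg E]|a b c [g Gg E] [h Gh E']].
- by exists 1%g; [exact: Gamma1|rewrite act1].
- by exists g^-1%g; [exact: GammaV|rewrite -E actK].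
- by exists (h * g)%g; [exact: GammaM|rewrite act_comp E E'].
Qed.

Lemma act_coreP g (Gg : Gamma g) (x : core) : act g (\val x) \in core.
Proof. by apply/mem_set; apply: Gamma_core => //; exact: set_valP. Qed.

Definition act_core g (Gg : Gamma g) (x : core) : core := SigSub (act_coreP Gg x).

Lemma act_core_continuous g (Gg : Gamma g) : continuous (act_core Gg).
Proof.
move=> x W; rewrite nbhsE => -[W' [[B oB BW'] W'w] W'W].
have nB : nbhs (act g (\val x)) B.
  by apply: open_nbhs_nbhs; split => //; move: W'w; rewrite -BW'.
have := act_continuous nB; rewrite /= nbhsE => -[B' [oB' B'x] B'B].
rewrite nbhsE; exists [set y : core | B' (\val y)].
  by split => //; exists B'.
by move=> y /B'B By; apply: W'W; rewrite -BW'.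
Qed.

(** The projection to the quotient by the group is open. *)
Lemma orbit_nbhs (x : core) (W : set core) : open W -> W x ->
  nbhs (qpi (orbit_rel Gamma (C := core)) x) [set q | exists2 y, qpi (orbit_rel Gamma (C := core)) y = q & W y].
Proof.
move=> oW Wx; apply: open_nbhs_nbhs; split; last by exists x.
rewrite /open /=.
suff : open [set y : core | exists2 y', orbit_rel Gamma y' y & W y'].
  congr open; apply/seteqP; split=> y [y' yy' Wy']; exists y' => //.
    exact/orbit_relP.
  exact/orbit_relP.
rewrite openE => y [y' [g Gg E] Wy'].
have nW : nbhs (act_core (GammaV Gg) y) W.
  apply: open_nbhs_nbhs; split => //.
  suff -> : act_core (GammaV Gg) y = y' by [].
  by apply: val_inj; rewrite /= -E actK.
have nW' : nbhs y (act_core (GammaV Gg) @^-1` W) by exact: act_core_continuous.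
apply: filterS nW' => z /= Wz.
exists (act_core (GammaV Gg) z) => //.
by exists g => //=; rewrite actKV.
Qed.

(** In the compact quotient the family converges to the class of some point [c]. The
    projection being open, the points have translates in a bounded neighbourhood of [c],
    which converge after scaling; the scaling factors are put into the matrices. *)
Lemma group_cocompact (I : Type) (U : set_system I) (u : I -> V) : UltraFilter U ->
  (\forall i \near U, cone_over f core (u i)) ->
  exists (A : I -> 'M[R]_d) w,
    [/\ forall i, G (A i), cone_over f core w & A i *m u i @[i --> U] --> w].
Proof.
move=> UU Uu; have [_ _ _ [c0 core0] cpt] := cc.
have exx i : exists x : core, cone_over f core (u i) ->
    exists2 w : @nonzero R d, \val w = u i & pt w = \val x.
  have [[hu [w wu cw]]|nc] := pselect (cone_over f core (u i)); last first.
    by exists (SigSub (mem_set core0)).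
  by exists (SigSub (mem_set cw)) => _; exists w.
have /choice[x xP] := exx.
pose rl := orbit_rel Gamma (C := core).
have [q _ xq] := ultra_compact_cvg (u := fun i => qpi rl (x i)) cpt (filterE _ (fun=> Logic.I)).
pose c := qrepr q; have cq : qpi rl c = q := qreprK q.
have corec : core (\val c) := set_valP c.
have Oc : cint C (rep (\val c)) by apply: rep_cint; exact: core_sub.
have nc : nbhs (rep (\val c)) (hil C 2 (rep (\val c))).
  by apply: near_hil => //; lra.
move: nc; rewrite nbhsE => -[B [oB Bc] Bhil].
pose P := [set p : pspace R d | exists2 w, pt w = p & B (\val w)].
have oP : open P by exact: open_pt_image.
have nq : nbhs q [set q' | exists2 y, qpi rl y = q' & P (\val y)].
  rewrite -cq; apply: (@orbit_nbhs c [set y | P (\val y)]); first by exists P.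
  have clc : closure Omega (\val c) by apply: subset_closure; exact: core_sub.
  have [w [wc wr _ _]] := rep_spec clc.
  by exists w => //; rewrite wr.
have [A AP] : exists A : I -> 'M[R]_d, \forall i \near U,
    G (A i) /\ hil C 2 (rep (\val c)) (A i *m u i).
  apply: (near_choice (P := fun i A => G A /\ hil C 2 (rep (\val c)) (A *m u i))).
  have Uq : \forall i \near U, exists2 y, qpi rl y = qpi rl (x i) & P (\val y).
    by exact: (xq _ nq).
  apply: filterS2 Uq Uu => i [y yx [w wy Bw]] cu.
  have [w' w'u w'x] := xP i cu.
  have /orbit_relP[g Gg gy] : qpi rl (x i) = qpi rl y by rewrite yx.
  have [A lA GA] := group_lift Gg; exists A; split => //.
  have [w1 w1A w1p] := lift_act w' lA.
  have /eq_pt[t t0 wE] : pt w = pt w1 by rewrite w1p w'x gy wy.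
  have hilw := Bhil _ Bw.
  have Ow : O (\val w) := hil_cint Oc hilw.
  have Ow1 : O (A *m u i).
    by apply: (over_sub core_sub); exact: group_inv.
  have t_gt0 : 0 < t.
    have := cint_height (C := C) Ow; rewrite /= wE w1A w'u lfunZ.
    by rewrite pmulr_lgt0//; exact: (cint_height (C := C) Ow1).
  by move: hilw; rewrite wE w1A w'u hilZr.
pose s i := (lfun f (A i *m u i))^-1.
pose A' i := if `[< G (A i) /\ 0 < s i >] then s i *: A i else 1%:M.
have G1 : G 1%:M.
  exists 1%g; first exact: Gamma1.
  exists (SigSub (invertible1 R d)); split => //.
  by move=> v; rewrite mul1mx.
have GA' i : G (A' i).
  by rewrite /A'; case: asboolP => // -[GA s0]; exact: groupZ.
have Os : \forall i \near U, [/\ O (A i *m u i), 0 < s i & A' i *m u i = s i *: (A i *m u i)].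
  apply: filterS AP => i [GAi Hi].
  have Oi : O (A i *m u i) := hil_cint Oc Hi.
  have si : 0 < s i by rewrite invr_gt0; exact: (cint_height (C := C) Oi).
  split => //; rewrite /A' (asboolT (conj GAi si)).
  by rewrite -scalemxAl.
have [w [Kw hw cw]] : exists w, [/\ ccl C w, height C w = 1 &
    A' i *m u i @[i --> U] --> w].
  apply: ultra_slice_cvg; apply: filterS Os => i [Oi si ->]; split.
    by apply: cclZ; [exact: ltW|exact: (cint_ccl (p := C) Oi)].
  rewrite heightZ /s mulVf// gt_eqF//; exact: (cint_height (C := C) Oi).
have Ow : cint C w.
  apply: (hil_cint Oc (M := 2)).
  apply: (hil_cvg _ (cvg_cst _) cw) => //; last by rewrite hw.
    apply: filterS2 AP Os => i [_ Hi] [_ si ->].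
    by rewrite hilZr.
  exact: cint_height.
exists A', w; split => //.
apply: (cset_closed core_cset); split => //.
apply: cvg_closure cw; apply: filterS Uu => i; exact: group_inv.
Qed.

Lemma group_limit (I : Type) (U : set_system I) (A : I -> 'M[R]_d)
    (t : I -> R) (p y : V) :
  UltraFilter U -> cint C p -> (forall i, G (A i)) ->
  (\forall i \near U, 0 < t i) ->
  t i *: (A i *m p) @[i --> U] --> y -> y != 0 -> ~ cint C y ->
  cone_over f L y.
Proof.
move=> UU Op GA t0 cy y0 nO; have [hp [w wp Ow]] := Op.
pose orb := [set act g (pt w) | g in Gamma].
have orbO : orb `<=` Omega by move=> _ [g Gg <-]; exact: Gamma_Omega.
have near_orb : \forall i \near U, cone_over f orb (t i *: (A i *m p)).
  apply: filterS t0 => i ti; apply: overZ => //; have [g Gg lA] := GA i.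
  have [w' w'A w'p] := lift_act w lA.
  have Oi : cint C (A i *m p) by exact: (autO (group_aut (GA i))).
  split; first exact: (cint_height Oi).
  by exists w'; [rewrite w'A wp|rewrite w'p; exists g].
have cl : closure (cone_over f orb) y by exact: cvg_closure cy.
have Ky : K y by move: cl; apply: closure_subset; exact: over_sub.
have hy : 0 < lfun f y by exact: K_height.
have clorb : closure orb (pt (nz y0)) by exact: (@over_closure_pt _ _ f orb (nz y0)).
split => //; exists (nz y0) => //; split; last by exists (pt w).
rewrite boundaryE; split; first by move: clorb; exact: closure_subset.
by move=> Oy; apply: nO; apply/(@overP _ _ f Omega (nz y0)).
Qed.

Lemma core_action : cocompact_action C G (cone_over f core).
Proof.
split.
- exact: group_aut.
- by move=> A [g Gg lA]; exists g^-1%g; [exact: GammaV|exact: liftV].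
- by move=> A B [g Gg lA] [h Gh lB]; exists (g * h)%g; [exact: GammaM|exact: liftM].
- exact: core_cset.
- exact: group_inv.
- exact: group_cocompact.
- move=> I U A t p y UU Op GA t0 cy y0 nO; apply: limit_closure_core.
  exact: group_limit cy y0 nO.
Qed.

(** * Families of convex subsets of the core *)

Variable X : set (set (pspace R d)).
Hypotheses (invX : invariant_family Gamma X) (cvX : convex_family Omega core X).

Definition cone_family : set (set V) := [set cone_over f Y | Y in X].

Lemma member_sub Y : X Y -> Y `<=` Omega.
Proof. by move=> /cvX[Yc _ _ _] p /Yc/core_sub. Qed.

Lemma family_act g Y : Gamma g -> X Y -> X (act g @` Y).
Proof. by move=> Gg XY; rewrite -invX; exists g => //; exists Y. Qed.

Lemma core_family : invariant_cfamily C G (cone_over f core) cone_family.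
Proof.
split.
- by move=> _ [Y /cvX[_ cY _ pY] <-]; exact: over_cset.
- by move=> _ [Y /cvX[Yc _ _ _] <-]; exact: over_sub.
- move=> _ [Y XY <-]; have [_ _ ub _] := cvX XY.
  by apply/(unbounded_hil) => //; exact: member_sub.
- move=> A _ [Y XY <-] [g Gg lA].
  rewrite -(lift_over lA); last first.
    by move=> p /(member_sub XY); exact: subset_closure.
  by exists (act g @` Y) => //; exact: family_act.
Qed.


Local Notation XC := cone_family.
Local Notation FX := core_family.
Local Notation GH := core_action.

Lemma member_sub_closure Y : X Y -> Y `<=` closure Omega.
Proof. by move=> XY p /(member_sub XY); exact: subset_closure. Qed.

Lemma member_cset Y : X Y -> cset C (cone_over f Y).
Proof. by move=> /cvX[_ cY _ pY]; exact: over_cset. Qed.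

Lemma cone_over_inj Y1 Y2 : Y1 `<=` closure Omega -> Y2 `<=` closure Omega ->
  cone_over f Y1 = cone_over f Y2 -> Y1 = Y2.
Proof.
move=> Y1O Y2O E; apply/seteqP; split=> p Yp.
  by apply/over_rep; [exact: Y1O|rewrite -E; apply/over_rep => //; exact: Y1O].
by apply/over_rep; [exact: Y2O|rewrite E; apply/over_rep => //; exact: Y2O].
Qed.

Lemma ideal_boundary_rep Y p : Y `<=` Omega ->
  ideal_boundary Omega Y p <-> closure Omega p /\ bd C (cone_over f Y) (rep p).
Proof.
move=> YO; split=> [Yp|[clp]].
  have clp : closure Omega p by case: Yp => _; rewrite boundaryE => -[].
  split => //; apply/(ideal_boundaryP _ YO).
  by apply/over_rep.
move=> /(ideal_boundaryP _ YO).
by move/(over_rep _ clp).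
Qed.

Lemma disjoint_bdP : (forall X1 X2, X X1 -> X X2 -> X1 <> X2 ->
    ideal_boundary Omega X1 `&` ideal_boundary Omega X2 = set0) <->
  disjoint_bd C XC.
Proof.
split=> [dis _ _ x [Y1 X1 <-] [Y2 X2 <-] b1 b2|dis Y1 Y2 X1 X2 n12].
  apply: contrapT => n12; have {}n12 : Y1 <> Y2 by move=> E; apply: n12; rewrite E.
  have {}b1 := (ideal_boundaryP x (member_sub X1)).2 b1.
  have {}b2 := (ideal_boundaryP x (member_sub X2)).2 b2.
  case: b1 => hx [w wx Y1w]; case: b2 => _ [w' + Y2w].
  rewrite -wx => /val_inj E; rewrite E in Y2w.
  by have := dis _ _ X1 X2 n12; rewrite -subset0 => /(_ (pt w)); apply.
rewrite -subset0 => p [].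
move=> /(ideal_boundary_rep _ (member_sub X1))[clp b1].
move=> /(ideal_boundary_rep _ (member_sub X2))[_ b2]; apply: n12.
apply: cone_over_inj; [exact: member_sub_closure|exact: member_sub_closure|].
by apply: (dis _ _ _ _ _ b1 b2); [exists Y1|exists Y2].
Qed.

Lemma bounded_overlapP : (forall r : R, 0 < r -> exists2 D1 : R, 0 < D1 &
    forall X1 X2, X X1 -> X X2 -> X1 <> X2 ->
      (hdiam Omega (hnbhd Omega X1 r `&` hnbhd Omega X2 r) <= D1%:E)%E) <->
  bounded_overlap C XC.
Proof.
split=> [ov M M0|ov r r0].
  have [|D1 D10 HD] := ov (`|M| + 1); first by rewrite ltr_wpDl.
  exists (expR (2 * D1)) => _ _ [Y1 X1 <-] [Y2 X2 <-] n12 u v u1 u2 v1 v2.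
  have {}n12 : Y1 <> Y2 by move=> E; apply: n12; rewrite E.
  have cY := member_cset.
  have main Y w : X Y -> nb C M (cone_over f Y) w -> forall p t, 0 < t -> Omega p ->
      w = t *: rep p -> hnbhd Omega Y (`|M| + 1) p.
    move=> XY nw p t t0 Op wE; have M1 : `|M| < `|M| + 1 by rewrite ltrDl.
    apply: (nb_hnbhd (member_sub XY) Op M1).
    apply: (nb_le (csetO (cY _ XY)) M0); first exact: expR_ge_id.
    have -> : rep p = t^-1 *: w by rewrite wE scalerA mulVf ?scale1r// gt_eqF.
    by apply: nbZ; [exact: cY|rewrite invr_gt0|].
  have Ou : O u := nbO (csetO (cY _ X1)) M0 u1.
  have Ov : O v := nbO (csetO (cY _ X1)) M0 v1.
  have OcO : Omega `<=` closure Omega by exact: subset_closure.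
  have [p [s [Op s0 uE]]] := cone_over_rep OcO Ou.
  have [q [t [Oq t0 vE]]] := cone_over_rep OcO Ov.
  rewrite uE vE; apply/(hilZr C _ _ _ t0)/(hilZl C _ _ _ s0)/dist_le_hil => //.
  apply: ((hdiam_le _ _).1 (HD _ _ X1 X2 n12)).
    by split; [exact: main u1 _ _ s0 Op uE|exact: main u2 _ _ s0 Op uE].
  by split; [exact: main v1 _ _ t0 Oq vE|exact: main v2 _ _ t0 Oq vE].
have [|D HD] := ov (expR (2 * r)); first exact: expR_gt0.
exists (`|D| + 1) => [|Y1 Y2 X1 X2 n12]; first by rewrite ltr_wpDl.
apply/hdiam_le => p q [p1 p2] [q1 q2].
have Op : Omega p by case/hnbhdP: p1.
have Oq : Omega q by case/hnbhdP: q1.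
apply: (@le_trans _ _ `|D|); last by rewrite lerDl.
apply/dist_le_hil => //.
apply: (hil_le (expR_ge_id D)); first exact: rep_ccl.
apply: (HD (cone_over f Y1) (cone_over f Y2)).
- by exists Y1.
- by exists Y2.
- by move=> E; apply: n12; apply: cone_over_inj E; exact: member_sub_closure.
- by apply: hnbhd_nb => //; exact: member_sub X1.
- by apply: hnbhd_nb => //; exact: member_sub X2.
- by apply: hnbhd_nb => //; exact: member_sub X1.
- by apply: hnbhd_nb => //; exact: member_sub X2.
Qed.

(** * Segments *)

Lemma rep_independent p q s t : closure Omega p -> closure Omega q -> p <> q ->
  s *: rep p = t *: rep q -> s = 0 /\ t = 0.
Proof.
move=> clp clq npq E.
have st : s = t.
  have := congr1 (lfun f) E; rewrite (lfunZ _ s) (lfunZ _ t) !rep_h//.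
  by rewrite !mulr1.
rewrite -st in E *; split; apply/eqP; apply: contrapT => /negP s0; apply: npq.
  by apply: (rep_inj (t := 1)) => //; rewrite scale1r; apply: (scalerI s0).
by apply: (rep_inj (t := 1)) => //; rewrite scale1r; apply: (scalerI s0).
Qed.

(** A coordinate on the line takes opposite values at [p] and [q], so by connectedness
    it vanishes somewhere on the segment. *)
Lemma segment_midpoint l p q : line_segment l -> l `<=` closure Omega ->
  l p -> l q -> p <> q -> (forall w, l w -> exists a b, rep w = a *: rep p + b *: rep q) /\
  exists2 w, l w & rep w = 2^-1 *: (rep p + rep q).
Proof.
move=> [conn [x0 [y0 [_ lxy]]]] lO lp lq npq.
have ind := rep_independent (lO _ lp) (lO _ lq) npq.
set u := \val (vec x0); set v := \val (vec y0).
have coord w : l w -> exists a b, rep w = a *: u + b *: v.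
  move=> lw; have [a [b E]] := lxy _ lw.
  exists ((lform f w)^-1 * a), ((lform f w)^-1 * b).
  by rewrite /rep /chart_coord E scalerDr !scalerA.
have [a1 [a2 pE]] := coord _ lp; have [b1 [b2 qE]] := coord _ lq.
have det0 : a1 * b2 - a2 * b1 != 0.
  apply/eqP => det.
  have [|b20 /esym/eqP a20] := ind b2 a2.
    rewrite pE qE; have -> : b2 *: (a1 *: u + a2 *: v) =
      a2 *: (b1 *: u + b2 *: v) + (a1 * b2 - a2 * b1) *: u by mxring.
    by rewrite det scale0r addr0.
  have [|b10 a10] := ind b1 a1.
    rewrite pE qE; have -> : b1 *: (a1 *: u + a2 *: v) =
      a1 *: (b1 *: u + b2 *: v) - (a1 * b2 - a2 * b1) *: v by mxring.
    by rewrite det scale0r subr0.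
  have := rep_h (lO _ lq); rewrite qE b10 b20 !scale0r addr0 lfun0.
  by move=> /eqP; rewrite eq_sym oner_eq0.
have comb w : l w -> exists a b, rep w = a *: rep p + b *: rep q.
  move=> lw; have [c1 [c2 ->]] := coord _ lw; rewrite pE qE.
  exists ((c1 * b2 - c2 * b1) / (a1 * b2 - a2 * b1)), ((a1 * c2 - a2 * c1) / (a1 * b2 - a2 * b1)).
  by mxfield.
split => //.
have [i [j D0]] := minor_neq0 ind; set D := _ - _ in D0.
pose psi (c : V) := c i 0 * (rep p j 0 + rep q j 0) - c j 0 * (rep p i 0 + rep q i 0).
have psiE a b : psi (a *: rep p + b *: rep q) = (a - b) * D.
  by rewrite /psi /D !linmxE; ring.
have cpsi : continuous psi.
  move=> c; apply: (@cvgB _ _ _ (nbhs c)); apply: (@cvgM _ _ (nbhs c));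
    by [exact: coord_continuous|exact: cvg_cst].
have connI : connected [set psi (rep w) | w in l].
  apply: connected_continuous_connected => //.
  apply: continuous_in_subspaceT => w /set_mem lw.
  apply: continuous_comp; last exact: cpsi.
  apply: chart_coord_continuous.
  have [w' [<- w'r _ hr]] := rep_spec (lO _ lw).
  by apply/affine_chart_pt; rewrite w'r hr oner_eq0.
have psip : psi (rep p) = D.
  by rewrite -[rep p]addr0 -(scale0r (rep q)) -[rep p]scale1r psiE subr0 mul1r.
have psiq : psi (rep q) = - D.
  by rewrite -[rep q]add0r -(scale0r (rep p)) -[rep q]scale1r psiE sub0r mulN1r.
have [w lw w0] : [set psi (rep w) | w in l] 0.
  have [D1|D1] := leP 0 D.
    apply: ((connected_intervalP _).1 connI (- D) D).
    - by exists q.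
    - by exists p.
    - by rewrite D1 oppr_le0 D1.
  apply: ((connected_intervalP _).1 connI D (- D)).
  - by exists p.
  - by exists q.
  - by rewrite oppr_ge0 (ltW D1).
exists w => //; have [a [b E]] := comb _ lw.
move: w0; rewrite E psiE => /eqP; rewrite mulf_eq0 (negPf D0) orbF subr_eq0 => /eqP ab.
have := rep_h (lO _ lw).
rewrite E lfunD (lfunZ _ a) (lfunZ _ b) (rep_h (lO _ lp)) (rep_h (lO _ lq)).
move=> ab1; have bE : b = 2^-1 by lra.
by rewrite ab bE scalerDr.
Qed.

(** The curve [x + `|t| *: y] is a segment that reaches the endpoint [y] only in the
    limit, which suffices since ideal boundaries are closed. *)
Lemma segments_inP : (forall l, nontrivial_segment l ->
     l `<=` ideal_boundary Omega core ->
     exists2 Y, X Y & l `<=` ideal_boundary Omega Y) -> segments_in C H XC.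
Proof.
move=> seg x y bx by_ bxy nprop.
have cH : cset C H := core_cset.
have HO := csetO cH.
have hx : 0 < lfun f x := bd_height HO bx.
have hy : 0 < lfun f y := bd_height HO by_.
have [clx _ x0] := bx; have [cly _ y0] := by_; have [_ nxy xy0] := bxy.
have Kx : ccl C x := closure_ccl HO clx.
have Ky : ccl C y := closure_ccl HO cly.
have hc (t : R) : 0 < lfun f (x + `|t| *: y).
  by rewrite lfunD lfunZ ltr_wpDr// mulr_ge0// ltW.
have cn (t : R) : x + `|t| *: y != 0 by apply: (@lfun_neq0 _ _ f); rewrite gt_eqF.
have bdt (t : R) : bd C H (x + `|t| *: y).
  split => //.
    have [->|t0] := eqVneq t 0; first by rewrite normr0 scale0r addr0.
    apply: (cset_closureD cH) => //; apply: (cset_closureZ cH) => //.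
    by rewrite normr_gt0.
  move=> Oxt; apply: nxy; have t1 : 0 < 1 + `|t| by rewrite ltr_wpDr.
  apply/(cintZP C _ t1).
  have -> : (1 + `|t|) *: (x + y) = (x + `|t| *: y) + (`|t| *: x + y) by mxring.
  by apply: cintD => //; apply: cclD => //; exact: cclZ.
pose ga t := pt (nz (cn t)).
have cga : continuous ga.
  apply: curve_continuous => t; apply: (@cvgD _ _ _ (nbhs t)); first exact: cvg_cst.
  apply: (@cvgZr_tmp _ _ _ (nbhs t)); exact: norm_continuous.
have [ga01 gal] : pt (nz x0) <> pt (nz y0) /\ forall t, proj_line (pt (nz x0)) (pt (nz y0)) (ga t).
  split.
    move=> /eq_pt[c c0 /= xE]; apply: (nprop c^-1); last by rewrite xE scalerA mulVf// scale1r.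
    by rewrite invr_gt0; move: hx; rewrite xE lfunZ pmulr_lgt0.
  move=> t; have [a a0 aE] := vec_pt (nz x0); have [b b0 bE] := vec_pt (nz y0).
  have [c c0 cE] := vec_pt (nz (cn t)).
  exists (c / a), (c * `|t| / b); rewrite -/(ga t) in cE; rewrite /ga cE aE bE /=.
  by mxfield; rewrite a0 b0.
have [|_ [t _ <-]|Y XY lY] := seg (range ga).
- split; last first.
    exists (ga 0), (ga 1); split; [by exists 0|by exists 1|].
    move=> /eq_pt[c c0 /=]; rewrite normr0 normr1 scale0r scale1r addr0 => E.
    have cnz : c != 1.
      by apply/eqP => c1; move: E; rewrite c1 scale1r => /eqP; rewrite -subr_eq0 opprD addNKr oppr_eq0 (negPf y0).
    have hE := congr1 (lfun f) E; rewrite lfunZ lfunD in hE.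
    have c_gt0 : 0 < c by rewrite -(pmulr_lgt0 _ (_ : 0 < lfun f x + lfun f y)) ?addr_gt0// -hE.
    have c_lt1 : c < 1 by nra.
    apply: (nprop ((1 - c) / c)); first by rewrite divr_gt0// subr_gt0.
    have -> : (1 - c) / c *: x = c^-1 *: (x - c *: x) by mxfield.
    have -> : x - c *: x = c *: y by rewrite {1}E; mxring.
    by rewrite scalerA mulVf// scale1r.
  split.
    apply: connected_continuous_connected; last exact: continuous_subspaceT.
    by apply/connected_intervalP.
  by exists (pt (nz x0)), (pt (nz y0)); split => // _ [t _ <-].
- have : cone_over f (ideal_boundary Omega core) (x + `|t| *: y).
    by apply/(ideal_boundaryP _ core_sub).
  by move=> [_ [w wE]]; have -> : w = nz (cn t) by exact: val_inj.
have clt (t : R) : closure (cone_over f Y) (x + `|t| *: y).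
  have : bd C (cone_over f Y) (x + `|t| *: y); last by case.
  apply/(ideal_boundaryP _ (member_sub XY)); split => //.
  by exists (nz (cn t)) => //; apply: lY; exists t.
exists (cone_over f Y); first by exists Y.
have cY : cset C (cone_over f Y) by exact: member_cset XY.
split; first by have := clt 0; rewrite normr0 scale0r addr0.
rewrite (closure_id (closure _)).1; last exact: closed_closure.
apply: (closure_ray (y := x)); first by move=> t u t0; exact: (cset_closureZ cY).
by move=> s s0; have := clt s; rewrite ger0_norm.
Qed.

(** The segment lies in the closure of the face of its midpoint: each of its points is a
    limit of interior points of a segment through the midpoint. *)
Lemma segments_of_faces : (forall (x y0 : V) M, bd C H x -> hil C M x y0 ->
    (forall t, 0 < t -> y0 <> t *: x) ->
    exists2 Y, XC Y & forall (y : V) N, hil C N x y -> closure Y y) ->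
  forall l, nontrivial_segment l -> l `<=` ideal_boundary Omega core ->
    exists2 Y, X Y & l `<=` ideal_boundary Omega Y.
Proof.
move=> fc l [seg [p [q [lp lq npq]]]] lH.
have lO w : l w -> closure Omega w /\ bd C H (rep w).
  by move=> /lH /(ideal_boundary_rep _ core_sub).
have lcl : l `<=` closure Omega by move=> w /lO[].
have [comb [m lm mE]] := segment_midpoint seg lcl lp lq npq.
have bm := (lO _ lm).2; have Km : ccl C (rep m) := rep_K (lcl _ lm).
have KR w : l w -> ccl C (rep w) by move=> lw; exact: (rep_K (lcl _ lw)).
have up w : l w -> exists M, ccl C (M *: rep m - rep w).
  move=> lw; have [a [b E]] := comb _ lw; exists (2 * (`|a| + `|b|)).
  have -> : (2 * (`|a| + `|b|)) *: rep m - rep w =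
      (`|a| + `|b| - a) *: rep p + (`|a| + `|b| - b) *: rep q.
    by rewrite E mE; move: (rep p) (rep q) => P Q; mxfield.
  have := ler_norm a; have := ler_norm b; have := normr_ge0 a; have := normr_ge0 b => b0 a0 b1 a1.
  by apply: cclD; apply: cclZ; try exact: KR; lra.
have hilm w s : l w -> 0 <= s -> exists N, hil C N (rep m) (rep m + s *: rep w).
  move=> lw s0; have [M KM] := up _ lw; exists (1 + s * M); exists 1; first exact: ltr01.
  split.
    by have -> : 1 *: (rep m + s *: rep w) - rep m = s *: rep w; [mxring|exact: cclZ (KR _ lw)].
  have -> : (1 + s * M) *: rep m - 1 *: (rep m + s *: rep w) = s *: (M *: rep m - rep w) by mxring.
  exact: cclZ.
have [N HN] := hilm p 1 lp ler01.
have [|_ [Y XY <-] HY] := fc _ _ _ bm HN.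
  move=> t t0 E; have [] := rep_independent (lcl _ lp) (lcl _ lq) npq (s := (1 - t) / 2 + 1) (t := (t - 1) / 2).
    have : rep m + 1 *: rep p - t *: rep m = 0 by rewrite E subrr.
    rewrite mE => E'; apply/eqP; rewrite -subr_eq0 -E'; apply/eqP.
    by move: (rep p) (rep q) => P Q; mxfield.
  move=> t1 t2; have : (1 - t) / 2 + 1 + (t - 1) / 2 = 0 by rewrite t1 t2 addr0.
  by rewrite addrAC -mulrDl addrA subrK subrr mul0r add0r => /eqP; rewrite oner_eq0.
exists Y => // w lw.
apply/(ideal_boundary_rep _ (member_sub XY)).
have [clw [_ nO w0]] := lO _ lw; split; first exact: clw.
split; [|exact: nO|exact: w0].
have cY : cset C (cone_over f Y) by exact: member_cset XY.
rewrite (closure_id (closure _)).1; last exact: closed_closure.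
apply: (closure_ray (y := rep m)); first by move=> t u t0; exact: (cset_closureZ cY).
by move=> s s0; have [N' HN'] := hilm w s lw s0; exact: HY HN'.
Qed.

(** * Simplices *)

(** A properly embedded triangle has independent vertices, so it is a simplex. *)
Lemma triangle_simplex (a b c : V) : O (a + b + c) ->
  (forall s t : R, 0 <= s -> 0 <= t ->
    [/\ ~ cint C (s *: a + t *: b), ~ cint C (s *: b + t *: c) & ~ cint C (s *: a + t *: c)]) ->
  exists2 S, simplex 2 S & forall p, S p <->
    exists (w : @nonzero R d) (r s t : R),
      [/\ 0 < r, 0 < s & 0 < t] /\ pt w = p /\ \val w = r *: a + s *: b + t *: c.
Proof.
move=> Oabc sides.
pose bb (i : 'I_3) : V := [eta (fun=> c) with 0 |-> a, 1 |-> b] i.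
have sumE (e : 'I_3 -> R) : \sum_i e i *: bb i = e 0 *: a + e 1 *: b + e 2%:R *: c.
  rewrite !big_ord_recl big_ord0 addr0 addrA /bb /=.
  by congr (_ *: _ + _ *: _ + _ *: _); congr e; apply: val_inj.
have [kd [A [uA AE]]] : exists (kd : (3 <= d)%N) (A : 'M[R]_d), A \in unitmx /\
    forall v : V, (forall j : 'I_d, (3 <= j)%N -> v j 0 = 0) ->
      A *m v = \sum_i v (widen_ord kd i) 0 *: bb i.
  apply: frame_exists => e; rewrite sumE => /(triangle_independent (C := C) Oabc sides)[e0 e1 e2] i.
  case: i => -[|[|[|//]]] lti; [rewrite -[RHS]e0|rewrite -[RHS]e1|rewrite -[RHS]e2];
    by congr e; apply: val_inj.
pose B : @invertible R d := SigSub (@mem_set _ (@invertible R d) A uA).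
exists (act (pgl B) @` std_simplex 2); first by split => //; exists (pgl B).
move=> p; split=> [[_ [v vP <-] <-]|[w [r [s [t [[r0 s0 t0] [<- wE]]]]]]].
  have v0 (j : 'I_d) : (3 <= j)%N -> \val v j 0 = 0.
    by move=> j3; have := vP j; rewrite leqNgt j3 /= => /eqP.
  exists (actGL B v), (\val v (widen_ord kd 0) 0), (\val v (widen_ord kd 1) 0),
    (\val v (widen_ord kd 2%:R) 0).
  split; last by rewrite actE /= AE.
  by split; [have := vP (widen_ord kd 0)|have := vP (widen_ord kd 1)|
    have := vP (widen_ord kd 2%:R)].
pose v : V := \col_j (if val j == 0%N then r else if val j == 1%N then s
   else if val j == 2%N then t else 0).
have v0 : v != 0.
  apply/eqP => /matrixP/(_ (widen_ord kd 0) 0); rewrite !mxE /= => r00.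
  by rewrite r00 ltxx in r0.
exists (pt (nz v0)).
  exists (nz v0) => // j /=; rewrite mxE.
  by case: j => -[|[|[|j]]] ? //=; rewrite eqxx.
rewrite actE; congr pt; apply: val_inj; rewrite /= wE AE; first by rewrite sumE !mxE.
by move=> j; rewrite mxE; case: j => -[|[|[|j]]] ?.
Qed.

(** A limit in the domain of points of the triangle is a nonnegative combination of the
    vertices; no coefficient vanishes as the sides are not in the domain. *)
Lemma triangle_embedded (a b c : V) (S : set (pspace R d)) : ccl C a -> ccl C b -> ccl C c ->
  (forall r s t : R, 0 < r -> 0 < s -> 0 < t -> H (r *: a + s *: b + t *: c)) ->
  (forall s t : R, 0 <= s -> 0 <= t ->
    [/\ ~ cint C (s *: a + t *: b), ~ cint C (s *: b + t *: c) & ~ cint C (s *: a + t *: c)]) ->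
  (forall p, S p <-> exists (w : @nonzero R d) (r s t : R),
      [/\ 0 < r, 0 < s & 0 < t] /\ pt w = p /\ \val w = r *: a + s *: b + t *: c) ->
  properly_embedded core S.
Proof.
move=> Ka Kb Kc inH sides SE.
have Score : S `<=` core.
  move=> p /SE[w [r [s [t [[r0 s0 t0] [<- wE]]]]]].
  by have [_ [w' + cw']] := inH _ _ _ r0 s0 t0; rewrite -wE => /val_inj <-.
split => // Q Qcore; rewrite !compact_ultra => cQ F UF FSQ.
have [|p [Qp Fp]] := cQ F UF; first by apply: filterS FSQ => p [].
exists p; split => //; split => //.
have Op : Omega p by exact: core_sub (Qcore _ Qp).
have clS : closure S p by apply: (cvg_closure (F := F) (u := id)) => //; apply: filterS FSQ => q [].
have clp : closure Omega p by exact: subset_closure.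
have [w [wp wr _ hr]] := rep_spec clp.
have clw : closure (cone_over f S) (rep p).
  by rewrite -wr; apply: pt_closure_over; [rewrite wr hr|rewrite wp].
have nz0 : [/\ a != 0, b != 0 & c != 0].
  have Oabc : O (a + b + c).
    by have := core_cset => /csetO; apply; have := inH 1 1 1 ltr01 ltr01 ltr01; rewrite !scale1r.
  have [s1 s2 s3] := sides 1 1 ler01 ler01; rewrite !scale1r in s1 s2 s3.
  split; apply/eqP => E; move: Oabc; rewrite E ?addr0 ?add0r => Oabc.
  - exact: s2.
  - exact: s3.
  - exact: s1.
case: nz0 => a0 b0 c0.
have ha : 0 < lfun f a := height_gt0 Ka a0.
have hb : 0 < lfun f b := height_gt0 Kb b0.
have hc : 0 < lfun f c := height_gt0 Kc c0.
have [U [UU US Uw]] := closure_ultra clw.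
have [e eP] : exists e : V -> R * R * R, \forall v \near U,
    [/\ 0 < (e v).1.1, 0 < (e v).1.2 & 0 < (e v).2] /\
    v = (e v).1.1 *: a + (e v).1.2 *: b + (e v).2 *: c.
  apply: (near_choice (P := fun v (e : R * R * R) => [/\ 0 < e.1.1, 0 < e.1.2 & 0 < e.2] /\
    v = e.1.1 *: a + e.1.2 *: b + e.2 *: c)).
  apply: filterS US => v [hv [w' w'v /SE[w1 [r [s [t [[r0 s0 t0] [/eq_pt[k k0 E] wE]]]]]]]].
  rewrite -w'v in hv *.
  have k_gt0 : 0 < k.
    have : 0 < lfun f (\val w1) by rewrite wE !lfunD !lfunZ !addr_gt0 ?mulr_gt0.
    by rewrite E lfunZ (pmulr_lgt0 _ hv).
  exists (k^-1 * r, k^-1 * s, k^-1 * t) => /=; split.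
    by rewrite !mulr_gt0 ?invr_gt0.
  have -> : \val w' = k^-1 *: \val w1 by rewrite E scalerA mulVf// scale1r.
  by rewrite wE; mxring.
have hil1 (u : V) : 0 < lfun f u -> height C ((lfun f u)^-1 *: u) = 1.
  by move=> hu; rewrite heightZ mulVf// gt_eqF.
have [|||al [be [ga [al0 be0 ga0 pE]]]] := combo_cvg (U := U) (C := C)
  (al := fun v => (e v).1.1 * lfun f a) (be := fun v => (e v).1.2 * lfun f b)
  (ga := fun v => (e v).2 * lfun f c) (u := id)
  (a := fun=> (lfun f a)^-1 *: a) (b := fun=> (lfun f b)^-1 *: b) (c := fun=> (lfun f c)^-1 *: c)
  _ _ (cvg_cst _) (cvg_cst _) (cvg_cst _) Uw (hil1 _ ha) (hil1 _ hb) (hil1 _ hc) _.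
- by apply: filterS eP => v [[r0 s0 t0] _]; rewrite !mulr_ge0// ltW.
- by apply: nearW => _; split; apply: cclZ; rewrite // invr_ge0 ltW.
- apply: filterS eP => v [_ {1}->]; rewrite !scalerA.
  by rewrite !mulfK ?gt_eqF.
have {}pE : rep p = (al / lfun f a) *: a + (be / lfun f b) *: b + (ga / lfun f c) *: c.
  by rewrite pE !scalerA.
have {}al0 : 0 <= al / lfun f a by rewrite divr_ge0// ltW.
have {}be0 : 0 <= be / lfun f b by rewrite divr_ge0// ltW.
have {}ga0 : 0 <= ga / lfun f c by rewrite divr_ge0// ltW.
move: (al / _) (be / _) (ga / _) al0 be0 ga0 pE => r s t r0 s0 t0 pE.
have Orep : cint C (rep p) by exact: rep_cint.
apply/SE; exists w, r, s, t; split; last by rewrite wr.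
have [s1 s2 s3] : [/\ r != 0, s != 0 & t != 0].
  split; apply/eqP => E; move: Orep; rewrite pE E scale0r ?addr0 ?add0r.
  - by have [] := sides s t s0 t0.
  - by have [] := sides r t r0 t0.
  - by have [] := sides r s r0 s0.
by split; rewrite lt_def ?s1 ?s2 ?s3.
Qed.

Lemma core_cone_O : H `<=` O.
Proof. exact: over_sub core_sub. Qed.

Lemma triangle_coveredP : (exists2 D2 : R, 0 < D2 &
    forall (k : nat) (S : set (pspace R d)), (2 <= k)%N -> simplex k S ->
      properly_embedded core S -> exists2 Y, X Y & S `<=` hnbhd Omega Y D2) ->
  exists2 D, 1 <= D & triangle_covered C H XC D.
Proof.
move=> [D2 D20 cov]; exists (expR (2 * D2)).
  by rewrite -expR0 ler_expR mulr_ge0// ltW.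
move=> a b c Ka Kb Kc inH sides.
have Oabc : O (a + b + c).
  by have := core_cone_O (inH 1 1 1 ltr01 ltr01 ltr01); rewrite !scale1r.
have [S simS SE] := triangle_simplex Oabc sides.
have [Y XY SY] := cov 2%N S isT simS (triangle_embedded Ka Kb Kc inH sides SE).
exists (cone_over f Y); first by exists Y.
move=> r s t r0 s0 t0; have Hv := inH r s t r0 s0 t0.
have [hv [w wv cw]] := Hv.
have Sw : S (pt w) by apply/SE; exists w, r, s, t.
have nw : nb C (expR (2 * D2)) (cone_over f Y) (rep (pt w)).
  by apply: hnbhd_nb; [exact: member_sub XY|exact: SY].
have vE : lfun f (r *: a + s *: b + t *: c) *: rep (pt w) = r *: a + s *: b + t *: c.
  by rewrite /rep chart_coord_pt wv scalerA (divff (lt0r_neq0 hv)) scale1r.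
by rewrite -vE; exact: nbZ (member_cset XY) hv nw.
Qed.

Section OneSimplex.
Variables (k : nat) (A0 : 'M[R]_d) (S : set (pspace R d)).
Hypotheses (uA0 : A0 \in unitmx) (kd : (k < d)%N) (k2 : (2 <= k)%N).

Definition positive (v : V) := forall i : 'I_d,
  if (i <= k)%N then 0 < v i 0 else v i 0 == 0.

Definition nonnegative (v : V) := forall i : 'I_d,
  if (i <= k)%N then 0 <= v i 0 else v i 0 == 0.

Hypothesis SE : forall p, S p <->
  exists (w : @nonzero R d) v, [/\ positive v, \val w = A0 *m v & pt w = p].
Hypothesis emb : properly_embedded core S.

Definition barycenter : V := \col_j ((j <= k)%N)%:R.

Lemma positive_barycenter : positive barycenter.
Proof. by move=> i; rewrite mxE; case: leqP => _; rewrite ?ltr01. Qed.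

Lemma positiveD u v s t : 0 < s -> 0 < t -> positive u -> positive v ->
  positive (s *: u + t *: v).
Proof.
move=> s0 t0 pu pv i; have := pu i; have := pv i; rewrite !mxE.
case: leqP => _; first by move=> vi ui; rewrite addr_gt0// mulr_gt0.
by move=> /eqP-> /eqP->; rewrite !mulr0 addr0.
Qed.

Lemma positive_shift u s : 0 < s -> nonnegative u -> positive (u + s *: barycenter).
Proof.
move=> s0 nu i; have := nu i; have := positive_barycenter i; rewrite !mxE.
case: leqP => _; first by move=> vi ui; rewrite ltr_wpDl// mulr_gt0.
by move=> /eqP-> /eqP->; rewrite !mulr0 addr0.
Qed.

Lemma positive_neq0 v : positive v -> v != 0.
Proof.
move=> pv; apply/eqP => v0; have := pv (Ordinal (leq_ltn_trans (leq0n k) kd)).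
by rewrite /= v0 mxE ltxx.
Qed.

Lemma unit_mulmx_neq0 (A : 'M[R]_d) (v : V) : A \in unitmx -> v != 0 -> A *m v != 0.
Proof.
move=> uA; apply: contra_neq => Av0.
by rewrite -[v](mulKmx uA) Av0 mulmx0.
Qed.

Lemma simplex_height v : positive v -> lfun f (A0 *m v) != 0.
Proof.
move=> pv; have Av0 := unit_mulmx_neq0 uA0 (positive_neq0 pv).
apply: (over_chart (w := nz Av0)); apply: core_sub.
by apply: emb.1; apply/SE; exists (nz Av0), v.
Qed.

Let c0 : R := lfun f (A0 *m barycenter).
Let A : 'M[R]_d := c0 *: A0.

Lemma frame_unit : A \in unitmx.
Proof.
by rewrite unitmxZ// unitfE; exact: simplex_height positive_barycenter.
Qed.

Lemma frame_height v : positive v -> 0 < lfun f (A *m v).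
Proof.
have c00 : c0 != 0 := simplex_height positive_barycenter.
move=> pv; rewrite /A -scalemxAl lfunZ ltNge; apply/negP => neg.
have {}neg : c0 * lfun f (A0 *m v) < 0 by rewrite lt_neqAle neg mulf_neq0// simplex_height.
have := simplex_height (positiveD (s := - (c0 * lfun f (A0 *m v))) (t := c0 ^+ 2) _ _
  positive_barycenter pv).
rewrite mulmxDr -!scalemxAr lfunD !lfunZ -/c0 oppr_gt0 neg lt_def sqr_ge0 sqrf_eq0 c00.
by move=> /(_ isT isT) /eqP; apply; ring.
Qed.

Lemma simplexP p : S p <->
  exists (w : @nonzero R d) v, [/\ positive v, \val w = A *m v & pt w = p].
Proof.
have c00 : c0 != 0 := simplex_height positive_barycenter.
split=> [/SE[w [v [pv wE <-]]]|[w [v [pv wE <-]]]].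
  have Av0 := unit_mulmx_neq0 frame_unit (positive_neq0 pv).
  exists (nz Av0), v; split => //; apply: (@pt_scale _ _ _ _ c0).
  by rewrite /= /A -scalemxAl wE.
apply/SE; have Av0 := unit_mulmx_neq0 uA0 (positive_neq0 pv).
exists (nz Av0), v; split => //; apply/esym; apply: (@pt_scale _ _ _ _ c0).
by rewrite wE /= /A -scalemxAl.
Qed.

Lemma frame_core v : positive v -> H (A *m v).
Proof.
move=> pv; have Av0 := unit_mulmx_neq0 frame_unit (positive_neq0 pv).
split; first exact: frame_height.
by exists (nz Av0) => //; apply: emb.1; apply/simplexP; exists (nz Av0), v.
Qed.

Lemma shift_cvg v (s : R) : A *m (v + `|t| *: barycenter) @[t --> s] -->
  A *m (v + `|s| *: barycenter).
Proof.
apply: mulmx_cvg; apply: (@cvgD _ _ _ (nbhs s)); first exact: cvg_cst.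
apply: (@cvgZr_tmp _ _ _ (nbhs s)); exact: norm_continuous.
Qed.

Lemma frame_closure v : nonnegative v -> closure H (A *m v).
Proof.
move=> nv; apply: (@cvg_closure _ (0 : R)^'+ _ _ (fun t : R => A *m (v + `|t| *: barycenter))).
  near=> t; apply: frame_core; apply: positive_shift => //; rewrite normr_gt0.
  by apply: lt0r_neq0; near: t; exact: nbhs_right_gt.
have c := @shift_cvg v 0; rewrite normr0 scale0r addr0 in c.
exact: cvg_at_right_filter c.
Unshelve. all: by end_near. Qed.

(** If a point of a proper face were in the domain, the segment from it to the
    barycenter would be compact and contained in the core, but would meet the simplex in
    a half-open segment. *)
Lemma frame_boundary v (l : 'I_d) : nonnegative v -> (l <= k)%N -> v l 0 = 0 ->
  ~ O (A *m v).
Proof.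
move=> nv lk vl Ov.
have OA (s : R) : O (A *m (v + `|s| *: barycenter)).
  have [->|s0] := eqVneq s 0; first by rewrite normr0 scale0r addr0.
  by apply: core_cone_O; apply: frame_core; apply: positive_shift; rewrite ?normr_gt0.
have HA (s : R) : H (A *m (v + `|s| *: barycenter)).
  have [->|s0] := eqVneq s 0; last first.
    by apply: frame_core; apply: positive_shift; rewrite ?normr_gt0.
  rewrite normr0 scale0r addr0; apply: (cset_closed core_cset).
  by split; [exact: frame_closure|exact: Ov].
have nA (s : R) : A *m (v + `|s| *: barycenter) != 0.
  by apply: (@lfun_neq0 _ _ f); rewrite gt_eqF//; case: (OA s).
(* the absolute value makes the curve defined and continuous on the whole line *)
pose ga s := pt (nz (nA s)).
have cga : continuous ga by apply: curve_continuous => s; exact: shift_cvg.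
have ga_core s : core (ga s).
  by have [_ [w wE]] := HA s; have -> : w = nz (nA s) by exact: val_inj.
have Score (s : R) : s != 0 -> S (ga s).
  move=> s0; apply/simplexP; exists (nz (nA s)), (v + `|s| *: barycenter); split => //.
  by apply: positive_shift; rewrite ?normr_gt0.
have cptQ : compact (ga @` `[0, 1]%classic).
  by apply: continuous_compact; [exact: continuous_subspaceT|exact: segment_compact].
have [U [UU sU]] := @ultraFilterLemma _ ((0 : R)^'+) _.
have cSQ := emb.2 _ _ cptQ.
have {}cSQ : compact (S `&` ga @` `[0, 1]%classic) by apply: cSQ => _ [s _ <-].
have U01 : \forall s \near U, 0 < s <= 1.
  apply: sU; near=> s; apply/andP; split; near: s; first exact: nbhs_right_gt.
  exact: nbhs_right_le.
(* as the simplex meets the compact segment in a compact set, the points [ga s] converge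
   in the simplex along an ultrafilter of positive [s] tending to [0] *)
have [|q [Sq _] gaq] := ultra_compact_cvg (U := U) (u := ga) cSQ.
  apply: filterS U01 => s /andP[s0 s1]; split; first by apply: Score; rewrite gt_eqF.
  by exists s => //=; rewrite in_itv/= (ltW s0).
have Oq : Omega q by apply: core_sub; exact: emb.1.
have clq : closure Omega q by exact: subset_closure.
have cl0 : closure Omega (ga 0) by apply: subset_closure; exact: core_sub.
have chart x : closure Omega x -> affine_chart f x.
  move=> clx; have [w [<- wr _ hr]] := rep_spec clx.
  by apply/affine_chart_pt; rewrite wr hr oner_eq0.
have c1 : rep (ga s) @[s --> U] --> rep q.
  by move=> W /(chart_coord_continuous (chart _ clq)) /gaq.
have c2 : rep (ga s) @[s --> U] --> rep (ga 0).
  move=> W /(chart_coord_continuous (chart _ cl0)) /cga n0.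
  apply: sU; exact: (cvg_at_right_filter (f := id) (@cvg_id _ (nbhs (0 : R)))) n0.
have E : rep q = rep (ga 0).
  exact: (@cvg_unique _ (@norm_hausdorff _ V) (rep (ga s) @[s --> U])).
have qE : q = ga 0 by apply: (rep_inj (t := 1)) => //; rewrite scale1r.
have /simplexP[w [v' [pv' wE /eq_pt[c c_neq0 /= wE']]]] : S (ga 0) by rewrite -qE.
move: wE'; rewrite wE normr0 scale0r addr0 scalemxAr => /(congr1 (mulmx (invmx A))).
rewrite !mulKmx ?frame_unit// => v'E; have := pv' l; rewrite lk v'E mxE vl mulr0.
by rewrite ltxx.
Unshelve. all: by end_near. Qed.

Lemma frame_bd v (l : 'I_d) : nonnegative v -> v != 0 -> (l <= k)%N -> v l 0 = 0 ->
  bd C H (A *m v).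
Proof.
move=> nv v0 lk vl; split; first exact: frame_closure.
  exact: frame_boundary lk vl.
exact: unit_mulmx_neq0 frame_unit v0.
Qed.

(** All edges lie in the ideal boundary of the core, so one member has all the vertices
    in its ideal boundary by [vertices_in_member]; it contains the simplex by convexity.
    At least three vertices are needed for the edges to be proper faces. *)
Lemma simplex_in_member : disjoint_bd C XC -> segments_in C H XC ->
  exists2 Y, X Y & S `<=` Y.
Proof.
move=> Xb Xc; pose J := {i : 'I_d | (i <= k)%N}.
pose e (i : J) : V := delta_mx (\val i) 0.
have d0 : (0 < d)%N by exact: leq_ltn_trans kd.
have d1 : (1 < d)%N by apply: leq_ltn_trans kd; exact: ltnW.
have d2 : (2 < d)%N by exact: leq_ltn_trans kd.
pose i0 : J := exist _ (Ordinal d0) (leq0n k).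
pose i1 : J := exist _ (Ordinal d1) (ltnW k2 : (1 <= k)%N).
have ene (i : J) : e i != 0.
  by apply/eqP => /matrixP/(_ (\val i) 0); rewrite !mxE !eqxx => /eqP; rewrite oner_eq0.
have epos (i : J) : nonnegative (e i).
  move=> j; rewrite mxE andbT; case: leqP => jk; first by case: (_ == _).
  have [ij|//] := eqVneq j (\val i); move: jk; rewrite ij ltnNge.
  by have := svalP i; rewrite /= => ->.
have eposD (i j : J) : nonnegative (e i + e j).
  move=> l; have -> : (e i + e j) l 0 = e i l 0 + e j l 0 by rewrite mxE.
  have := epos i l; have := epos j l.
  case: leqP => _; first by move=> ? ?; rewrite addr_ge0.
  by move=> /eqP-> /eqP->; rewrite addr0.
have e0 (i : J) (l : 'I_d) : \val i != l -> e i l 0 = 0.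
  by move=> il; rewrite mxE eq_sym (negPf il).
have bde (i : J) : bd C H (A *m e i).
  have [il|il] := eqVneq (\val i) (Ordinal d0).
    by apply: (frame_bd (l := Ordinal d1)) => //; [exact: ltnW|rewrite e0// il].
  by apply: (frame_bd (l := Ordinal d0)) => //; rewrite e0.
have bdD (i : J) : i <> i0 -> bd C H (A *m e i0 + A *m e i).
  move=> ii0; rewrite -mulmxDr.
  have ine : \val i != Ordinal d0.
    by apply/eqP => E; apply: ii0; apply: val_inj.
  have nzD : e i0 + e i != 0.
    apply/eqP => /matrixP/(_ (\val i) 0); rewrite [LHS]mxE (e0 i0) 1?eq_sym// add0r !mxE !eqxx.
    by move=> /eqP; rewrite oner_eq0.
  have [il|il] := eqVneq (\val i) (Ordinal d1).
    apply: (frame_bd (l := Ordinal d2)) => //.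
    by rewrite mxE e0// e0 ?il// addr0.
  apply: (frame_bd (l := Ordinal d1)) => //; first exact: ltnW.
  by rewrite mxE e0// e0 ?addr0.
have [|i t ii0|_ [Y XY <-] clY] := vertices_in_member Xb Xc (i1 := i1) (v := fun i => A *m e i) (i0 := i0) _ bde bdD.
- by move=> /(congr1 (fun i : J => val (\val i))).
- rewrite scalemxAr => /(congr1 (mulmx (invmx A))); rewrite !mulKmx ?frame_unit//.
  move=> /matrixP/(_ (\val i) 0); rewrite [RHS]mxE (e0 i0); last first.
    by apply/eqP => E; apply: ii0; apply: val_inj.
  by rewrite mulr0 mxE !eqxx => /eqP; rewrite oner_eq0.
exists Y => // p /simplexP[w [v [pv wE <-]]].
have cY : cset C (cone_over f Y) by exact: member_cset XY.
have cl0 : closure (cone_over f Y) 0.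
  rewrite (closure_id (closure _)).1; last exact: closed_closure.
  apply: (@cvg_closure _ (0 : R)^'+ _ _ (fun t : R => t *: (A *m e i0))).
    near=> t; apply: (cset_closureZ cY) => //; near: t; exact: nbhs_right_gt.
  apply: cvg_at_right_filter; rewrite -(scale0r (A *m e i0)).
  by apply: (@cvgZr_tmp _ _ _ (nbhs (0 : R))); exact: cvg_id.
have clv : closure (cone_over f Y) (A *m v).
  rewrite (matrix_sum_delta v) mulmx_sumr.
  apply: (big_ind (closure (cone_over f Y)) cl0).
    by move=> x y cx cy; exact: (cset_closureD cY).
  move=> j _; rewrite big_ord1 -scalemxAr; have := pv j.
  case: leqP => [jk vj|_ /eqP->]; last by rewrite scale0r.
  exact: (cset_closureZ cY vj (clY (exist _ j jk))).
have : cone_over f Y (A *m v).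
  by apply: (cset_closed cY); split => //; apply: core_cone_O; exact: frame_core.
by move=> [_ [w']]; rewrite -wE => /val_inj ->.
Unshelve. all: by end_near. Qed.

End OneSimplex.

Lemma simplices_covered : disjoint_bd C XC -> segments_in C H XC ->
  exists2 D2 : R, 0 < D2 &
    forall (k : nat) (S : set (pspace R d)), (2 <= k)%N -> simplex k S ->
      properly_embedded core S -> exists2 Y, X Y & S `<=` hnbhd Omega Y D2.
Proof.
move=> Xb Xc; exists 1 => // k S k2 [kd [g SE]] emb.
have [|Y XY SY] := @simplex_in_member k (\val (mx g)) S (@set_valP _ (@invertible R d) (mx g)) kd k2 _ emb Xb Xc.
  rewrite SE => p; split=> [[_ [v pv <-] <-]|[w [v [pv wE <-]]]].
    by exists (actGL (mx g) v), (\val v); rewrite act_pt.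
  have v0 : v != 0.
    by apply: contraNneq (val_neq0 w) => v0; rewrite wE v0 mulmx0.
  exists (pt (nz v0)); first by exists (nz v0).
  by rewrite act_pt; congr pt; apply: val_inj; rewrite /= wE.
exists Y => // p Sp; apply/hnbhdP; split; first by apply: core_sub; exact: emb.1 Sp.
by exists p; [exact: SY|rewrite /hilbert_dist eqxx].
Qed.

(** * The local Hausdorff topology *)

Lemma local_hausdorff_cvg (I : Type) (U : set_system I) {UF : Filter U}
    (c : I -> closed_subset Omega) (z : closed_subset Omega) :
  (forall B, local_hausdorff_subbase (Omega := Omega) B -> B z -> \forall i \near U, B (c i)) ->
  c i @[i --> U] --> z.
Proof.
move=> near_c W; rewrite nbhsE => -[B [[D' D'sub <-] [A D'A Az]] BW].
have [D0 sD0 AE] := D'sub _ D'A.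
have nA : U [set i | A (c i)].
  rewrite -AE; apply: (@filter_bigI _ _ D0 (fun B : set (closed_subset Omega) => [set i | B (c i)]) U UF).
  move=> B' D0B'; apply: near_c; first exact/set_mem/sD0.
  by move: Az; rewrite -AE; apply.
by apply: filterS nA => i Ai; apply: BW; exists A.
Qed.

Lemma local_hausdorff_nbhs (z : closed_subset Omega) B :
  local_hausdorff_subbase (Omega := Omega) B -> B z -> nbhs z B.
Proof.
move=> sB Bz; apply: open_nbhs_nbhs; split => //.
exists [set B]; first by move=> _ ->; exact: (finI_from1 id sB).
by rewrite bigcup_set1.
Qed.

Lemma cone_over_ulim (I : Type) (U : set_system I) {UU : UltraFilter U} (Y : I -> set V) :
  (forall i, cset C (Y i)) ->
  cone_over f [set p | Omega p /\ ulim C U Y (rep p)] = ulim C U Y.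
Proof.
move=> cY; have cZ : cset C (ulim C U Y) by exact: cset_ulim.
apply/seteqP; split=> v.
  have sub : [set p | Omega p /\ ulim C U Y (rep p)] `<=` closure Omega.
    by move=> p [Op _]; exact: subset_closure.
  move=> /(cone_over_rep sub)[p [t [[Op Zp] t0 ->]]].
  exact: (csetZ cZ).
move=> Zv; have OcO : Omega `<=` closure Omega by exact: subset_closure.
have Ov : O v := csetO cZ Zv.
have [p [t [Op t0 vE]]] := cone_over_rep OcO Ov.
rewrite vE; apply: overZ => //; apply/over_rep; first exact: OcO.
split => //; have -> : rep p = t^-1 *: v by rewrite vE scalerA mulVf ?gt_eqF// scale1r.
by apply: (csetZ cZ) => //; rewrite invr_gt0.
Qed.

Lemma closed_in_ulim (I : Type) (U : set_system I) {UU : UltraFilter U} (Y : I -> set V) :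
  (forall i, cset C (Y i)) -> closed_in Omega [set p | Omega p /\ ulim C U Y (rep p)].
Proof.
move=> cY; split=> [p []//|p [clp Op]]; split => //.
have cZ : cset C (ulim C U Y) by exact: cset_ulim.
have clpO : closure Omega p by exact: subset_closure.
have [w [wp wr _ hr]] := rep_spec clpO.
apply: (cset_closed cZ); split; last exact: rep_cint.
rewrite -(@cone_over_ulim I U UU Y cY) -wr.
by apply: pt_closure_over; [rewrite wr hr|rewrite wp].
Qed.

Lemma member_nonempty Y : X Y -> Y !=set0.
Proof.
move=> XY; have XCY : XC (cone_over f Y) by exists Y.
have [u [_ [/over_pt[w [_ Yw]] _ _]]] := fam_unbounded FX XCY 1.
by exists (pt w).
Qed.

Definition member_closed Y (XY : X Y) : closed_subset Omega :=
  exist _ Y (conj (member_nonempty XY) (let: And4 _ cY _ _ := cvX XY in cY)).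

(** The cones over the sets [Y' i] converge to their limit along the ultrafilter, and by
    [ulim_hausdorff_l] and [ulim_hausdorff_r] the sets converge for the local Hausdorff
    topology. *)
Lemma ultraclosed_of_local_hausdorff : local_hausdorff_closed Omega X ->
  ultraclosed C XC.
Proof.
move=> clX I U Y UU XY [v0 Zv0].
have /choice[Y' Y'P] : forall i, exists Y', X Y' /\ cone_over f Y' = Y i.
  by move=> i; have [Y' XY' E] := XY i; exists Y'.
have XY' i : X (Y' i) by case: (Y'P i).
have YE i : cone_over f (Y' i) = Y i by case: (Y'P i).
have cY i : cset C (Y i) by exact: fam_cset FX _ (XY i).
set Z := ulim C U Y in Zv0 *; have cZ : cset C Z by exact: cset_ulim.
pose Z' := [set p | Omega p /\ Z (rep p)].
have ZE : cone_over f Z' = Z := @cone_over_ulim I U UU Y cY.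
have Z'cl : Z' `<=` closure Omega by move=> p [Op _]; exact: subset_closure.
have Z'0 : Z' !=set0 by move: Zv0; rewrite -ZE => /over_pt[w [_ Zw]]; exists (pt w).
pose z : closed_subset Omega := exist _ Z' (conj Z'0 (@closed_in_ulim I U UU Y cY)).
suff lim : (fun i => member_closed (XY' i)) i @[i --> U] --> z.
  exists Z' => //; apply: (cvg_closed (F := U) clX (u := fun i => member_closed (XY' i)) (l := z)) => //.
  exact: nearW.
apply: local_hausdorff_cvg => _ [C0 [x0 [r0 [e0 [Ox0 r00 e00 ->]]]]].
move=> [ne0 [z0 [[Oz0 Zz0] [_ z0r]]] /hausdorff_distP[e1 e1e [HA HB]]].
pose e := (e0 - e1) / 2; have e_gt0 : 0 < e by rewrite /e; lra.
have e1e0 : e1 + e < e0 by rewrite /e; lra.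
have N1 : 1 < expR (2 * e) by rewrite -expR0 ltr_expR mulr_gt0.
have /(dist_lt_hil _ Ox0 Oz0)[M0 M0M HM0] := z0r.
have Orx := rep_cint Ox0.
have nl := @ulim_hausdorff_l _ _ C I U UU Y cY _ _ _ _ _ Orx M0M N1 Zz0 HM0.
have nr := @ulim_hausdorff_r _ _ C I U UU Y cY _ _ _ _ _ Orx M0M N1 Zz0 HM0.
apply: filterS2 nl nr => i nl nr.
have hl p : Z' p -> hball Omega x0 r0 p ->
    exists q, [/\ Y' i q, hball Omega x0 r0 q & dist p q <= e].
  move=> [Op Zp] [_ pr].
  have [|y [Yy [M' M'M Hy] Hpy]] := nl _ Zp.
    by apply/(dist_le_hil _ Ox0 Op); exact: ltW.
  move: Yy; rewrite -YE => Yy.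
  have [q [t [Yq t0 yE]]] := cone_over_rep (member_sub_closure (XY' i)) Yy.
  have Oq : Omega q := member_sub (XY' i) Yq.
  rewrite yE in Hy Hpy; exists q; split; [exact: Yq| |].
    split; first exact: Oq.
    have Hr := (hilZr C _ _ _ t0).1 Hy.
    exact: ((dist_lt_hil r0 Ox0 Oq).2 (ex_intro2 _ _ M' M'M Hr)).
  exact: ((dist_le_hil e Op Oq).2 ((hilZr C _ _ _ t0).1 Hpy)).
have hr q : Y' i q -> hball Omega x0 r0 q ->
    exists p, [/\ Z' p, hball Omega x0 r0 p & dist q p <= e].
  move=> Yq [Oq qr]; have Yr : Y i (rep q).
    by rewrite -YE; apply/over_rep => //; exact: subset_closure.
  have [|y [Zy [M' M'M Hy] Hqy]] := nr _ Yr.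
    by apply/(dist_le_hil _ Ox0 Oq); exact: ltW.
  move: Zy; rewrite -/Z -ZE => Zy.
  have [p [t [Zp t0 yE]]] := cone_over_rep Z'cl Zy.
  have Op : Omega p by case: Zp.
  rewrite yE in Hy Hqy; exists p; split; [exact: Zp| |].
    split; first exact: Op.
    have Hr := (hilZr C _ _ _ t0).1 Hy.
    exact: ((dist_lt_hil r0 Ox0 Op).2 (ex_intro2 _ _ M' M'M Hr)).
  exact: ((dist_le_hil e Oq Op).2 ((hilZr C _ _ _ t0).1 Hqy)).
have Bz0 : hball Omega x0 r0 z0 by split; [exact: Oz0|exact: z0r].
split; first exact: ne0.
  have [q [Yq Bq _]] := hl z0 (conj Oz0 Zz0) Bz0.
  by exists q; split; [exact: Yq|exact: Bq].
apply/hausdorff_distP; exists (e1 + e); first exact: e1e0.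
split=> [a Aa|q [Yq Bq]].
  have [b [Zb Bb] ab] := HA _ Aa; have [q [Yq Bq bq]] := hl _ Zb Bb.
  exists q; first by split; [exact: Yq|exact: Bq].
  have [_ [Oa _]] := Aa; have [Ob _] := Bb; have [Oq _] := Bq.
  apply: (le_lt_trans (dist_triangle Oa Ob Oq)).
  exact: ltr_leD.
have [b [Zb Bb qb]] := hr _ Yq Bq; have [a Aa ba] := HB b (conj Zb Bb).
exists a; first exact: Aa.
have [_ [Oa _]] := Aa; have [Ob _] := Bb; have [Oq _] := Bq.
apply: (le_lt_trans (dist_triangle Oq Ob Oa)).
by rewrite [e1 + e]addrC; exact: ler_ltD.
Qed.

(** An ultrafilter on the family that converges to [z] has the cone over [z] as limit:
    the basic neighbourhoods of [z] centred at a point [p] compare, near [p], the members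
    with [z]. As members are isolated, [z] is one of them. *)
Lemma local_hausdorff_of_overlap : bounded_overlap C XC -> local_hausdorff_closed Omega X.
Proof.
move=> ov; apply/closure_id/seteqP; split=> [|z clz]; first exact: subset_closure.
have [U [UU US Uz]] := closure_ultra clz.
have [c0 Xc0] := near_ex US.
have [Z0 [ZO Zcl]] := svalP z; set Z := sval z in Z0 ZO Zcl *.
pose Y' (c : closed_subset Omega) := if `[< X (sval c) >] then sval c else sval c0.
have XY' c : X (Y' c) by rewrite /Y'; case: asboolP.
pose Y c := cone_over f (Y' c).
have XY c : XC (Y c) by exists (Y' c).
have cY c : cset C (Y c) by exact: fam_cset FX _ (XY c).
have ZcO : Z `<=` closure Omega by move=> p /ZO; exact: subset_closure.
have near_basic x0 r0 e : Omega x0 -> 0 < r0 -> 0 < e -> Z `&` hball Omega x0 r0 !=set0 ->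
    \forall c \near U, (forall p, Z p -> hball Omega x0 r0 p ->
        exists q, [/\ Y' c q, Omega q & dist p q < e]) /\
      (forall q, Y' c q -> hball Omega x0 r0 q -> exists p, [/\ Z p, Omega p & dist q p < e]).
  move=> Ox0 r00 e0 ne.
  have nb : nbhs z (hausdorff_basic z x0 r0 e).
    apply: local_hausdorff_nbhs; first by exists z, x0, r0, e.
    split; [exact: ne|exact: ne|].
    apply/hausdorff_distP; exists (e / 2); first by lra.
    by split=> a Aa; (exists a; first exact: Aa); rewrite distxx divr_gt0.
  have Ub : \forall c \near U, hausdorff_basic z x0 r0 e c by exact: Uz.
  apply: filterS2 Ub US => c [_ _ /hausdorff_distP[e1 e1e [HA HB]]] Xc.
  have -> : Y' c = sval c by rewrite /Y' asboolT.
  split=> [p Zp Bp|q Yq Bq].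
    have [q [Yq [Oq _]] pq] := HA p (conj Zp Bp).
    by exists q; split; [exact: Yq|exact: Oq|exact: lt_trans e1e].
  have [p [Zp [Op _]] qp] := HB q (conj Yq Bq).
  by exists p; split; [exact: Zp|exact: Op|exact: lt_trans e1e].
have cL : cset C (ulim C U Y) by exact: cset_ulim.
have EZ : ulim C U Y = cone_over f Z.
  apply/seteqP; split=> [v Zv|v].
    have Ov := csetO cL Zv.
    have OcO : Omega `<=` closure Omega by exact: subset_closure.
    have [p [t [Op t0 vE]]] := cone_over_rep OcO Ov.
    rewrite vE; apply: overZ => //; apply/over_rep; first exact: OcO.
    have {}Zv : ulim C U Y (rep p).
      have -> : rep p = t^-1 *: v by rewrite vE scalerA mulVf ?gt_eqF// scale1r.
      by apply: (csetZ cL) => //; rewrite invr_gt0.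
    apply: Zcl; split => //.
    have [w [wp wr _ hr]] := rep_spec (OcO _ Op).
    rewrite -wp; apply: (@over_closure_pt _ _ f); rewrite wr => W nW.
    have [e e0 eW] := nbhs_dist Op nW.
    have [z0 Zz0] := Z0; have Oz0 := ZO _ Zz0.
    pose r0 := `|dist p z0| + e + 1.
    have r00 : 0 < r0 by rewrite /r0; have := normr_ge0 (dist p z0); lra.
    have ne : Z `&` hball Omega p r0 !=set0.
      exists z0; split; first exact: Zz0.
      split; first exact: Oz0.
      rewrite /r0.
      by have := ler_norm (dist p z0); lra.
    have e20 : 0 < e / 2 by lra.
    have near1 := near_basic _ _ _ Op r00 e20 ne.
    have M1 : 1 < expR (2 * (e / 4)).
      by rewrite -expR0 ltr_expR mulr_gt0// divr_gt0.
    have near2 : \forall c \near U, nb C (expR (2 * (e / 4))) (Y c) (rep p).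
      exact: (ulim_near cY Zv (cvg_cst _) M1).
    have [c [[_ hr'] nbc]] := near_ex (filterI near1 near2).
    have cYO : Y' c `<=` Omega := member_sub (XY' c).
    have e42 : e / 4 < e / 2 by lra.
    have /hnbhdP[_ [q Yq pq]] := nb_hnbhd cYO Op e42 nbc.
    have Oq := cYO _ Yq.
    have e2r : e / 2 < r0 by rewrite /r0; have := normr_ge0 (dist p z0); lra.
    have [q' [Zq' Oq' qq']] := hr' q Yq (conj Oq (lt_trans pq e2r)).
    exists (rep q'); split; first by apply/over_rep => //; exact: ZcO.
    apply: (eW _ Oq'); apply: (le_lt_trans (dist_triangle Op Oq Oq')).
    by rewrite [e in _ < e]splitr; exact: ltrD.
  move=> /(cone_over_rep ZcO)[p [t [Zp t0 ->]]]; have Op := ZO _ Zp.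
  apply: (csetZ cL) => //.
  split; first exact: rep_cint.
  move=> W nW; have [e e0 eW] := nbhs_dist Op nW.
  have Bp : hball Omega p 1 p by split; [exact: Op|rewrite distxx].
  have ne : Z `&` hball Omega p 1 !=set0 by exists p.
  apply: filterS (near_basic _ _ _ Op ltr01 e0 ne) => c [hl _].
  have [q [Yq Oq pq]] := hl p Zp Bp.
  exists (rep q); split; last exact: (eW _ Oq pq).
  by apply/over_rep => //; exact: subset_closure.
have [|XZ _] := fam_isolated FX ov (U := U) XY.
  have [p Zp] := Z0; exists (rep p); rewrite EZ.
  by apply/over_rep => //; exact: ZcO.
rewrite EZ in XZ; have [Y1 XY1 E] := XZ.
rewrite /= -/Z; suff -> : Z = Y1 by [].
apply/esym; apply: (cone_over_inj) E => //.
exact: member_sub_closure XY1.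
Qed.

(** * The boundary quotients *)

Section Quotients.
Hypotheses (ov : bounded_overlap C XC) (Xb : disjoint_bd C XC)
  (Xc : segments_in C H XC).

(** An open segment can be prolonged a little beyond each of its points, so a small
    multiple of either point can be subtracted from the other one within the closed
    cone. *)
Lemma face_hil x y : closure Omega x -> face Omega x y ->
  exists M, hil C M (rep x) (rep y).
Proof.
move=> clx [->|[cly [l [[conn [x0 [y0 [_ [U oU lE]]]]] lO lx ly]]]].
  by exists 1; apply: hil_refl => //; exact: rep_K.
have [->|nxy] := pselect (x = y).
  by exists 1; apply: hil_refl => //; exact: rep_K.
have line p : l p -> closure Omega p -> exists a b,
    rep p = a *: \val (vec x0) + b *: \val (vec y0).
  rewrite lE => -[[a [b E]] _] clp.
  exists ((lform f p)^-1 * a), ((lform f p)^-1 * b).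
  by rewrite /rep /chart_coord E scalerDr !scalerA.
have beyond p q : l p -> l q -> exists2 e, 0 < e & K (rep p - e *: rep q).
  move=> lp lq; have clp := lO _ lp; have clq := lO _ lq.
  have [a1 [b1 pE]] := line p lp clp; have [a2 [b2 qE]] := line q lq clq.
  have [w [wp wr _ hr]] := rep_spec clp.
  have nU : nbhs w (@pt R d @^-1` U).
    apply: pt_continuous; apply: open_nbhs_nbhs; split => //.
    by move: lp; rewrite lE -wp => -[].
  have [B Bw BU] := nbhs_nz nU; rewrite wr in Bw.
  have c : rep p - e *: rep q @[e --> 0^'+] --> rep p.
    apply: cvg_at_right_filter; rewrite -[X in _ --> X]subr0 -(scale0r (rep q)).
    apply: (@cvgB _ _ _ (nbhs (0 : R))); first exact: cvg_cst.
    by apply: (@cvgZr_tmp _ _ _ (nbhs (0 : R))); exact: cvg_id.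
  have e0 : \forall e \near (0 : R)^'+, 0 < e by exact: nbhs_right_gt.
  have e1 : \forall e \near (0 : R)^'+, e < 1 by apply: nbhs_right_lt.
  have [e [[e_gt0 e_lt1] Be]] := near_ex (filterI (filterI e0 e1) (c _ Bw)).
  exists e => //.
  have hz : 0 < lfun f (rep p - e *: rep q).
    rewrite lfunD lfunN (lfunZ _ e) (rep_h clp) (rep_h clq).
    by rewrite mulr1 subr_gt0.
  have z0 : rep p - e *: rep q != 0 by apply: (@lfun_neq0 _ _ f); rewrite gt_eqF.
  have lz : l (pt (nz z0)).
    rewrite lE; split; last exact: BU.
    have [k k0 kE] := vec_pt (nz z0).
    exists (k * (a1 - e * a2)), (k * (b1 - e * b2)); rewrite kE /= pE qE; mxring.
  exact: ((closure_domainP (w := nz z0) hz).1 (lO _ lz)).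
have [e e0 Ke] := beyond x y lx ly; have [e' e'0 Ke'] := beyond y x ly lx.
exists (e'^-1 / e), e'^-1; first by rewrite invr_gt0.
split.
  have -> : e'^-1 *: rep y - rep x = e'^-1 *: (rep y - e' *: rep x).
    by move: (rep x) (rep y) => a b; mxfield; exact: lt0r_neq0.
  by apply: (@cclZ _ _ C); [rewrite invr_ge0 ltW|].
have -> : (e'^-1 / e) *: rep x - e'^-1 *: rep y = (e'^-1 / e) *: (rep x - e *: rep y).
  by move: (rep x) (rep y) => a b; mxfield; rewrite !lt0r_neq0.
apply: (@cclZ _ _ C); last exact: Ke.
by apply: divr_ge0; [rewrite invr_ge0|]; exact: ltW.
Qed.

(** The two points are equal or span a segment of the ideal boundary of the core, which
    lies in a member; that member shares the ideal point [a] with [Z]. *)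
Lemma comparable_member (Z : set V) a b M : XC Z -> bd C Z a -> bd C H b ->
  hil C M a b -> bd C Z b.
Proof.
move=> XZ ba bb ab; have cZ := fam_cset FX XZ.
have bHa := bd_fam_hull FX XZ ba.
have ha := bd_height (csetO cZ) ba.
have [cla _ _] := ba; have [_ nb b0] := bb.
have [[t t0 bE]|nprop] := pselect (exists2 t, 0 < t & b = t *: a).
  split; [|exact: nb|exact: b0].
  by rewrite bE; exact: (cset_closureZ cZ t0 cla).
have np t : 0 < t -> b <> t *: a by move=> t0 bE; apply: nprop; exists t.
have [Z' XZ' [cla' clb']] := Xc bHa bb (bd_sum_comparable GH ha bHa bb ab) np.
have ba' : bd C Z' a by case: ba => _ na a0; split.
by rewrite (Xb XZ XZ' ba ba'); split.
Qed.

Lemma face_ideal_boundary Y x y : X Y -> ideal_boundary Omega Y x ->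
  ideal_boundary Omega core y -> face Omega x y -> ideal_boundary Omega Y y.
Proof.
move=> XY Yx cy fxy.
have [clx bx] := (ideal_boundary_rep x (member_sub XY)).1 Yx.
have [cly by_] := (ideal_boundary_rep y core_sub).1 cy.
have [M HM] := face_hil clx fxy.
apply/(ideal_boundary_rep y (member_sub XY)); split; first exact: cly.
have XCY : XC (cone_over f Y) by exists Y.
exact: comparable_member XCY bx by_ HM.
Qed.

Lemma face_common_member x y : ideal_boundary Omega core x -> ideal_boundary Omega core y ->
  face Omega x y -> x <> y ->
  exists Y, [/\ X Y, ideal_boundary Omega Y x & ideal_boundary Omega Y y].
Proof.
move=> cx cy fxy nxy.
have [clx bx] := (ideal_boundary_rep x core_sub).1 cx.
have [cly by_] := (ideal_boundary_rep y core_sub).1 cy.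
have [M HM] := face_hil clx fxy.
have cH : cset C H := core_cset.
have hx := bd_height (csetO cH) bx.
have [|_ [Y XY <-] [Yx Yy]] := Xc bx by_ (bd_sum_comparable GH hx bx by_ HM).
  by move=> t t0 E; apply: nxy; apply/esym; exact: rep_inj E.
exists Y; split; [exact: XY| |].
  apply/(ideal_boundary_rep x (member_sub XY)).
  by split; [exact: clx|case: bx].
apply/(ideal_boundary_rep y (member_sub XY)).
by split; [exact: cly|case: by_].
Qed.

(** Ideal points are limits of the stabilizer by [stab_limit]. Conversely, an orbit of
    the stabilizer stays at bounded distance from the orbit of a point of [Y], which
    remains in [Y]; so each limit point is comparable to an ideal point of [Y]. *)
Lemma limit_set_stab Y : X Y ->
  limit_set Omega (family_stab Gamma Y) = ideal_boundary Omega Y.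
Proof.
move=> XY; have YO := member_sub XY.
have YcO := member_sub_closure XY.
have XCY : XC (cone_over f Y) by exists Y.
have cY := fam_cset FX XCY.
apply/seteqP; split=> y; last first.
  move=> Yy; have [cly by_] := (ideal_boundary_rep y YO).1 Yy.
  have [U [A [t [p [UU Op UA cv]]]]] := stab_limit GH FX ov XCY by_.
  have hy : height C (rep y) = 1 := rep_h cly.
  rewrite hy invr1 scale1r in cv.
  have [_ [w wp Ow]] := Op.
  split; first by case: Yy.
  exists (pt w); first exact: Ow.
  have [w' [w'y w'r _ hr]] := rep_spec cly.
  rewrite -w'y; apply: (@over_closure_pt _ _ f); rewrite w'r.
  apply: cvg_closure cv; apply: filterS UA => i [[g Gg lA] AY ti].
  apply: overZ; first exact: ti.
  have [w1 w1A w1p] := lift_act w lA.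
  have cA : cone_aut C (A i) := lift_cone_aut (GammaAut Gg) lA.
  have Oi : cint C (A i *m p) := autO cA Op.
  split; first exact: (cint_height Oi).
  exists w1; first by rewrite w1A wp.
  rewrite w1p; exists g; last by [].
  split; first exact: Gg.
  apply: (cone_over_inj); [|exact: YcO|].
    by move=> _ [q /YcO clq <-]; exact: (Gamma_closure Gg).
  by rewrite (lift_over lA YcO) AY.
move=> [bdy [p Op clp]].
have [cly nO] : closure Omega y /\ ~ Omega y by move: bdy; rewrite boundaryE => -[].
have [w [wy wr _ hr]] := rep_spec cly.
have [q Yq] := member_nonempty XY.
have Oq := YO _ Yq.
have Orp : cint C (rep p) := rep_cint Op.
have Orq : cint C (rep q) := rep_cint Oq.
have Yrq : cone_over f Y (rep q).
  by apply/over_rep; [exact: YcO|].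
have [M M1 HM] := hil_exists Orp Orq.
have cl : closure (cone_over f [set act g p | g in family_stab Gamma Y]) (rep y).
  by rewrite -wr; apply: pt_closure_over; [rewrite wr hr|rewrite wy].
have nOy : ~ cint C (rep y).
  by move=> /(over_rep Omega cly).
have Hy : bd C H (rep y).
  split; [|exact: nOy|by rewrite -wr; exact: val_neq0].
  apply: (limit_closure_core).
  apply/over_rep; first exact: cly.
  split; first exact: bdy.
  exists p; first exact: Op.
  apply: closure_subset clp => _ [g [Gg _] <-]; by exists g.
have [U [UU US Uy]] := closure_ultra cl.
(* replace each point of the orbit of [p] by the point of the orbit of [q] for the same
   element of the stabilizer *)
have [u uP] : exists u : V -> V, \forall v \near U, cone_over f Y (u v) /\ hil C M v (u v).
  apply: (near_choice (P := fun v u => cone_over f Y u /\ hil C M v u)).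
  apply: filterS US => v [hv [w1 w1v [g [Gg gY] gp]]].
  have [A lA GA] := group_lift Gg.
  have cA := group_aut GA.
  exists (A *m rep q); split.
    rewrite -gY (lift_over lA YcO); exists (rep q); [exact: Yrq|by []].
  have [c c0 E] := lift_preimage lA hv (subset_closure Op) (ex_intro2 _ _ w1 w1v (esym gp)).
  have := aut_hil cA HM; rewrite E => HM'.
  exact: ((hilZl C _ _ _ c0).1 HM').
have [|t [l [t0 Kl hl tl]]] := @ultra_scale _ _ C _ U UU u.
  apply: filterS uP => v [Yu _]; have Ou := csetO cY Yu.
  by split; [exact: cint_ccl Ou|exact: cint_nz Ou].
have yl : hil C M (rep y) l.
  apply: (hil_cvg _ Uy tl); last by rewrite hl.
    by apply: filterS2 uP t0 => v [_ vu] tv; exact: ((hilZr C _ _ _ tv).2 vu).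
  have -> : height C (rep y) = 1 by exact: (rep_h cly).
  exact: ltr01.
have M0 : 0 < M by exact: lt_le_trans M1.
have bl : bd C (cone_over f Y) l.
  split.
  - apply: cvg_closure tl; apply: filterS2 uP t0 => v [Yu _] tv.
    exact: (csetZ cY).
  - exact: (bd_hil_nO nOy M0 yl).
  - by apply: (@height_neq0 _ _ C); rewrite hl.
apply/(ideal_boundary_rep y YO); split; first exact: cly.
exact: comparable_member XCY bl Hy (hil_sym M0 yl).
Qed.

Lemma conj_family_stab g Y : Gamma g ->
  conj_subgroup g (family_stab Gamma Y) = family_stab Gamma (act g @` Y).
Proof.
move=> Gg; apply/seteqP; split=> [_ [h [Gh hY] <-]|h [Gh hY]].
  split; first by apply: GammaM; [exact: GammaM|exact: GammaV].
  by rewrite act_image_comp -mulgA mulVg mulg1 -act_image_comp hY.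
exists (g^-1 * h * g)%g; last by rewrite !mulgA mulgV mul1g -mulgA mulgV mulg1.
split.
  by apply: GammaM => //; apply: GammaM => //; exact: GammaV.
by rewrite -act_image_comp -act_image_comp hY act_image_comp mulVg act_image1.
Qed.

(** The limit sets of the conjugates of the representatives are the ideal boundaries of
    the members. Points with the same face, and points of faces of ideal points of a
    member, are already identified by these sets. *)
Lemma same_boundary_quotient P :
  conj_representatives Gamma [set family_stab Gamma Y | Y in X] P ->
  same_quotient (subgroup_rel Omega core Gamma P) (family_rel Omega core X).
Proof.
move=> [PX rP]; apply: same_quotient_of_equiv => x y.
  move=> [g [S [Gg PS Lx Ly]]]; have [Y XY YS] := PX _ PS.
  rewrite -YS (conj_family_stab Y Gg) (limit_set_stab (family_act Gg XY)) in Lx Ly.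
  apply: rst_step; left; exists (act g @` Y); first exact: (family_act Gg XY).
  split; [exists (\val x)|exists (\val y)] => //; by left.
have both Y : X Y -> ideal_boundary Omega Y (\val x) -> ideal_boundary Omega Y (\val y) ->
    clos_refl_sym_trans _ (subgroup_rel Omega core Gamma P) x y.
  move=> XY Yx Yy; have [S [[PS [g Gg E]] _]] := rP _ (ex_intro2 _ _ Y XY erefl).
  apply: rst_step; exists g, S; split; [exact: Gg|exact: PS| |];
    by rewrite -E limit_set_stab.
have cx : ideal_boundary Omega core (\val x) := set_valP x.
have cy : ideal_boundary Omega core (\val y) := set_valP y.
move=> [[Y XY [[z1 Yz1 fx] [z2 Yz2 fy]]]|fxy].
  by apply: (both Y XY); [exact: face_ideal_boundary Yz1 cx fx|exact: face_ideal_boundary Yz2 cy fy].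
have [/val_inj->|nxy] := pselect (\val x = \val y); first exact: rst_refl.
have fy : face Omega (\val x) (\val y) by rewrite fxy; left.
by have [Y [XY Yx Yy]] := face_common_member cx cy fy nxy; exact: (both Y XY).
Qed.

End Quotients.

End ConvexDomain.

(** * Characterization of peripheral families *)

Theorem proposition1p8 (R : realType) (d : nat)
    (Omega : set (pspace R d)) (Gamma : set (PGL R d))
    (X : set (set (pspace R d))) :
  properly_convex_domain Omega ->
  convex_cocompact Omega Gamma ->
  invariant_family Gamma X ->
  convex_family Omega (core Omega Gamma) X ->
  (peripheral_family Omega (core Omega Gamma) Gamma X <->
   [/\ local_hausdorff_closed Omega X,
       forall X1 X2, X X1 -> X X2 -> X1 <> X2 ->
         ideal_boundary Omega X1 `&` ideal_boundary Omega X2 = set0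
     & forall l, nontrivial_segment l ->
         l `<=` ideal_boundary Omega (core Omega Gamma) ->
         exists2 Y, X Y & l `<=` ideal_boundary Omega Y])
  /\
  (peripheral_family Omega (core Omega Gamma) Gamma X ->
   forall P : set (set (PGL R d)),
     conj_representatives Gamma [set family_stab Gamma Y | Y in X] P ->
     same_quotient
       (subgroup_rel Omega (core Omega Gamma) Gamma P)
       (family_rel Omega (core Omega Gamma) X)).
Proof.
move=> [oO [f chartO]] cc invX cvX.
have Omega0 : Omega !=set0 by case: cc => _ _ _ [p [Op _]] _; exists p.
pose GH := core_action oO chartO Omega0 cc.
pose FX := core_family oO chartO Omega0 invX cvX.
have necessary : peripheral_family Omega (core Omega Gamma) Gamma X ->
    [/\ bounded_overlap (domain_cone oO chartO Omega0) (cone_family f X),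
      forall X1 X2, X X1 -> X X2 -> X1 <> X2 ->
         ideal_boundary Omega X1 `&` ideal_boundary Omega X2 = set0
     & forall l, nontrivial_segment l ->
         l `<=` ideal_boundary Omega (core Omega Gamma) ->
         exists2 Y, X Y & l `<=` ideal_boundary Omega Y].
  move=> [_ _ overlap covered].
  have ov := (bounded_overlapP oO chartO Omega0 cvX).1 overlap.
  have [D D1 tri] := triangle_coveredP oO chartO Omega0 cvX covered.
  split; first exact: ov.
    exact: (disjoint_bdP oO chartO Omega0 cvX).2 (disjoint_of_overlap FX ov).
  apply: (segments_of_faces cvX (oO := oO) (chartO := chartO) (Omega0 := Omega0)).
  by move=> x y0 M; exact: (face_in_member GH FX D1 tri ov).
split.
  split=> [/necessary[ov disj seg]|[closedX disj seg]].
    split; [|exact: disj|exact: seg].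
    exact: local_hausdorff_of_overlap invX cvX ov.
  have uc := ultraclosed_of_local_hausdorff (oO := oO) (chartO := chartO) (Omega0 := Omega0) invX cvX closedX.
  have db := (disjoint_bdP oO chartO Omega0 cvX).1 disj.
  have sg := segments_inP (oO := oO) (chartO := chartO) (Omega0 := Omega0) cvX seg.
  have ov := overlap_of_closed GH FX uc db sg.
  split; [exact: cvX|exact: invX| |].
    exact: (bounded_overlapP oO chartO Omega0 cvX).2 ov.
  exact: simplices_covered cvX db sg.
move=> /necessary[ov disj seg] P repP.
apply: (same_boundary_quotient (oO := oO) (chartO := chartO) (Omega0 := Omega0) cc invX cvX ov).
- exact: (disjoint_bdP oO chartO Omega0 cvX).1 disj.
- exact: (segments_inP (oO := oO) (chartO := chartO) (Omega0 := Omega0) cvX seg).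
- exact: repP.
Qed.
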